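(* In the setting described in the context (with $M\to+\infty$, $N\to+\infty$, $c_N=ML/N\to c\in(0,+\infty)$), let $(\mathbf{T}_N(z),\widetilde{\mathbf{T}}_N(z))$ be the unique pair in $\mathcal{S}_{ML}(\mathbb{R}^+)\times\mathcal{S}_N(\mathbb{R}^+)$ satisfying, for each $z\in\mathbb{C}\setminus\mathbb{R}^+$, $$\mathbf{T}_N(z)=-\frac1z\left(\mathbf{I}_{ML}+\Psi\left(\widetilde{\mathbf{T}}_N^{T}(z)\right)\right)^{-1},\qquad \widetilde{\mathbf{T}}_N(z)=-\frac1z\left(\mathbf{I}_{N}+c_N\overline{\Psi}^{T}\left(\mathbf{T}_N(z)\right)\right)^{-1}.$$ Then for every sequence $(\mathbf{A}_N)_{N\ge1}$ of deterministic $ML\times ML$ matrices with $\sup_N\|\mathbf{A}_N\|<+\infty$ and for each $z\in\mathbb{C}\setminus\mathbb{R}^+$, $$\frac{1}{ML}\mathrm{tr}\left(\left(\mathbf{Q}_N(z)-\mathbf{T}_N(z)\right)\mathbf{A}_N\right)\longrightarrow 0\quad\text{almost surely as } N\to+\infty.$$ In particular, $\frac{1}{ML}\mathrm{tr}\,\mathbf{Q}_N(z)-\frac{1}{ML}\mathrm{tr}\,\mathbf{T}_N(z)\to0$ almost surely for each $z\in\mathbb{C}\setminus\mathbb{R}^+$.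
   Context: Dimensions: $M=M_N$ and $L=L_N$ are positive integers indexed by $N\ge 1$, with $M\to+\infty$ and $c_N=\frac{ML}{N}\to c$, $0<c<+\infty$, as $N\to+\infty$. Spectral densities: for each $M$, $\mathcal{S}_1,\ldots,\mathcal{S}_M$ are positive functions on $[0,1]$ and $r_m(k)=\int_0^1\mathcal{S}_m(\nu)e^{2\mathrm{i}\pi\nu k}d\nu$, $k\in\mathbb{Z}$. It is assumed that $\sup_M\sum_{n\in\mathbb{Z}}\left(\frac1M\sum_{m=1}^M|r_m(n)|^2\right)^{1/2}<+\infty$ (so each $\mathcal{S}_m$ is continuous), $\sup_M\sup_{m\le M}\max_{\nu}\mathcal{S}_m(\nu)<+\infty$ and $\inf_M\inf_{m\le M}\min_{\nu}\mathcal{S}_m(\nu)>0$. Random matrix: for each $N$, $(w_{m,N}(n))_{m=1,\ldots,M,\,n=1,\ldots,N+L-1}$ are jointly (circularly symmetric) complex Gaussian zero-mean random variables with $\mathbb{E}[w_{m,N}(k)w_{m',N}^*(k')]=\frac{r_m(k-k')}{N}\delta_{m-m'}$ (so different $m$ are independent), all defined on a common probability space. $\mathbf{W}_{m,N}$ is the $L\times N$ Hankel matrix with entries $\{\mathbf{W}_{m,N}\}_{i,j}=w_{m,N}(i+j-1)$, and $\mathbf{W}_N=[\mathbf{W}_{1,N}^T,\ldots,\mathbf{W}_{M,N}^T]^T$ is $ML\times N$. $\mathbf{Q}_N(z)=(\mathbf{W}_N\mathbf{W}_N^H-z\mathbf{I}_{ML})^{-1}$. $(\cdot)^H$ is conjugate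 transpose, $\|\cdot\|$ the spectral norm. Operators: $\mathbf{d}_R(\nu)=(1,e^{2\mathrm{i}\pi\nu},\ldots,e^{2\mathrm{i}\pi(R-1)\nu})^T$, $\mathbf{a}_R(\nu)=\mathbf{d}_R(\nu)/\sqrt R$. For an $R\times R$ matrix $\mathbf{M}$, $\Psi_K^{(m)}(\mathbf{M})=\int_0^1\mathcal{S}_m(\nu)\,\mathbf{a}_R^H(\nu)\mathbf{M}\mathbf{a}_R(\nu)\,\mathbf{d}_K(\nu)\mathbf{d}_K^H(\nu)\,d\nu$, a $K\times K$ matrix. For an $N\times N$ matrix $\mathbf{M}$, $\Psi(\mathbf{M})$ is the $ML\times ML$ block-diagonal matrix with $m$-th $L\times L$ diagonal block $\Psi_L^{(m)}(\mathbf{M})$. For an $ML\times ML$ matrix $\mathbf{M}$ with $m$-th $L\times L$ diagonal block $\mathbf{M}^{m,m}$, $\overline{\Psi}(\mathbf{M})=\frac1M\sum_{m=1}^M\Psi_N^{(m)}(\mathbf{M}^{m,m})$ ($N\times N$), and $\overline{\Psi}^T(\mathbf{M})$ denotes its transpose. Class $\mathcal{S}_K(\mathbb{R}^+)$: the set of $K\times K$ matrix-valued functions on $\mathbb{C}\setminus\mathbb{R}^+$ of the form $\int_{\mathbb{R}^+}\frac{d\boldsymbol\mu(\lambda)}{\lambda-z}$, where $\boldsymbol\mu$ is a positive $K\times K$ matrix-valued measure carried by $\mathbb{R}^+$ with $\boldsymbol\mu(\mathbb{R}^+)=\mathbf{I}_K$. (Existence and uniqueness of the pair $(\mathbf{T}_N,\widetilde{\mathbf{T}}_N)$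 is known.) *)

(* Defs.v *)
From mathcomp Require Import all_boot all_order all_algebra.
From mathcomp Require Import all_classical all_reals all_analysis.
From mathcomp Require Import complex.
Import Order.TTheory GRing.Theory Num.Theory Normc.
Import numFieldNormedType.Exports.

Set Implicit Arguments.
Unset Strict Implicit.
Unset Printing Implicit Defensive.

Local Open Scope classical_set_scope.
Local Open Scope ring_scope.
Local Open Scope complex_scope.
Local Open Scope sesquilinear_scope.

Definition expi {R : realType} (t : R) : R[i] := cos t +i* sin t.

Definition cintegral d {T : measurableType d} {R : realType}
    (mu : {measure set T -> \bar R}) (D : set T) (f : T -> R[i]) : R[i] :=
  (\int[mu]_(x in D) complex.Re (f x)) +i* (\int[mu]_(x in D) complex.Im (f x)).

Definition mxintegral d {T : measurableType d} {R : realType}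
    (mu : {measure set T -> \bar R}) (D : set T) m n (F : T -> 'M[R[i]]_(m, n)) :
    'M[R[i]]_(m, n) :=
  \matrix_(i, j) cintegral mu D (fun x => F x i j).

Definition cexpectation d {T : measurableType d} {R : realType}
    (P : probability T R) (X : T -> R[i]) : R[i] :=
  fine 'E_P[fun t => complex.Re (X t)] +i* fine 'E_P[fun t => complex.Im (X t)].

Definition l2norm {R : realType} n (x : 'cV[R[i]]_n) : R :=
  Num.sqrt (\sum_(i < n) normc (x i 0) ^+ 2).

Definition spectral_norm {R : realType} m n (A : 'M[R[i]]_(m, n)) : R :=
  sup [set l2norm (A *m x) | x in [set x : 'cV[R[i]]_n | l2norm x <= 1]].

(* Gaussian distributions may be degenerate.  The case s = 0 is treated apart
   because normal_prob m 0 is, by convention, a uniform distribution. *)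
Definition gaussian_rv d {T : measurableType d} {R : realType}
    (P : probability T R) (X : T -> R) : Prop :=
  measurable_fun setT X /\
  exists m s : R, forall B : set (measurableTypeR R), measurable B ->
    P (X @^-1` B) = if s == 0 then \d_m B else normal_prob m s B.

Definition jointly_gaussian d {T : measurableType d} {R : realType}
    (P : probability T R) (I : finType) (w : I -> T -> R[i]) : Prop :=
  forall a b : I -> R, gaussian_rv P (fun t =>
    \sum_i (a i * complex.Re (w i t) + b i * complex.Im (w i t))).

(* For every theta, (e^{i theta} w_i)_i has the same law as (w_i)_i; the laws
   are compared on measurable rectangles of (R * R)^I, R[i] being identified
   with R * R. *)
Definition circularly_symmetric d {T : measurableType d} {R : realType}
    (P : probability T R) (I : finType) (w : I -> T -> R[i]) : Prop :=
  forall (theta : R) (B : I -> set (measurableTypeR R * measurableTypeR R)),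
    (forall i, measurable (B i)) ->
    let event (v : I -> T -> R[i]) :=
      [set t | forall i, B i (complex.Re (v i t), complex.Im (v i t))] in
    P (event (fun i t => expi theta * w i t)) = P (event w).

Definition circular_gaussian d {T : measurableType d} {R : realType}
    (P : probability T R) (I : finType) (w : I -> T -> R[i]) : Prop :=
  [/\ jointly_gaussian P w, circularly_symmetric P w &
      forall i, cexpectation P (w i) = 0].

Definition fourier_coef {R : realType} (S : R -> R) (k : int) : R[i] :=
  cintegral lebesgue_measure `[0, 1]
    (fun nu : measurableTypeR R => (S nu)%:C * expi (2 * pi * nu * k%:~R)).

Definition dvec {R : realType} (K : nat) (nu : R) : 'cV[R[i]]_K :=
  \col_(j < K) expi (2 * pi * j%:R * nu).

Definition avec {R : realType} (K : nat) (nu : R) : 'cV[R[i]]_K :=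
  ((Num.sqrt K%:R)^-1)%:C *: dvec K nu.

(* The operator Psi_K^{(m)} attached to the density S = S_m. *)
Definition psi {R : realType} (S : R -> R) (K K' : nat) (X : 'M[R[i]]_K') :
    'M[R[i]]_K :=
  mxintegral lebesgue_measure `[0, 1] (fun nu : measurableTypeR R =>
    ((S nu)%:C * ((avec K' nu)^t* *m X *m avec K' nu) 0 0)
      *: (dvec K nu *m (dvec K nu)^t*)).

(* ML x ML matrices are M x M block matrices with L x L blocks; their size is
   written as the sum L + ... + L (which equals M * L) on which the library
   defines block matrices. *)
Definition blockdim (M L : nat) : nat := \sum_(m < M) L.

Definition Psi {R : realType} (M L N : nat) (S : 'I_M -> R -> R)
    (X : 'M[R[i]]_N) : 'M[R[i]]_(blockdim M L) :=
  \mxdiag_(m < M) psi (S m) L X.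

Definition Psibar {R : realType} (M L N : nat) (S : 'I_M -> R -> R)
    (X : 'M[R[i]]_(blockdim M L)) : 'M[R[i]]_N :=
  M%:R^-1 *: \sum_(m < M)
    psi (S m) N (@submxblock _ M M (fun=> L) (fun=> L) X m m).

(* Indices are 0-based: w m n stands for w_{m+1}(n+1), so
   that the (i, j) entry of the m-th Hankel block is w m (i + j). *)

Definition hankel_mx {R : realType} (L N : nat) (w : nat -> R[i]) :
    'M[R[i]]_(L, N) :=
  \matrix_(i < L, j < N) w (i + j)%N.

Definition Wmx {R : realType} (M L N : nat) (w : 'I_M -> nat -> R[i]) :
    'M[R[i]]_(blockdim M L, N) :=
  \mxcol_(m < M) hankel_mx L N (w m).

Definition resolvent {R : realType} (M L N : nat) (w : 'I_M -> nat -> R[i])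
    (z : R[i]) : 'M[R[i]]_(blockdim M L) :=
  let W := Wmx L N w in invmx (W *m W^t* - z%:M).

(* mu is a positive K x K matrix-valued measure and q x is the scalar measure
   B |-> x^H mu(B) x. *)
Definition positive_mxmeasure {R : realType} (K : nat)
    (mu : set (measurableTypeR R) -> 'M[R[i]]_K)
    (q : 'cV[R[i]]_K -> {finite_measure set (measurableTypeR R) -> \bar R}) :
    Prop :=
  forall x (B : set (measurableTypeR R)), measurable B ->
    (x^t* *m mu B *m x) 0 0 = (fine (q x B))%:C.

(* The class S_K(R^+).  The complex order makes 0 <= z mean that z is a real in R^+, so that
   ~~ (0 <= z) means z \in C \ R^+.  The matrix \int dmu(l) / (l - z) is taken
   in the weak sense: by polarization it is determined by its quadratic form,
   whose value at x is the integral against x^H mu x. *)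
Definition stieltjes_class {R : realType} (K : nat)
    (F : R[i] -> 'M[R[i]]_K) : Prop :=
  exists (mu : set (measurableTypeR R) -> 'M[R[i]]_K)
         (q : 'cV[R[i]]_K -> {finite_measure set (measurableTypeR R) -> \bar R}),
  [/\ positive_mxmeasure mu q,
      mu `]-oo, 0[%classic = 0,
      mu `[0, +oo[%classic = 1%:M &
      forall z, ~~ (0 <= z) -> forall x : 'cV[R[i]]_K,
        (x^t* *m F z *m x) 0 0 =
        cintegral (q x) `[0, +oo[ (fun l : measurableTypeR R => (l%:C - z)^-1)].

(* Main.v *)
(* Write Q for the resolvent. Independent copies W, V of a circular Gaussian matrix
   satisfy (W, V) ~ (cW + sV, -sW + cV) for c^2 + s^2 = 1, and letting s -> 0 yields
   the integration by parts
     E tr (Q K(F) B) = E tr (Q W F W^H B) + E tr (Q W Kt(Q) F W^H B),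
   where K(F) = E (V F V^H) = Psi(F^T) and Kt(X) = E (V^H X V) = c_N Psibar^T(X).
   Splitting the passage from W to V into many small rotations bounds the fourth
   central moment of tr (Q A) by a multiple of (eta |A|_F^2)^2, with eta of order
   L / N. Hence E Q solves the fixed-point equation up to a trace error of relative
   order eta, which tends to 0 as 1 / M, and the fluctuations of the normalized
   trace are summable, their fourth moments being O(1 / N^2).

   Far from the half-line the fixed-point equation is stable, by contraction of its
   adjoint on test matrices. A general z is the limit of Lagrange interpolations
   of 1 / (l - z) at far points z - y u^*, uniformly in l >= 0, with coefficients
   independent of N, and this transfers the estimate to z. *)

From HB Require Import structures.
Require Import Defs.
From mathcomp Require Import all_boot all_order all_algebra.
From mathcomp Require Import all_classical all_reals all_analysis.
From mathcomp Require Import complex zify measurable_realfun measurable_fun_approximation.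
From mathcomp Require Import ring lra.
Import Order.TTheory GRing.Theory Num.Theory Normc.
Import numFieldNormedType.Exports.

Set Implicit Arguments.
Unset Strict Implicit.
Unset Printing Implicit Defensive.

Local Open Scope classical_set_scope.
Local Open Scope ring_scope.
Local Open Scope complex_scope.
Local Open Scope sesquilinear_scope.

(** The obstacle is the Hankel structure: one sample fills an antidiagonal of its block, so the
    entries of W are strongly dependent, and L may grow with N. Two numbers carry all the
    probabilistic information. The number [eta] bounds the variance of tr (G W) for G of Frobenius
    norm one and feels the repetitions; [kap] bounds the mean square of W y and W^H x for unit
    vectors and does not feel them, since a sample occurs at most once in a row or a column. The
    variance of the normalized trace is only O(1 / (M N)), and M may grow arbitrarily slowly, so
    second moments need not be summable: this is why fourth moments are estimated. The covariance
    estimates control E Q - T only through traces against test matrices of norm at most one, and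
    stability is accordingly a statement on the dual side. The expansions behind the rotations have
    constants that depend on the dimension; this is harmless because the angle tends to 0 before N
    moves. *)

Notation "A ^H" := (map_mx Num.conj (trmx A)) (at level 8, format "A ^H").

(** * Norms and quadratic forms of complex matrices *)

Section complex_numbers.
Variable R : realType.
Implicit Types x y z : R[i].
Notation Re := (@complex.Re R).
Notation Im := (@complex.Im R).

(** The squared modulus as a real polynomial in the two parts: no square root occurs, and [ring] and
    [nra] apply. *)
Definition n2 x : R := Re x ^+ 2 + Im x ^+ 2.

Lemma n2E x : n2 x = normc x ^+ 2.
Proof. by case: x => a b; rewrite /n2 /normc /= sqr_sqrtr// addr_ge0// sqr_ge0. Qed.
Lemma n2_ge0 x : 0 <= n2 x. Proof. by rewrite addr_ge0// sqr_ge0. Qed.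
Lemma n2M x y : n2 (x * y) = n2 x * n2 y.
Proof. by rewrite !n2E normcM exprMn. Qed.
Lemma n20 : n2 0 = 0. Proof. by rewrite /n2 /= expr0n addr0. Qed.
Lemma n21 : n2 1 = 1. Proof. by rewrite /n2 /= expr0n expr1n addr0. Qed.
Lemma n2_eq0 x : n2 x = 0 -> x = 0.
Proof. by rewrite n2E => /eqP; rewrite expf_eq0/= => /eqP /eq0_normc. Qed.
Lemma n2N x : n2 (- x) = n2 x. Proof. by case: x => a b; rewrite /n2/= !sqrrN. Qed.
Lemma n2J x : n2 x^* = n2 x. Proof. by case: x => a b; rewrite /n2/= sqrrN. Qed.
Lemma n2V x : n2 x^-1 = (n2 x)^-1. Proof. by rewrite !n2E normcV exprVn. Qed.
Lemma n2C (a : R) : n2 a%:C = a ^+ 2. Proof. by rewrite /n2/= expr0n addr0. Qed.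
Lemma n2D x y : n2 (x + y) <= 2 * n2 x + 2 * n2 y.
Proof.
case: x => a b; case: y => c d; rewrite /n2/=.
have := sqr_ge0 (a - c); have := sqr_ge0 (b - d); nra.
Qed.

Lemma ReD x y : Re (x + y) = Re x + Re y. Proof. by case: x; case: y. Qed.
Lemma ImD x y : Im (x + y) = Im x + Im y. Proof. by case: x; case: y. Qed.
Lemma ReN x : Re (- x) = - Re x. Proof. by case: x. Qed.
Lemma ImN x : Im (- x) = - Im x. Proof. by case: x. Qed.
Lemma Re_mul x y : Re (x * y) = Re x * Re y - Im x * Im y. Proof. by case: x; case: y. Qed.
Lemma Im_mul x y : Im (x * y) = Re x * Im y + Im x * Re y. Proof. by case: x; case: y. Qed.
Lemma ReJ x : Re x^* = Re x. Proof. by case: x. Qed.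
Lemma ImJ x : Im x^* = - Im x. Proof. by case: x. Qed.
Lemma Re_sum I (r : seq I) (P : pred I) (F : I -> R[i]) :
  Re (\sum_(i <- r | P i) F i) = \sum_(i <- r | P i) Re (F i).
Proof. by apply: (big_morph Re ReD). Qed.
Lemma Im_sum I (r : seq I) (P : pred I) (F : I -> R[i]) :
  Im (\sum_(i <- r | P i) F i) = \sum_(i <- r | P i) Im (F i).
Proof. by apply: (big_morph Im ImD). Qed.
Lemma complexP x y : Re x = Re y -> Im x = Im y -> x = y.
Proof. by case: x; case: y => a b c d /= -> ->. Qed.
Lemma cjB x y : Num.conj (x - y) = Num.conj x - Num.conj y. Proof. exact: rmorphB. Qed.
Lemma cjM x y : Num.conj (x * y) = Num.conj x * Num.conj y. Proof. exact: rmorphM. Qed.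
Lemma cjC (a : R) : Num.conj a%:C = a%:C. Proof. exact: conjc_real. Qed.
Lemma cj_sum I (r : seq I) (P : pred I) (F : I -> R[i]) :
  Num.conj (\sum_(i <- r | P i) F i) = \sum_(i <- r | P i) Num.conj (F i).
Proof. exact: rmorph_sum. Qed.
Lemma mulCJ x : x * x^* = (n2 x)%:C.
Proof. by case: x => a b; apply: complexP; rewrite /n2/=; ring. Qed.
Lemma Re_mulC (a : R) x : Re (a%:C * x) = a * Re x.
Proof. by case: x => b c /=; ring. Qed.
Lemma Im_mulC (a : R) x : Im (a%:C * x) = a * Im x.
Proof. by case: x => b c /=; ring. Qed.
Lemma Re_le x : Re x ^+ 2 <= n2 x. Proof. by rewrite /n2 lerDl sqr_ge0. Qed.
Lemma Im_le x : Im x ^+ 2 <= n2 x. Proof. by rewrite /n2 lerDr sqr_ge0. Qed.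
Lemma Re_ler x : Re x <= normc x.
Proof.
case: x => a b /=; rewrite (le_trans (ler_norm a))// -sqrtr_sqr ler_wsqrtr//.
by rewrite lerDl sqr_ge0.
Qed.
Lemma normc_ge0' x : 0 <= normc x. Proof. by case: x => a b; exact: sqrtr_ge0. Qed.
Lemma normc_le_sqr x (a : R) : 0 <= a -> n2 x <= a ^+ 2 -> normc x <= a.
Proof. by move=> a0; rewrite n2E ler_pXn2r// ?nnegrE// normc_ge0'. Qed.
Lemma normcJ' x : normc x^* = normc x.
Proof. by case: x => a b; rewrite /= sqrrN. Qed.

(* |sum x_i y_i|^2 expanded as a double sum, each term being
   Re (x_i y_j^* (x_j y_i^* )^* ), to which AM-GM applies *)
Lemma n2_CS (I : finType) (P : pred I) (F G : I -> R[i]) :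
  n2 (\sum_(i | P i) F i * G i) <=
  (\sum_(i | P i) n2 (F i)) * (\sum_(i | P i) n2 (G i)).
Proof.
have E : n2 (\sum_(i | P i) F i * G i) =
    \sum_(i | P i) \sum_(j | P j) Re ((F i * (G j)^*) * (F j * (G i)^*)^*).
  have -> : n2 (\sum_(i | P i) F i * G i) =
     Re ((\sum_(i | P i) F i * G i) * (\sum_(i | P i) F i * G i)^*).
    by rewrite mulCJ.
  rewrite mulr_suml Re_sum; apply: eq_bigr => i _.
  rewrite rmorph_sum mulr_sumr Re_sum; apply: eq_bigr => j _.
  have cM x y : Num.conj (x * y) = Num.conj x * Num.conj y :> R[i] by rewrite rmorphM.
  have cK x : Num.conj (Num.conj x) = x :> R[i] by rewrite conjCK.
  rewrite !cM cK.
  by congr Re; ring.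
rewrite E big_distrlr/=.
apply: (@le_trans _ _ (\sum_(i | P i) \sum_(j | P j)
   (n2 (F i) * n2 (G j) / 2 + n2 (F j) * n2 (G i) / 2))).
  apply: ler_sum => i _; apply: ler_sum => j _.
  rewrite -(n2J (G j)) -(n2J (G i)) -!n2M.
  move: (F i * _) (F j * _) => [a b] [c d]; rewrite /n2/=.
  have := sqr_ge0 (a - c); have := sqr_ge0 (b - d); nra.
rewrite (eq_bigr (fun i => \sum_(j | P j) n2 (F i) * n2 (G j) / 2 +
  \sum_(j | P j) n2 (F j) * n2 (G i) / 2)); last by move=> i _; rewrite -big_split.
rewrite big_split/= [X in _ + X]exchange_big/= -big_split/=.
by apply: ler_sum => i _; rewrite -big_split/=; apply: ler_sum => j _; lra.
Qed.

End complex_numbers.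

Section frobenius.
Variable R : realType.
Local Notation C := R[i].
Notation Re := (@complex.Re R).

Definition fro2 m n (A : 'M[C]_(m, n)) : R := \sum_i \sum_j n2 (A i j).
Definition nrm m n (A : 'M[C]_(m, n)) : R := Num.sqrt (fro2 A).

Lemma fro2_ge0 m n (A : 'M[C]_(m, n)) : 0 <= fro2 A.
Proof. by apply: sumr_ge0 => i _; apply: sumr_ge0 => j _; exact: n2_ge0. Qed.
Hint Resolve fro2_ge0 : core.
Lemma nrm_ge0 m n (A : 'M[C]_(m, n)) : 0 <= nrm A. Proof. exact: sqrtr_ge0. Qed.
Hint Resolve nrm_ge0 : core.
Lemma nrm2 m n (A : 'M[C]_(m, n)) : nrm A ^+ 2 = fro2 A.
Proof. by rewrite sqr_sqrtr. Qed.
Lemma fro20 m n : fro2 (0 : 'M[C]_(m, n)) = 0.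
Proof. by apply: big1 => i _; apply: big1 => j _; rewrite mxE n20. Qed.
Lemma fro2_eq0 m n (A : 'M[C]_(m, n)) : fro2 A = 0 -> A = 0.
Proof.
move=> /eqP; rewrite psumr_eq0; last by move=> i _; apply: sumr_ge0 => j _; exact: n2_ge0.
move=> /allP h; apply/matrixP => i j; rewrite mxE.
have /eqP := h i (mem_index_enum _); move=> /eqP/=.
rewrite psumr_eq0; last by move=> k _; exact: n2_ge0.
by move=> /allP /(_ j (mem_index_enum _))/= /eqP /n2_eq0.
Qed.
Lemma fro2_tr m n (A : 'M[C]_(m, n)) : fro2 A^T = fro2 A.
Proof. by rewrite /fro2 exchange_big/=; do 2 apply: eq_bigr => ? _; rewrite mxE. Qed.
Lemma adjE m n (A : 'M[C]_(m, n)) i j : (A^H) i j = (A j i)^*.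
Proof. by rewrite !mxE. Qed.
Lemma fro2_adj m n (A : 'M[C]_(m, n)) : fro2 A^H = fro2 A.
Proof.
rewrite /fro2 exchange_big/=; do 2 apply: eq_bigr => ? _.
by rewrite adjE n2J.
Qed.
Lemma fro2N m n (A : 'M[C]_(m, n)) : fro2 (- A) = fro2 A.
Proof. by do 2 apply: eq_bigr => ? _; rewrite mxE n2N. Qed.
Lemma fro2Z m n a (A : 'M[C]_(m, n)) : fro2 (a *: A) = n2 a * fro2 A.
Proof.
rewrite /fro2 mulr_sumr; apply: eq_bigr => i _; rewrite mulr_sumr.
by apply: eq_bigr => j _; rewrite mxE n2M.
Qed.
Lemma fro2_col m n (A : 'M[C]_(m, n)) : fro2 A = \sum_j fro2 (col j A).
Proof.
rewrite /fro2 exchange_big/=; apply: eq_bigr => j _; apply: eq_bigr => i _.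
by rewrite big_ord1 mxE.
Qed.
Lemma fro2_cV n (x : 'cV[C]_n) : fro2 x = \sum_i n2 (x i 0).
Proof. by apply: eq_bigr => i _; rewrite big_ord1. Qed.
Lemma fro2M m n p (A : 'M[C]_(m, n)) (B : 'M[C]_(n, p)) :
  fro2 (A *m B) <= fro2 A * fro2 B.
Proof.
rewrite /fro2 mulr_suml; apply: ler_sum => i _.
rewrite [X in _ * X]exchange_big/= mulr_sumr; apply: ler_sum => j _.
by rewrite mxE; exact: n2_CS.
Qed.
Lemma n2_trM m n (A : 'M[C]_(m, n)) (B : 'M[C]_(n, m)) :
  n2 (\tr (A *m B)) <= fro2 A * fro2 B.
Proof.
rewrite /mxtrace; under eq_bigr do rewrite mxE.
rewrite pair_bigA/= (le_trans (n2_CS _ _ _))// -[fro2 B]fro2_tr /fro2 !pair_bigA/=.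
by rewrite [X in _ * X <= _](eq_bigr (fun p => n2 (B^T p.1 p.2)))// => -[i j] _; rewrite mxE.
Qed.
Lemma tr_adj_fro2 m n (A : 'M[C]_(m, n)) : \tr (A^H *m A) = (fro2 A)%:C.
Proof.
rewrite /mxtrace /fro2 exchange_big/= rmorph_sum/=; apply: eq_bigr => j _.
rewrite mxE rmorph_sum/=; apply: eq_bigr => i _.
by rewrite adjE mulrC mulCJ.
Qed.
Lemma adjM m n p (A : 'M[C]_(m, n)) (B : 'M[C]_(n, p)) :
  (A *m B)^H = B^H *m A^H.
Proof. by rewrite trmx_mul map_mxM. Qed.
Lemma adjK m n (A : 'M[C]_(m, n)) : A^H^H = A. Proof. exact: trmxCK. Qed.
Lemma adjD m n (A B : 'M[C]_(m, n)) : (A + B)^H = A^H + B^H.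
Proof. by apply/matrixP => i j; rewrite !(mxE, rmorphD). Qed.
Lemma adj_scale m n a (A : 'M[C]_(m, n)) : (a *: A)^H = a^* *: A^H.
Proof. by apply/matrixP => i j; rewrite !(mxE, rmorphM). Qed.
Lemma adjB m n (A B : 'M[C]_(m, n)) : (A - B)^H = A^H - B^H.
Proof. by apply/matrixP => i j; rewrite !mxE cjB. Qed.
Lemma adj_scalar n (a : C) : (a%:M : 'M[C]_n)^H = (Num.conj a)%:M.
Proof. by rewrite tr_scalar_mx map_scalar_mx. Qed.
Lemma tr_adj n (A : 'M[C]_n) : \tr (A^H) = Num.conj (\tr A).
Proof. by rewrite /mxtrace rmorph_sum; apply: eq_bigr => i _; rewrite adjE. Qed.

Lemma nrmM m n p (A : 'M[C]_(m, n)) (B : 'M[C]_(n, p)) : nrm (A *m B) <= nrm A * nrm B.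
Proof. by rewrite /nrm -sqrtrM// ler_sqrt ?mulr_ge0// fro2M. Qed.
Lemma nrmN m n (A : 'M[C]_(m, n)) : nrm (- A) = nrm A.
Proof. by rewrite /nrm fro2N. Qed.
Lemma nrm_adj m n (A : 'M[C]_(m, n)) : nrm A^H = nrm A.
Proof. by rewrite /nrm fro2_adj. Qed.
Lemma nrmZ m n a (A : 'M[C]_(m, n)) : nrm (a *: A) = normc a * nrm A.
Proof. by rewrite /nrm fro2Z sqrtrM ?n2_ge0// n2E sqrtr_sqr ger0_norm// normc_ge0'. Qed.
Lemma normc_trM m n (A : 'M[C]_(m, n)) (B : 'M[C]_(n, m)) :
  normc (\tr (A *m B)) <= nrm A * nrm B.
Proof.
by apply: normc_le_sqr; rewrite ?mulr_ge0// exprMn !nrm2 n2_trM.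
Qed.
Lemma nrmD m n (A B : 'M[C]_(m, n)) : nrm (A + B) <= nrm A + nrm B.
Proof.
rewrite -(@ler_pXn2r _ 2)// ?nnegrE ?addr_ge0// sqrrD !nrm2.
have -> : fro2 (A + B) = fro2 A + fro2 B + Re (\tr (A^H *m B)) *+ 2.
  have E (m' n' : nat) (X : 'M[C]_(m', n')) : fro2 X = Re (\tr (X^H *m X)).
    by rewrite tr_adj_fro2.
  rewrite (E _ _ (A + B)) (E _ _ A) (E _ _ B) adjD mulmxDl !mulmxDr !mxtraceD.
  have -> : \tr (B^H *m A) = Num.conj (\tr (A^H *m B)) by have := tr_adj (A^H *m B); rewrite adjM adjK.
  rewrite !ReD ReJ; move: (Re _) (Re _) (Re _) => p q r; ring.
rewrite addrAC lerD2r lerD2l ler_wMn2r//.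
by rewrite (le_trans (Re_ler _))// (le_trans (normc_trM _ _))// nrm_adj.
Qed.
Lemma nrm_eq0 m n (A : 'M[C]_(m, n)) : nrm A = 0 -> A = 0.
Proof. by move=> h; apply: fro2_eq0; rewrite -nrm2 h expr0n. Qed.
Lemma nrm0 m n : nrm (0 : 'M[C]_(m, n)) = 0.
Proof. by rewrite /nrm fro20 sqrtr0. Qed.
Lemma entry_nrm m n (A : 'M[C]_(m, n)) i j : normc (A i j) <= nrm A.
Proof.
apply: normc_le_sqr => //; rewrite nrm2 /fro2 (bigD1 i)//= (bigD1 j)//=.
rewrite -addrA lerDl addr_ge0// ?sumr_ge0// => k _; rewrite ?n2_ge0//.
by apply: sumr_ge0 => l _; rewrite n2_ge0.
Qed.

(** A bound on the operator norm, as a predicate that composes and passes to adjoints without any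
    supremum. The condition [0 <= k] is needed because only [k ^+ 2] enters the inequality. *)
Definition opb m n (k : R) (A : 'M[C]_(m, n)) :=
  0 <= k /\ forall x : 'cV[C]_n, fro2 (A *m x) <= k ^+ 2 * fro2 x.

Lemma opb_fro2 m n p k (A : 'M[C]_(m, n)) (X : 'M[C]_(n, p)) :
  opb k A -> fro2 (A *m X) <= k ^+ 2 * fro2 X.
Proof.
move=> [k0 h]; rewrite !fro2_col mulr_sumr; apply: ler_sum => j _.
by rewrite !colE -mulmxA -colE h.
Qed.
Lemma opb_nrm m n p k (A : 'M[C]_(m, n)) (X : 'M[C]_(n, p)) :
  opb k A -> nrm (A *m X) <= k * nrm X.
Proof.
move=> kA; have k0 := kA.1.
by rewrite -(@ler_pXn2r _ 2)// ?nnegrE ?mulr_ge0// exprMn !nrm2 opb_fro2.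
Qed.
Lemma opbP m n k (A : 'M[C]_(m, n)) : 0 <= k ->
  (forall x : 'cV[C]_n, nrm (A *m x) <= k * nrm x) -> opb k A.
Proof.
move=> k0 h; split=> // x; have := h x.
by rewrite -(@ler_pXn2r _ 2)// ?nnegrE ?mulr_ge0// exprMn !nrm2.
Qed.
(** |A^H x|^2 = x^H A (A^H x) <= |x| k |A^H x|, and one factor |A^H x| cancels. *)
Lemma opb_adj m n k (A : 'M[C]_(m, n)) : opb k A -> opb k A^H.
Proof.
move=> kA; have k0 := kA.1; apply: opbP => // x.
have := normc_trM x^H (A *m (A^H *m x)).
rewrite mulmxA -(adjK A) -adjM adjK tr_adj_fro2 nrm_adj -nrm2 /= expr0n addr0 sqrtr_sqr.
rewrite ger0_norm ?sqr_ge0// => h.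
have {}h := le_trans h (ler_wpM2l (nrm_ge0 _) (opb_nrm _ kA)).
have [->|n0] := eqVneq (nrm (A^H *m x)) 0; first by rewrite mulr_ge0.
have np : 0 < nrm (A^H *m x) by rewrite lt0r n0 nrm_ge0.
by rewrite -(ler_pM2r np) -expr2 (le_trans h)// le_eqVlt; apply/orP; left; apply/eqP; ring.
Qed.
Lemma opbM m n p k l (A : 'M[C]_(m, n)) (B : 'M[C]_(n, p)) :
  opb k A -> opb l B -> opb (k * l) (A *m B).
Proof.
move=> kA lB; have k0 := kA.1; have l0 := lB.1; apply: opbP; first exact: mulr_ge0.
move=> x; rewrite -mulmxA (le_trans (opb_nrm _ kA))// -mulrA.
by rewrite ler_wpM2l// opb_nrm.
Qed.
Lemma opbZ m n k a (A : 'M[C]_(m, n)) :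
  opb k A -> opb (normc a * k) (a *: A).
Proof.
move=> kA; have k0 := kA.1; apply: opbP; first by rewrite mulr_ge0// normc_ge0'.
by move=> x; rewrite -scalemxAl nrmZ -mulrA ler_wpM2l ?normc_ge0'// opb_nrm.
Qed.
Lemma opbW m n k l (A : 'M[C]_(m, n)) : k <= l -> opb k A -> opb l A.
Proof.
move=> kl kA; have k0 := kA.1; apply: opbP; first exact: le_trans kl.
by move=> x; rewrite (le_trans (opb_nrm _ kA))// ler_wpM2r.
Qed.
Lemma opb1 n : opb 1 (1%:M : 'M[C]_n).
Proof. by apply: opbP => // x; rewrite mul1mx mul1r. Qed.
Lemma opb0 m n k : 0 <= k -> opb k (0 : 'M[C]_(m, n)).
Proof. by move=> k0; apply: opbP => // x; rewrite mul0mx nrm0 mulr_ge0. Qed.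
Lemma opb_nrmr m n p k (A : 'M[C]_(m, n)) (X : 'M[C]_(p, m)) :
  opb k A -> nrm (X *m A) <= k * nrm X.
Proof.
by move=> /opb_adj kA; rewrite -nrm_adj adjM (le_trans (opb_nrm _ kA))// nrm_adj.
Qed.
Lemma fro21 n : fro2 (1%:M : 'M[C]_n) = n%:R.
Proof.
rewrite /fro2 (eq_bigr (fun=> 1)); first by rewrite sumr_const card_ord.
move=> i _; rewrite (bigD1 i)//= mxE eqxx n21 big1 ?addr0// => j /negPf ji.
by rewrite mxE eq_sym ji n20.
Qed.
Lemma opb_fro n k (A : 'M[C]_n) : opb k A -> fro2 A <= k ^+ 2 * n%:R.
Proof. by move=> kA; rewrite -[A]mulmx1 -fro21; exact: opb_fro2. Qed.
Lemma opb_nrm1 n k (A : 'M[C]_n) : opb k A -> nrm A <= k * Num.sqrt n%:R.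
Proof. by move=> kA; rewrite -[A]mulmx1 -fro21; exact: opb_nrm. Qed.
Definition qf n (X : 'M[C]_n) (x : 'cV[C]_n) : C := (x^H *m X *m x) 0 0.
Definition bf m n (X : 'M[C]_(m, n)) (x : 'cV[C]_m) (y : 'cV[C]_n) : C := (x^H *m X *m y) 0 0.

Lemma trmx11 (A : 'M[C]_1) : \tr A = A 0 0. Proof. by rewrite /mxtrace big_ord1. Qed.
Lemma bf_norm m n k (X : 'M[C]_(m, n)) x y : opb k X ->
  normc (bf X x y) <= k * nrm x * nrm y.
Proof.
move=> kX; rewrite /bf -trmx11 -mulmxA (le_trans (normc_trM _ _))// nrm_adj.
by rewrite (mulrC k) -mulrA ler_wpM2l// opb_nrm.
Qed.
Lemma opb_bf m n k (X : 'M[C]_(m, n)) : 0 <= k ->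
  (forall x y, normc (bf X x y) <= k * nrm x * nrm y) -> opb k X.
Proof.
move=> k0 h; apply: opbP => // y; have := h (X *m y) y.
rewrite /bf -mulmxA -trmx11 tr_adj_fro2 -nrm2 /= expr0n addr0 sqrtr_sqr ger0_norm ?sqr_ge0//.
have [->|n0] := eqVneq (nrm (X *m y)) 0; first by rewrite mulr_ge0.
have np : 0 < nrm (X *m y) by rewrite lt0r n0 nrm_ge0.
by move=> h1; rewrite -(ler_pM2r np) -expr2 (le_trans h1)// mulrAC.
Qed.

Lemma qfD n (X Y : 'M[C]_n) x : qf (X + Y) x = qf X x + qf Y x.
Proof. by rewrite /qf mulmxDr mulmxDl mxE. Qed.
Lemma qfN n (X : 'M[C]_n) x : qf (- X) x = - qf X x.
Proof. by rewrite /qf mulmxN mulNmx mxE. Qed.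
Lemma qfZ n a (X : 'M[C]_n) x : qf (a *: X) x = a * qf X x.
Proof. by rewrite /qf -scalemxAr -scalemxAl mxE. Qed.
Lemma qf_scalar n (a : C) (x : 'cV[C]_n) : qf a%:M x = a * (fro2 x)%:C.
Proof. by rewrite /qf mul_mx_scalar -scalemxAl mxE -trmx11 tr_adj_fro2. Qed.
Lemma qf1 n (x : 'cV[C]_n) : qf 1%:M x = (fro2 x)%:C.
Proof. by rewrite qf_scalar mul1r. Qed.
Lemma qf_WW m n (W : 'M[C]_(m, n)) x : qf (W *m W^H) x = (fro2 (W^H *m x))%:C.
Proof. by rewrite -tr_adj_fro2 adjM adjK trmx11 /qf !mulmxA. Qed.
Lemma qf_cong m n (X : 'M[C]_m) (A : 'M[C]_(m, n)) x : qf (A^H *m X *m A) x = qf X (A *m x).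
Proof. by rewrite /qf adjM !mulmxA. Qed.
Lemma polarization n (X : 'M[C]_n) x y :
  4 * bf X x y = qf X (x + y) - qf X (x - y) - 'i%C * qf X (x + 'i%C *: y) + 'i%C * qf X (x - 'i%C *: y).
Proof.
have Dl (p q r : 'cV_n) : bf X (p + q) r = bf X p r + bf X q r.
  by rewrite /bf adjD !mulmxDl mxE.
have Dr (p q r : 'cV_n) : bf X p (q + r) = bf X p q + bf X p r by rewrite /bf mulmxDr mxE.
have Zl a (p q : 'cV_n) : bf X (a *: p) q = a^* * bf X p q.
  by rewrite /bf adj_scale -!scalemxAl mxE.
have Zr a (p q : 'cV_n) : bf X p (a *: q) = a * bf X p q by rewrite /bf -scalemxAr mxE.
have E a b : Num.conj a = b ->
    qf X (x + a *: y) = qf X x + a * bf X x y + b * bf X y x + a * b * qf X y.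
  move=> <-; rewrite -[LHS]/(bf X _ _) Dl !Dr !Zr !Zl.
  change (bf X x x + a * bf X x y + (a^* * bf X y x + a * (a^* * bf X y y)) =
    bf X x x + a * bf X x y + a^* * bf X y x + a * a^* * bf X y y).
  by rewrite !mulrA !addrA.
have c1 : Num.conj 1 = 1 :> C by rewrite rmorph1.
have cN1 : Num.conj (-1) = -1 :> C by rewrite rmorphN rmorph1.
have ci : Num.conj 'i%C = - 'i%C :> C by apply: complexP => /=; rewrite ?oppr0.
have cNi : Num.conj (- 'i%C) = 'i%C :> C by apply: complexP => /=; rewrite ?oppr0 ?opprK.
have i2 : ('i%C : C) * 'i%C = -1 by rewrite -expr2 sqr_i.
move: (E _ _ c1) (E _ _ cN1) (E _ _ ci) (E _ _ cNi).
rewrite scale1r scaleN1r scaleNr => -> -> -> ->.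
move: (qf X x) (qf X y) (bf X x y) (bf X y x) => p q r s.
(* The identity holds only modulo i^2 = -1; the multiple of i^2 + 1 is displayed so that [ring] can
   treat i as an indeterminate. *)
transitivity (4 * r + ('i%C * 'i%C + 1) * (2 * s - 2 * r)).
  by rewrite i2; ring.
by ring.
Qed.

(** For unit vectors, the four vectors x + a y of the polarization identity have norm at most 2, so
    each quadratic form is at most 4 k and 4 |x^H X y| <= 16 k. The general case follows by
    homogeneity. *)
Lemma numerical_radius n k (X : 'M[C]_n) : 0 <= k ->
  (forall x, normc (qf X x) <= k * fro2 x) -> opb (4 * k) X.
Proof.
move=> k0 h.
have nC (a : R) : 0 <= a -> normc a%:C = a.
  by move=> a0; rewrite /normc/= expr0n addr0 sqrtr_sqr ger0_norm.
have hc (x y : 'cV_n) : nrm x <= 1 -> nrm y <= 1 -> normc (bf X x y) <= 4 * k.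
  move=> x1 y1.
  have q (a : C) : normc a = 1 -> normc (qf X (x + a *: y)) <= 4 * k.
    move=> a1; rewrite (le_trans (h _))// mulrC ler_wpM2r// -nrm2.
    have : nrm (x + a *: y) <= 2.
      by rewrite (le_trans (nrmD _ _))// nrmZ a1 mul1r; lra.
    by have := nrm_ge0 (x + a *: y); nra.
  have e1 : normc (1 : C) = 1 by exact: normc1.
  have ei : normc ('i%C : C) = 1 by rewrite /normc/= expr0n expr1n add0r sqrtr1.
  have := le_normcD (qf X (x + 1 *: y) - qf X (x + (-1) *: y)
       - 'i%C * qf X (x + 'i%C *: y)) ('i%C * qf X (x + (- 'i%C) *: y)).
  rewrite scale1r scaleN1r scaleNr -polarization.
  have := le_normcD (qf X (x + 1 *: y) - qf X (x + (-1) *: y)) (- ('i%C * qf X (x + 'i%C *: y))).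
  have := le_normcD (qf X (x + 1 *: y)) (- qf X (x + (-1) *: y)).
  rewrite !(normcM, normcN) ei !mul1r scale1r scaleN1r.
  have := q 1 e1; have := q (-1); rewrite normcN => /(_ e1); have := q 'i%C ei.
  have := q (- 'i%C); rewrite normcN => /(_ ei); rewrite scale1r scaleN1r scaleNr.
  have -> : normc (4 : C) = 4.
    by rewrite -(rmorph_nat (real_complex R)) nC.
  by repeat match goal with |- context [normc ?t] => move: (normc t) => ? end; lra.
apply: opb_bf; first by rewrite mulr_ge0.
move=> x y.
have [x0|x0] := eqVneq (nrm x) 0.
  by rewrite (nrm_eq0 x0) /bf trmx0 map_mx0 !mul0mx mxE normc0 nrm0 mulr0 mul0r.
have [y0|y0] := eqVneq (nrm y) 0.
  by rewrite (nrm_eq0 y0) /bf mulmx0 mxE normc0 nrm0 mulr0.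
have xp : 0 < nrm x by rewrite lt0r x0 nrm_ge0.
have yp : 0 < nrm y by rewrite lt0r y0 nrm_ge0.
have := hc ((nrm x)^-1%:C *: x) ((nrm y)^-1%:C *: y).
rewrite !nrmZ !nC ?invr_ge0// !mulVf// => /(_ (lexx _) (lexx _)).
rewrite /bf adj_scale -!scalemxAl -!scalemxAr !mxE !normcM normcJ' !nC ?invr_ge0//.
by rewrite mulrA -invfM mulrC ler_pdivrMr ?mulr_gt0// mulrA.
Qed.

End frobenius.
#[global] Hint Extern 0 (is_true (@Order.le _ _ _ (nrm _))) => exact: nrm_ge0 : core.
#[global] Hint Extern 0 (is_true (@Order.le _ _ _ (fro2 _))) => exact: fro2_ge0 : core.
#[global] Hint Extern 0 (is_true (@Order.le _ _ _ (normc _))) => exact: normc_ge0' : core.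
#[global] Hint Extern 0 (is_true (@Order.le _ _ _ (n2 _))) => exact: n2_ge0 : core.

(** * Resolvents and stability of the fixed-point equation *)

Section accretive.
Variable R : realType.
Local Notation C := R[i].
Notation Re := (@complex.Re R).
Implicit Types (u v z : C) (dl : R).

(** The numerical range of X lies in the half-plane Re (v w) >= 0. This is stable under congruence X
    |-> A^H X A and under averaging, hence under both covariance operators. *)
Definition accr v n (X : 'M[C]_n) := forall x, 0 <= Re (v * qf X x).

Lemma normc1_n2 v : n2 v = 1 -> normc v = 1.
Proof.
move=> h; apply/eqP; rewrite -sqrp_eq1 ?normc_ge0'//.
by rewrite -n2E h.
Qed.

(** The Lax-Milgram argument: dl |x|^2 <= Re (v x^H X x) <= |x| |X x|, so X is injective, hence
    invertible in finite dimension, with inverse bounded by 1 / dl. *)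
Lemma coercive_inv n (X : 'M[C]_n) v (dl : R) : n2 v = 1 -> 0 < dl ->
  (forall x, dl * fro2 x <= Re (v * qf X x)) ->
  X \in unitmx /\ opb dl^-1 (invmx X).
Proof.
move=> v1 dl0 h.
have key (x : 'cV[C]_n) : dl * nrm x <= nrm (X *m x).
  have [->|x0] := eqVneq (nrm x) 0; first by rewrite mulr0.
  have xp : 0 < nrm x by rewrite lt0r x0 nrm_ge0.
  rewrite -(ler_pM2r xp) -mulrA -expr2 nrm2 (le_trans (h x))//.
  rewrite (le_trans (Re_ler _))// normcM (normc1_n2 v1) mul1r.
  have -> : qf X x = bf 1%:M x (X *m x) by rewrite /qf /bf mulmx1 mulmxA.
  by rewrite (le_trans (bf_norm _ _ (opb1 _ _)))// mul1r mulrC.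
have Xu : X \in unitmx.
  rewrite -unitmx_tr -row_free_unit; apply: inj_row_free => w w0.
  have : X *m w^T = 0 by rewrite -[X]trmxK -trmx_mul w0 trmx0.
  move=> Xw; have := key w^T; rewrite Xw nrm0 pmulr_rle0// => w1.
  have /nrm_eq0 : nrm w^T = 0 by apply/eqP; rewrite eq_le w1 nrm_ge0.
  by move=> /(congr1 trmx); rewrite trmxK trmx0.
split=> //; apply: opbP; first by rewrite invr_ge0 ltW.
move=> x; have := key (invmx X *m x).
by rewrite mulmxA mulmxV// mul1mx ler_pdivlMl.
Qed.

(* The half-plane [dl <= Re (u (l - z))] contains every l >= 0, so that resolvents
   at z are bounded by 1 / dl; moving z to z - y u^* replaces dl by dl + y. *)
Definition dir u z dl := [/\ n2 u = 1, 0 <= Re u, 0 < dl & dl <= Re (- u * z)].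

Lemma dir_neq0 u z dl : dir u z dl -> z != 0.
Proof. by case=> _ _ d0 h; apply/eqP => z0; move: h; rewrite z0 mulr0/= leNgt d0. Qed.

Lemma dir_shift u z dl (y : R) : 0 <= y -> dir u z dl ->
  dir u (z - y%:C * Num.conj u) (dl + y).
Proof.
move=> y0 [u1 u0 d0 h]; split=> //; first by rewrite ltr_wpDr.
have -> : - u * (z - y%:C * Num.conj u) = - u * z + y%:C * (u * Num.conj u) by ring.
by rewrite mulCJ u1 ReD Re_mulC /= mulr1 lerD2r.
Qed.

Lemma dir_conj u z dl : dir u z dl -> dir (Num.conj u) (Num.conj z) dl.
Proof.
move=> [u1 u0 d0 h]; split=> //; first by rewrite n2J.
  by rewrite ReJ.
have -> : - Num.conj u * Num.conj z = Num.conj (- u * z) by rewrite rmorphM rmorphN.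
by rewrite ReJ.
Qed.

(** The direction is u = -i, i or 1 according to whether z lies below, above or on the real axis;
    [dl] is then |Im z| or -z. *)
Lemma exists_dir z : ~~ (0 <= z) -> exists u dl, dir u z dl.
Proof.
case: z => a b; rewrite lecE/= => h.
have [b0|b0|b0] := ltgtP b 0.
- exists (- 'i)%C, (- b); split; rewrite /n2/= ?oppr0 ?expr0n ?sqrrN ?expr1n ?add0r ?oppr_gt0//.
  by rewrite opprK mul0r mul1r sub0r.
- exists 'i%C, b; split; rewrite /n2/= ?expr0n ?expr1n ?add0r// oppr0 mul0r sub0r mulN1r opprK.
  by [].
- move: h; rewrite b0 eqxx/= -ltNge => a0.
  exists 1, (- a); split; rewrite /n2/= ?expr0n ?expr1n ?addr0 ?oppr_gt0//.
  by rewrite oppr0 mul0r subr0 mulN1r.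
Qed.

Section point.
Variables (u z : C) (dl : R).
Hypothesis hd : dir u z dl.

(** Both inequalities hold for 1 / (l - z) with l >= 0, hence for every Stieltjes transform at z.
    They are what remains of that property at a single point, and the fixed-point map preserves
    them. *)
Definition pos n (X : 'M[C]_n) := accr (Num.conj u) X /\ accr (- u * z) X.

Lemma qf_inv n (X : 'M[C]_n) y : X \in unitmx ->
  qf (invmx X) (X *m y) = Num.conj (qf X y).
Proof.
move=> Xu; transitivity ((y^H *m X *m y)^H 0 0); last by rewrite adjE.
by rewrite !adjM adjK /qf -mulmxA mulKmx// adjM mulmxA.
Qed.

Lemma accr_inv n (X : 'M[C]_n) v : X \in unitmx -> accr v X -> accr (Num.conj v) (invmx X).
Proof.
move=> Xu h x; rewrite -[x](mulKVmx Xu) qf_inv// -rmorphM ReJ; exact: h.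
Qed.

Lemma invmx_eq n (X Y : 'M[C]_n) : X *m Y = 1%:M -> invmx X = Y.
Proof. by move=> h; have [Xu _] := mulmx1_unit h; rewrite -[Y](mulKmx Xu) h mulmx1. Qed.

(** The second half of [pos K] makes u times -z (1 + K) coercive with constant [dl], and T is the
    inverse of -z (1 + K). Conversely -u z T = u (1 + K)^-1, which is accretive because u^* (1 + K)
    is, by the first half of [pos K] and Re u >= 0. *)
Lemma pos_fix n (K : 'M[C]_n) : pos K ->
  let T := - z^-1 *: invmx (1%:M + K) in
  [/\ 1%:M + K \in unitmx, opb dl^-1 T, pos T & (z *: (1%:M + K)) *m T = - 1%:M].
Proof.
move=> [K1 K2] T; have z0 := dir_neq0 hd; case: hd => u1 u0 d0 hz.
pose Y := - z *: (1%:M + K).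
have YE x : Re (u * qf Y x) = Re (- u * z) * fro2 x + Re (- u * z * qf K x).
  have -> : u * qf Y x = (fro2 x)%:C * (- u * z) + - u * z * qf K x.
    by rewrite /Y qfZ qfD qf1; ring.
  by rewrite ReD Re_mulC mulrC.
have Yc x : dl * fro2 x <= Re (u * qf Y x).
  by rewrite YE ler_wpDr// ?K2// ler_wpM2r.
have [Yu Yo] := coercive_inv u1 d0 Yc.
have DE : 1%:M + K = - z^-1 *: Y.
  by rewrite /Y scalerA mulrNN mulVf// scale1r.
have Du : 1%:M + K \in unitmx by rewrite DE unitmxZ// unitfE oppr_eq0 invr_eq0.
have TY : T = invmx Y.
  symmetry; apply: invmx_eq; rewrite /T /Y -scalemxAl -scalemxAr scalerA mulrNN.
  by rewrite divff// scale1r mulmxV.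
split; [exact: Du|by rewrite TY; exact: Yo| |].
- split.
  + rewrite TY; apply: accr_inv => // x; rewrite (le_trans _ (Yc x))//.
    by rewrite mulr_ge0// ltW.
  + move=> x; rewrite /T qfZ.
    have -> : - u * z * (- z^-1 * qf (invmx (1%:M + K)) x) = u * qf (invmx (1%:M + K)) x.
      by field.
    suff h : accr (Num.conj u) (1%:M + K) by have := accr_inv Du h x; rewrite conjCK.
    move=> {}x; rewrite qfD qf1 mulrDr ReD.
    by rewrite addr_ge0//; rewrite mulrC Re_mulC ReJ mulr_ge0.
- by rewrite /T -scalemxAr -scalemxAl mulmxV// scalerA mulNr mulVf// scaleN1r.
Qed.

Definition resolv n N (W : 'M[C]_(n, N)) : 'M[C]_n := invmx (W *m W^H - z%:M).

(** The last bound involves no bound on W: with v = Q y, the equation y = (W W^H - z) v gives |W^H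
    v|^2 = v^H y + z |v|^2, and |v| <= |y| / dl. *)
Lemma resolvP n N (W : 'M[C]_(n, N)) :
  [/\ W *m W^H - z%:M \in unitmx, opb dl^-1 (resolv W), pos (resolv W),
      resolv W *m (W *m W^H) = 1%:M + z *: resolv W
    & opb (Num.sqrt (dl^-1 + normc z * dl^-2)) (W^H *m resolv W)].
Proof.
case: hd => u1 u0 d0 hz; set X := W *m W^H - z%:M.
have qX x : qf X x = (fro2 (W^H *m x))%:C - z * (fro2 x)%:C.
  by rewrite qfD qfN qf_scalar qf_WW.
have Xc x : dl * fro2 x <= Re (u * qf X x).
  rewrite qX.
  have -> : u * ((fro2 (W^H *m x))%:C - z * (fro2 x)%:C) =
     (fro2 (W^H *m x))%:C * u + (fro2 x)%:C * (- u * z) by ring.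
  rewrite ReD !Re_mulC mulrC -[X in X <= _]add0r lerD// ?mulr_ge0//.
  by rewrite ler_wpM2l.
have [Xu Xo] := coercive_inv u1 d0 Xc.
split=> //.
- split.
    by apply: accr_inv => // x; rewrite (le_trans _ (Xc x))// mulr_ge0// ltW.
  move=> x; rewrite -[x](mulKVmx Xu) qf_inv//; set y := invmx X *m x.
  have -> : Num.conj (qf X y) = (fro2 (W^H *m y))%:C - Num.conj z * (fro2 y)%:C.
    by rewrite qX cjB cjM !cjC.
  have -> : - u * z * ((fro2 (W^H *m y))%:C - Num.conj z * (fro2 y)%:C) =
     (fro2 (W^H *m y))%:C * (- u * z) + (fro2 y)%:C * ((n2 z)%:C * u).
    by rewrite -mulCJ; ring.
  rewrite ReD !Re_mulC addr_ge0// ?mulr_ge0// ?n2_ge0//.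
  by rewrite (le_trans _ hz)// ltW.
- rewrite -[X in _ = X + _](mulVmx Xu) /resolv -/X -mul_scalar_mx -scalar_mxC -mulmxDr.
  by rewrite /X subrK.
- split; first exact: sqrtr_ge0.
  move=> y; have y0 : 0 <= dl^-1 + normc z * dl^-2.
    by rewrite addr_ge0 ?mulr_ge0 ?normc_ge0' ?invr_ge0 ?exprn_ge0// ltW.
  rewrite sqr_sqrtr// -mulmxA; set v := resolv W *m y.
  have yE : y = X *m v by rewrite /v /resolv mulmxA mulmxV// mul1mx.
  have E : (fro2 (W^H *m v))%:C = bf 1%:M v y + z * (fro2 v)%:C.
    have -> : bf 1%:M v y = qf X v by rewrite yE /bf /qf mulmx1 mulmxA.
    by rewrite qX; ring.
  have -> : fro2 (W^H *m v) = Re (bf 1%:M v y + z * (fro2 v)%:C) by rewrite -E.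
  rewrite (le_trans (Re_ler _))// (le_trans (le_normcD _ _))// normcM.
  have vy : nrm v <= dl^-1 * nrm y by apply: opb_nrm.
  rewrite mulrDl lerD//.
    rewrite (le_trans (bf_norm _ _ (opb1 _ _)))// mul1r -nrm2 expr2 mulrA.
    by rewrite ler_wpM2r.
  rewrite -mulrA ler_wpM2l ?normc_ge0'//= expr0n addr0 sqrtr_sqr ger0_norm//.
  by rewrite -!nrm2 -exprVn -exprMn ler_pXn2r// nnegrE// mulr_ge0// invr_ge0 ltW.
Qed.

End point.

Lemma resolv_adj z n N (W : 'M[C]_(n, N)) : W *m W^H - z%:M \in unitmx ->
  (resolv z W)^H = resolv (Num.conj z) W.
Proof.
move=> Xu; symmetry; apply: invmx_eq.
have -> : W *m W^H - (Num.conj z)%:M = (W *m W^H - z%:M)^H.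
  by rewrite adjB adjM adjK adj_scalar.
by rewrite -adjM mulVmx// trmx1 map_mx1.
Qed.

Lemma resolv_opbW u z dl n N (W : 'M[C]_(n, N)) : dir u z dl ->
  opb (Num.sqrt (dl^-1 + normc z * dl^-2)) (resolv z W *m W).
Proof.
move=> hd; have [Xu _ _ _ _] := resolvP hd W.
have [_ _ _ _ h] := resolvP (dir_conj hd) W.
have := opb_adj h; rewrite adjM adjK -resolv_adj// adjK.
by rewrite normcJ'.
Qed.

Lemma resolv_id (z z' : C) n N (W W' : 'M[C]_(n, N)) :
  W *m W^H - z%:M \in unitmx -> W' *m W'^H - z'%:M \in unitmx ->
  resolv z W - resolv z' W' =
    resolv z W *m ((W' *m W'^H - z'%:M) - (W *m W^H - z%:M)) *m resolv z' W'.
Proof.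
by move=> h h'; rewrite mulmxBr mulmxBl -mulmxA mulmxV// mulmx1 mulVmx// mul1mx.
Qed.

End accretive.

Section stability.
Variable R : realType.
Local Notation C := R[i].
Notation Re := (@complex.Re R).
Variables (u z : C) (dl : R) (n N : nat) (kap : R).
Hypothesis hd : dir u z dl.
Variables (K : 'M[C]_N -> 'M[C]_n) (Kt : 'M[C]_n -> 'M[C]_N).
Hypothesis kap0 : 0 <= kap.
Hypothesis KB : forall X Y, K (X - Y) = K X - K Y.
Hypothesis KtB : forall X Y, Kt (X - Y) = Kt X - Kt Y.
Hypothesis Kop : forall k X, opb k X -> opb (kap * k) (K X).
Hypothesis Ktop : forall k X, opb k X -> opb (kap * k) (Kt X).
Hypothesis Kpos : forall v X, accr v X -> accr v (K X).
Hypothesis Ktpos : forall v X, accr v X -> accr v (Kt X).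
Hypothesis Kadj : forall F B, \tr (K F *m B) = \tr (F *m Kt B).

Lemma fix_diff m (A B X Y : 'M[C]_m) : (z *: (1%:M + X)) *m A = - 1%:M ->
  (z *: (1%:M + Y)) *m B = - 1%:M -> A - B = z *: (A *m (X - Y) *m B).
Proof.
move=> hA hB.
have hA' : A *m (z *: (1%:M + X)) = - 1%:M.
  have : (- (z *: (1%:M + X))) *m A = 1%:M by rewrite mulNmx hA opprK.
  by move/mulmx1C; rewrite mulmxN => h; rewrite -[LHS]opprK h.
have -> : A - B = A *m (z *: (1%:M + X)) *m B - A *m ((z *: (1%:M + Y)) *m B).
  by rewrite hA' hB mulNmx mul1mx mulmxN mulmx1 opprK addrC.
by rewrite mulmxA -mulmxBl -mulmxBr -scalerBr -scalemxAr -scalemxAl opprD addrACA subrr add0r.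
Qed.

(** One pass through the two equations: T is a fixed point of [Rr], and G is assumed to be an
    approximate one. *)
Let Rt (G : 'M[C]_n) : 'M[C]_N := - z^-1 *: invmx (1%:M + Kt G).
Let Rr (G : 'M[C]_n) : 'M[C]_n := - z^-1 *: invmx (1%:M + K (Rt G)).

Lemma posK X : pos u z X -> pos u z (K X).
Proof. by case=> h1 h2; split; apply: Kpos. Qed.
Lemma posKt X : pos u z X -> pos u z (Kt X).
Proof. by case=> h1 h2; split; apply: Ktpos. Qed.

(* The equation for G - T is transposed on the test matrix A, on which the
   resulting map is a contraction when z is far from the half-line. *)
Lemma perturbed_fixpoint (G T : 'M[C]_n) (Tt : 'M[C]_N) (e : R) :
  pos u z G -> pos u z T -> pos u z Tt ->
  T = - z^-1 *: invmx (1%:M + K Tt) -> Tt = - z^-1 *: invmx (1%:M + Kt T) ->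
  2 * n2 z * kap ^+ 2 <= dl ^+ 4 ->
  (forall A, opb 1 A -> normc (\tr ((G - Rr G) *m A)) <= e) ->
  forall A, opb 1 A -> normc (\tr ((G - T) *m A)) <= 2 * e.
Proof.
move=> pG pT pTt TE TtE far he.
have d0 : 0 < dl by case: hd.
have [_ oRt pRt eRt] := pos_fix hd (posKt pG); rewrite -/(Rt G) in oRt pRt eRt.
have [_ oR pR eR] := pos_fix hd (posK pRt); rewrite -/(Rr G) in oR pR eR.
have [_ oT _ eT] := pos_fix hd (posK pTt); rewrite -TE in oT eT.
have [_ oTt _ eTt] := pos_fix hd (posKt pT); rewrite -TtE in oTt eTt.
(* Applying [fix_diff] to both equations expresses Rr G - T as a linear image of G - T; [Ad] is the
   transpose of that linear map for the trace pairing. *)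
pose Ad A := z ^+ 2 *: K (Tt *m Kt (T *m A *m Rr G) *m Rt G).
have adE A : \tr ((Rr G - T) *m A) = \tr ((G - T) *m Ad A).
  rewrite (fix_diff eR eT) -KB (fix_diff eRt eTt) -KtB.
  have cyc p q (X : 'M[C]_(p, q)) Y V : \tr (X *m Y *m V) = \tr (Y *m (V *m X)).
    by rewrite -mulmxA mxtrace_mulC mulmxA.
  have ktadj X Y : \tr (Kt X *m Y) = \tr (X *m K Y).
    by rewrite mxtrace_mulC -Kadj mxtrace_mulC.
  rewrite -scalemxAl mxtraceZ -[_ *m T *m A]mulmxA cyc Kadj -scalemxAl mxtraceZ.
  rewrite -[_ *m Tt *m _]mulmxA cyc ktadj mulrA -expr2.
  by rewrite /Ad -(scalemxAr (z ^+ 2)) mxtraceZ.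
(* Each of the factors T, Tt, Rr, Rt costs 1 / dl and each covariance operator costs [kap]: the norm
   is at most |z|^2 kap^2 / dl^4, which [far] bounds by 1 / 2. *)
have adO A : opb 1 A -> opb (2^-1) (Ad A).
  move=> oA.
  have h := opbZ (z ^+ 2) (Kop (opbM (opbM oTt (Ktop (opbM (opbM oT oA) oR))) oRt)).
  apply: opbW h; rewrite expr2 normcM -expr2 -n2E.
  have -> : n2 z * (kap * (dl^-1 * (kap * (dl^-1 * 1 * dl^-1)) * dl^-1)) =
     (n2 z * kap ^+ 2) / dl ^+ 4 by field; rewrite gt_eqF.
  by rewrite ler_pdivrMr ?exprn_gt0// mulrC; move: far; lra.
(* The supremum over test matrices is finite because the dimension is fixed. Its a priori bound
   depends on n, but disappears when sup V <= e + sup V / 2 is absorbed. *)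
pose V := [set normc (\tr ((G - T) *m A)) | A in [set A | opb 1 A]].
have Vb : has_sup V.
  split.
    by exists (normc (\tr ((G - T) *m 0))), 0 => //=; exact: opb0.
  exists (nrm (G - T) * Num.sqrt n%:R) => _ [A oA <-].
  rewrite (le_trans (normc_trM _ _))// ler_wpM2l//.
  by have := opb_nrm1 oA; rewrite mul1r.
have Vub A : opb 1 A -> normc (\tr ((G - T) *m A)) <= sup V.
  by move=> oA; apply: sup_upper_bound => //; exists A.
have sV : sup V <= e + 2^-1 * sup V.
  apply: ge_sup; first by case: Vb.
  move=> _ [A oA <-].
  have -> : \tr ((G - T) *m A) = \tr ((G - Rr G) *m A) + \tr ((G - T) *m Ad A).
    by rewrite -adE -mxtraceD -mulmxDl addrA subrK.
  rewrite (le_trans (le_normcD _ _))// lerD//; first exact: he.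
  have -> : Ad A = (2^-1)%:C *: (2 *: Ad A).
    by rewrite scalerA rmorphV ?unitfE//= rmorph_nat mulVf// ?scale1r// pnatr_eq0.
  rewrite -scalemxAr mxtraceZ normcM.
  have n2_ (a : R) : 0 <= a -> normc a%:C = a.
    by move=> a0; rewrite /normc/= expr0n addr0 sqrtr_sqr ger0_norm.
  rewrite n2_ ?invr_ge0// ler_wpM2l ?invr_ge0//.
  apply: Vub; have := opbZ 2 (adO _ oA).
  by rewrite -(rmorph_nat (real_complex R)) n2_// mulfV// pnatr_eq0.
move=> A oA; rewrite (le_trans (Vub _ oA))//; lra.
Qed.

End stability.

(** * Rational approximation of resolvents by resolvents at far points *)

Section continuation.
Variable R : realType.
Local Notation C := R[i].

(* F y plays the role of the resolvent at z - y u^*; the coefficients, which are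
   those of Lagrange interpolation of w |-> 1 / (l - w), do not depend on F. *)
Definition resolvent_like (u : C) (dl : R) n (F : R -> 'M[C]_n) :=
  (forall y y', 0 <= y -> 0 <= y' ->
     F y - F y' = ((y' - y)%:C * Num.conj u) *: (F y *m F y')) /\
  (forall y, 0 <= y -> opb (dl + y)^-1 (F y)).

(** By the resolvent identity, a new node y multiplies the error on the right by y u^* F(y), whose
    norm is at most y / (dl + y). *)
Lemma interpolation (u : C) (s : seq R) : n2 u = 1 ->
  uniq (0 :: s) -> all (>= 0) s ->
  exists al : R -> C, forall n dl (F : R -> 'M[C]_n), 0 < dl -> resolvent_like u dl F ->
    opb (dl^-1 * \prod_(y <- s) (y / (dl + y))) (F 0 - \sum_(y <- s) al y *: F y).
Proof.
move=> u1; elim: s => [|y s ih].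
  move=> _ _; exists (fun=> 0) => n dl F d0 [_ hF].
  by rewrite !big_nil subr0 mulr1; have := hF 0 (lexx _); rewrite addr0.
move=> us /andP[y0 s0].
have [|al h] := ih _ s0.
  by move: us; rewrite /= inE negb_or => /andP[/andP[_ ->] /andP[_ ->]].
have ys : y \notin s by move: us; rewrite /= => /and3P[].
have uJ : Num.conj u != 0.
  apply/eqP => /(congr1 (fun x => n2 x)); rewrite n2J u1 n20.
  by move/eqP; rewrite oner_eq0.
(* Partial fractions: y u^* F(t) F(y) = y / (y - t) (F(t) - F(y)). The coefficient of the new node
   collects the identity F(0) - y u^* F(0) F(y) = F(y) and the terms in F(y) of the old nodes. *)
pose be t := al t * (y%:C / (y - t)%:C).
pose ga t := if t == y then 1 - \sum_(t <- s) be t else be t.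
exists ga => n dl F d0 hF; have [hF1 hF2] := hF.
have E : F 0 - \sum_(t <- y :: s) ga t *: F t =
    (y%:C * Num.conj u) *: ((F 0 - \sum_(t <- s) al t *: F t) *m F y).
  have sE G : (forall t, t \in s -> G t = be t *: (F t - F y)) ->
      \sum_(t <- s) G t = \sum_(t <- s) be t *: F t - (\sum_(t <- s) be t) *: F y.
    move=> hG; rewrite scaler_suml -sumrB big_seq [in RHS]big_seq.
    by apply: eq_bigr => t ts; rewrite hG// scalerBr.
  rewrite mulmxBl scalerBr -[y in y%:C * _]subr0 -hF1// mulmx_suml scaler_sumr sE.
    rewrite big_cons /ga eqxx.
    have -> : \sum_(t <- s) (if t == y then 1 - \sum_(t0 <- s) be t0 else be t) *: F t
       = \sum_(t <- s) be t *: F t.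
      rewrite big_seq [RHS]big_seq; apply: eq_bigr => t ts.
      by case: eqP => // ty; move: ys; rewrite -ty ts.
    by rewrite scalerBl scale1r !opprB !opprD !opprK !addrA; congr (_ + _); rewrite addrAC.
  move=> t ts; have t0 : 0 <= t by have /allP/(_ _ ts) := s0.
  have yt : y - t != 0 by rewrite subr_eq0; apply: contraNneq ys => ->.
  rewrite -scalemxAl scalerA hF1// scalerA; congr (_ *: _).
  have ytC : (y - t)%:C != 0 :> C.
    by apply/eqP => /(congr1 (@complex.Re R))/= /eqP; rewrite (negPf yt).
  by rewrite /be subr0; move: ((y - t)%:C) ytC => w w0; field.
rewrite E big_cons.
have hs := h _ _ _ d0 hF.
apply: opbW (opbZ _ (opbM hs (hF2 y y0))).
rewrite normcM normcJ' (normc1_n2 u1) mulr1.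
have -> : normc y%:C = y by rewrite /normc/= expr0n addr0 sqrtr_sqr ger0_norm.
by rewrite le_eqVlt; apply/orP; left; apply/eqP; ring.
Qed.

(** The nodes are packed in ]y0, y0 + 1], so that every factor y / (dl + y) is at most the same r <
    1, and J nodes give an error r^J / dl. The lower bound y0 is free, which allows all nodes to be
    taken in the region where the fixed-point map contracts. *)
Lemma rational_approx (u : C) (dl y0 e : R) : n2 u = 1 -> 0 < dl -> 0 <= y0 -> 0 < e ->
  exists (s : seq R) (al : R -> C), all (> y0) s /\
    forall n (F : R -> 'M[C]_n), resolvent_like u dl F ->
      opb e (F 0 - \sum_(y <- s) al y *: F y).
Proof.
move=> u1 d0 y00 e0.
pose r := (y0 + 1) / (dl + (y0 + 1)).
have r0 : 0 <= r by rewrite divr_ge0 ?addr_ge0// ltW.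
have r1 : r < 1 by rewrite ltr_pdivrMr ?mul1r ?ltrDr// addr_gt0// ltr_wpDl.
have [J hJ] : exists J, dl^-1 * r ^+ J <= e.
  have : (fun J => dl^-1 * r ^+ J) @ \oo --> (dl^-1 * 0 : R).
    by apply: cvgMr; apply: cvg_expr; rewrite ger0_norm.
  rewrite mulr0 => /cvgrPdist_le/(_ e e0) [J _ /(_ J (leqnn J))].
  by rewrite sub0r normrN => h; exists J; rewrite (le_trans (ler_norm _)).
(* Interpolation needs distinct nodes, also distinct from 0. *)
pose s := [seq y0 + i.+1%:R^-1 | i <- iota 0 J] : seq R.
have sP y : y \in s -> y0 < y <= y0 + 1.
  move=> /mapP[i _ ->]; rewrite ltrDl invr_gt0 ltr0n/= lerD2l invf_le1 ?ltr0n//.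
  by rewrite ler1n.
have us : uniq (0 :: s).
  rewrite /= map_inj_uniq ?iota_uniq ?andbT.
    by apply/negP => /sP /andP[]; rewrite ltNge y00.
  move=> i j /addrI /invr_inj /eqP; rewrite eqr_nat => /eqP[].
  by [].
have s0 : all (>= 0) s by apply/allP => y /sP /andP[/ltW /(le_trans y00)].
have [al h] := interpolation u1 us s0.
exists s, al; split; first by apply/allP => y /sP /andP[].
move=> n F hF; apply: opbW (h _ _ _ d0 hF); apply: le_trans hJ.
rewrite ler_wpM2l ?invr_ge0 ?(ltW d0)//.
have -> : r ^+ J = r ^+ size s by rewrite size_map size_iota.
elim: (s) sP => [|y t ih] hy; first by rewrite big_nil.
rewrite big_cons exprS; have /andP[y1 y2] := hy y (mem_head _ _).
have yp : 0 <= y by rewrite (le_trans y00)// ltW.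
apply: ler_pM; rewrite ?divr_ge0 ?addr_ge0 ?(ltW d0)//.
- rewrite big_seq; elim/big_ind: _ => //; first by move=> *; exact: mulr_ge0.
  move=> v vt.
  have /andP[v1 _] : y0 < v <= y0 + 1 by apply: hy; rewrite inE vt orbT.
  by rewrite divr_ge0 ?addr_ge0 ?(le_trans y00 (ltW v1))// ltW.
- rewrite /r ler_pdivrMr ?ltr_wpDr// mulrAC ler_pdivlMr ?ltr_wpDr ?addr_ge0//.
  by nra.
- by apply: ih => v vt; apply: hy; rewrite inE vt orbT.
Qed.

End continuation.

(** * Gaussian laws on the line *)

Section density.
Variable R : realType.
Local Notation leb := (@lebesgue_measure R).
Implicit Types (m s x y t : R).
Import HBNNSimple.
Local Open Scope ereal_scope.

(** The normal law is given by its values on sets. The density formula holds there by definition,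
    extends to simple functions by linearity, and to g by monotone convergence. *)
Lemma ge0_integral_normal m s (g : R -> R) : measurable_fun setT g ->
  (forall x, (0 <= g x)%R) ->
  \int[normal_prob m s]_x (g x)%:E = \int[leb]_x (g x * normal_pdf m s x)%:E.
Proof.
move=> mg g0.
have mgE : measurable_fun setT (EFin \o g) by exact/measurable_EFinP.
have mp := @measurable_normal_pdf R m s.
have p0 x := @normal_pdf_ge0 R m s x.
pose f_ := nnsfun_approx measurableT mgE.
have cf x : (f_ n x)%:E @[n --> \oo] --> (g x)%:E.
  by apply: (@cvg_nnsfun_approx _ _ _ _ measurableT _ mgE) => // y _; rewrite lee_fin.
have mf n : measurable_fun setT (f_ n) by exact: measurable_funPT.
have nd i j y : (i <= j)%N -> (f_ i y <= f_ j y)%R.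
  by move=> /(nd_nnsfun_approx measurableT mgE)/lefP; exact.
transitivity (limn (fun n => \int[normal_prob m s]_x (f_ n x)%:E)).
  rewrite -monotone_convergence//.
  - by apply: eq_integral => y _; apply/esym/cvg_lim => //; exact: cf.
  - by move=> n; apply/measurable_EFinP; exact: mf.
  - by move=> n y _; rewrite lee_fin.
  - by move=> y _ i j ij; rewrite lee_fin; exact: nd.
rewrite [X in limn X](_ : _ =
    (fun n => \int[leb]_x (f_ n x * normal_pdf m s x)%:E)).
  rewrite -monotone_convergence//.
  - apply: eq_integral => x _; apply/cvg_lim => //; rewrite EFinM.
    under eq_fun do rewrite EFinM.
    by apply: cvgeZr => //; exact: cf.
  - by move=> n; apply/measurable_EFinP; exact: (measurable_funM (mf n) mp).
  - by move=> n x _; rewrite lee_fin mulr_ge0.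
  - by move=> x _ i j ij; rewrite lee_fin ler_wpM2r//; exact: nd.
apply/funext => n.
have m1 k : measurable_fun setT (\1_(f_ n @^-1` [set k]) : R -> R).
  by apply: measurable_indic; rewrite -[X in measurable X]setTI; exact: (mf n).
transitivity (\sum_(k \in range (f_ n))
    \int[leb]_x (k * (\1_(f_ n @^-1` [set k]) x * normal_pdf m s x))%:E).
  under eq_integral do rewrite fimfunE -fsumEFin//.
  rewrite ge0_integral_fsum//; last 2 first.
  - by move=> y; apply/measurable_EFinP/measurable_funM; [exact: measurable_cst|exact: m1].
  - by move=> y x _; rewrite nnfun_muleindic_ge0.
  apply: eq_fsbigr => r rr.
  have r0 : (0 <= r)%R by move: rr; rewrite inE => -[x _ <-].
  have mr : measurable (f_ n @^-1` [set r]).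
    by rewrite -[X in measurable X]setTI; exact: (mf n).
  transitivity (r%:E * normal_prob m s (f_ n @^-1` [set r])).
    under eq_integral do rewrite EFinM.
    rewrite ge0_integralZl//.
    - by rewrite integral_indic// setIT.
    - by apply/measurable_EFinP; exact: m1.
  under [RHS]eq_integral do rewrite EFinM.
  have A1 : measurable_fun setT
      (fun x : R => (\1_(f_ n @^-1` [set r]) x * normal_pdf m s x)%:E).
    by apply/measurable_EFinP; exact: (measurable_funM (m1 r) mp).
  have A2 (x : R) : setT x -> 0 <= (\1_(f_ n @^-1` [set r]) x * normal_pdf m s x)%:E.
    by move=> _; rewrite lee_fin mulr_ge0// indicE ler0n.
  have /= -> := @ge0_integralZl _ _ _ leb setT measurableT _ A1 r%:E A2 r0.
  congr (_ * _); rewrite /normal_prob integral_mkcond.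
  by apply: eq_integral => x _; rewrite patchE/= indicE; case: ifP; rewrite ?mul1r ?mul0r.
rewrite -ge0_integral_fsum//.
- apply: eq_integral => x _; rewrite fsumEFin// [in RHS]fimfunE; congr (_%:E).
  rewrite !fsbig_finite//= mulr_suml; apply: eq_bigr => k _.
  by rewrite mulrA.
- move=> r; apply/measurable_EFinP/measurable_funM; first exact: measurable_cst.
  exact: (measurable_funM (m1 r) mp).
- move=> r x _; rewrite mulrA EFinM mule_ge0 ?lee_fin//.
  by rewrite -lee_fin nnfun_muleindic_ge0.
Qed.

End density.

Section gaussian.
Variable R : realType.
Local Notation leb := (@lebesgue_measure R).
Local Notation gam := (normal_prob (0:R) 1).
Implicit Types (m s x y t : R).

(** The scale in [gaussian_rv] may be negative; this reduces it to its absolute value. *)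
Lemma normal_pdf_sqr m s : normal_pdf m `|s| = normal_pdf m s.
Proof.
apply/funext => x; rewrite /normal_pdf normr_eq0; case: ifP => // _.
by rewrite /normal_peak /normal_fun real_normK ?num_real.
Qed.

Lemma gam_cst k : (\int[gam]_x k%:E = k%:E)%E.
Proof.
rewrite integral_cst// [X in (_ * X)%E](_ : _ = 1%E) ?mule1//.
exact: integral_normal_pdf.
Qed.

Lemma normal_affine m s (g : R -> R) : 0 < s -> continuous g -> (forall x, 0 <= g x) ->
  (\int[normal_prob m s]_x (g x)%:E = \int[gam]_x (g (m + s * x))%:E)%E.
Proof.
move=> s0 cg g0.
have cA : continuous (fun x : R => m + s * x).
  by move=> x; apply: cvgD; [exact: cvg_cst|apply: cvgM; [exact: cvg_cst|exact: cvg_id]].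
have mg : measurable_fun setT g by exact: continuous_measurable_fun.
have mgA : measurable_fun setT (fun x : R => g (m + s * x)).
  by apply: measurableT_comp => //; exact: continuous_measurable_fun.
rewrite (ge0_integral_normal _ _ mg g0) (ge0_integral_normal _ _ mgA (fun x => g0 _)).
pose F x : R := m + s * x.
have dF : F^`()%classic = cst s.
  apply/funext => x; rewrite /F derive1E deriveD// derive_cst add0r.
  rewrite deriveM// derive_cst scaler0 addr0 derive_id.
  by rewrite /GRing.scale/= mulr1.
rewrite (@increasing_ge0_integration_by_substitutionT _ F); last 9 first.
- by move=> x y xy; rewrite /F ltrD2l ltr_pM2l.
- by rewrite dF => x; exact: cvg_cst.
- by rewrite dF; exact: is_cvg_cst.
- by rewrite dF; exact: is_cvg_cst.
- by move=> x; apply: derivableD => //; apply: derivableM.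
- apply: (@cvg_comp _ _ _ (fun x => s * x) (fun x => m + x)); last exact: cvg_addrl_Ny.
  by apply: gt0_cvgMrNy => //; exact: cvg_id.
- apply: (@cvg_comp _ _ _ (fun x => s * x) (fun x => m + x)); last exact: cvg_addrl.
  by apply: gt0_cvgMry => //; exact: cvg_id.
- move=> x; apply: cvgM; first exact: cg.
  by apply: continuous_normal_pdf; rewrite gt_eqF.
- by move=> x; rewrite mulr_ge0// normal_pdf_ge0.
apply: eq_integral => x _; congr (_%:E); rewrite /= dF /= -mulrA; congr (_ * _).
rewrite !normal_pdfE ?gt_eqF// /normal_peak /normal_fun /F.
rewrite [LHS]/GRing.mul/=.
have -> : - (m + s * x - m) ^+ 2 / (s ^+ 2 *+ 2) = - (x - 0) ^+ 2 / (1 ^+ 2 *+ 2).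
  by field; rewrite gt_eqF.
rewrite expr1n mul1r -mulrnAr sqrtrM ?sqr_ge0// sqrtr_sqr gtr0_norm// invfM.
by rewrite mulrAC [_ * s](mulrAC) mulVf ?gt_eqF// mul1r.
Qed.

(** A single formula m + s x with x standard covers the degenerate case, where s = 0 gives the Dirac
    mass at m. *)
Lemma gaussian_law d (T : measurableType d) (P : probability T R) (X : T -> R) :
  gaussian_rv P X -> measurable_fun setT X /\ exists m s, 0 <= s /\
    forall g : R -> R, continuous g -> (forall x, 0 <= g x) ->
      (\int[P]_t (g (X t))%:E = \int[gam]_x (g (m + s * x))%:E)%E.
Proof.
move=> [mX [m [s h]]]; split=> //; exists m, `|s|; split=> // g cg g0.
have mg : measurable_fun setT (EFin \o g).
  by apply/measurable_EFinP; exact: continuous_measurable_fun.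
have mX' : measurable_fun setT (X : T -> measurableTypeR R) by [].
have := @ge0_integral_pushforward _ _ _ _ R _ mX' P setT (EFin \o g) measurableT mg.
rewrite preimage_setT => E.
have /E{}E : {in setT, forall y : R, (0 <= (EFin \o g) y)%E}.
  by move=> x _; rewrite /= lee_fin.
rewrite -[LHS]/(\int[P]_x ((EFin \o g) \o X) x)%E -E.
have [s0|s0] := eqVneq s 0.
  rewrite (@eq_measure_integral _ _ _ _ (\d_(m : measurableTypeR R))).
    rewrite integral_dirac// diracT mul1e.
    rewrite s0 normr0; under eq_integral do rewrite mul0r addr0.
    by rewrite gam_cst.
  move=> B mB _; transitivity (P (X @^-1` B)); first by [].
  by rewrite h// s0 eqxx.
rewrite (@eq_measure_integral _ _ _ _ (normal_prob m s)).
  have sp : 0 < `|s| by rewrite normr_gt0.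
  have mgR : measurable_fun setT g by exact: continuous_measurable_fun.
  rewrite -(normal_affine m sp cg g0).
  rewrite (ge0_integral_normal m `|s| mgR g0) normal_pdf_sqr.
  exact: ge0_integral_normal.
move=> B mB _; transitivity (P (X @^-1` B)); first by [].
by rewrite h// (negPf s0).
Qed.

(** Completing the square. With X, Y standard independent, the left side is the joint density of (s
    X + t Y, Y) as conditional times marginal; the right side is the same density with the two roles
    exchanged. *)
Lemma pdf_product s t w y : 0 < s -> 0 <= t ->
  let r := Num.sqrt (s ^+ 2 + t ^+ 2) in
  normal_pdf (t * y) s w * normal_pdf 0 1 y =
  normal_pdf 0 r w * normal_pdf (t * w / r ^+ 2) (s / r) y.
Proof.
move=> s0 t0 r; have r0 : 0 < r by rewrite sqrtr_gt0 ltr_pwDl ?exprn_gt0// sqr_ge0.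
have r2 : r ^+ 2 = s ^+ 2 + t ^+ 2 by rewrite sqr_sqrtr// addr_ge0 ?sqr_ge0.
rewrite !normal_pdfE ?gt_eqF ?divr_gt0//.
rewrite mulrACA [RHS]mulrACA /normal_fun -!expRD /normal_peak; congr (_ * expR _).
  rewrite -!invfM -!sqrtrM; try by rewrite mulrn_wge0// mulr_ge0 ?sqr_ge0// pi_ge0.
  by congr (Num.sqrt _)^-1; field; rewrite gt_eqF.
rewrite expr_div_n r2.
have st : s ^+ 2 + t ^+ 2 != 0 by rewrite gt_eqF// ltr_pwDl ?exprn_gt0// sqr_ge0.
by field; rewrite st gt_eqF.
Qed.

(** By [pdf_product] and Fubini: after the exchange, the conditional density of Y integrates to 1
    and leaves a centred normal law of variance s^2 + t^2. *)
Lemma gam_rotation s t (g : R -> R) : 0 <= s -> 0 <= t -> continuous g ->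
  (forall x, 0 <= g x) ->
  (\int[gam]_y \int[gam]_x (g (s * x + t * y))%:E =
   \int[gam]_x (g (Num.sqrt (s ^+ 2 + t ^+ 2) * x))%:E)%E.
Proof.
move=> s0 t0 cg g0.
have [->|sn0] := eqVneq s 0.
  rewrite expr0n add0r sqrtr_sqr ger0_norm//; apply: eq_integral => y _.
  under eq_integral do rewrite mul0r add0r.
  by rewrite gam_cst.
have {s0 sn0}s0 : 0 < s by rewrite lt0r sn0.
set r := Num.sqrt _.
have r0 : 0 < r by rewrite sqrtr_gt0 ltr_pwDl ?exprn_gt0// sqr_ge0.
have mg : measurable_fun setT g by exact: continuous_measurable_fun.
have mp m s' := @measurable_normal_pdf R m s'.
transitivity (\int[gam]_y \int[leb]_w (g w * normal_pdf (t * y) s w)%:E)%E.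
  apply: eq_integral => y _.
  under eq_integral do rewrite addrC.
  by rewrite -(normal_affine _ s0 cg g0) (ge0_integral_normal _ _ mg g0).
pose h (p : R * R) := g p.1 * normal_pdf (t * p.2) s p.1.
have mh : measurable_fun setT h.
  apply: measurable_funM; first exact: measurableT_comp.
  rewrite /normal_pdf (gt_eqF s0); apply: measurable_funM => //.
  apply: measurableT_comp => //; apply: measurable_funM => //.
  apply: measurableT_comp => //; apply: measurable_funX.
  apply: measurable_funB; first exact: measurable_fst.
  by apply: measurable_funM => //; exact: measurable_snd.
have h0 p : 0 <= h p by rewrite mulr_ge0// normal_pdf_ge0.
transitivity (\int[gam]_y \int[leb]_w (h (w, y))%:E)%E; first by [].
rewrite -(@sfinite_Fubini _ _ _ _ R leb gam (EFin \o h))//; last by apply/measurable_EFinP.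
have -> : (\int[gam]_x (g (r * x))%:E = \int[normal_prob (0:R) r]_w (g w)%:E)%E.
  rewrite (normal_affine 0 r0 cg g0).
  by under [RHS]eq_integral do rewrite add0r.
rewrite ge0_integral_normal//; apply: eq_integral => w _ /=.
have mhw : measurable_fun setT (fun y : R => h (w, y)).
  by apply: (measurableT_comp mh); exact: measurable_pair1.
rewrite (ge0_integral_normal _ _ mhw (fun y => h0 _)).
  transitivity (\int[leb]_y ((g w * normal_pdf 0 r w)%:E * (normal_pdf (t * w / r ^+ 2) (s / r) y)%:E))%E.
    apply: eq_integral => y _; rewrite -EFinM; congr (_%:E).
    by rewrite /h/= -mulrA pdf_product// mulrA.
  rewrite ge0_integralZl//.
  - by rewrite integral_normal_pdf mule1.
  - by apply/measurable_EFinP; exact: mp.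
  - by move=> y _; rewrite lee_fin normal_pdf_ge0.
  - by rewrite lee_fin mulr_ge0// normal_pdf_ge0.
Qed.

Lemma gam_expR a : (\int[gam]_x (expR (a * x))%:E = (expR (a ^+ 2 / 2))%:E)%E.
Proof.
have me : measurable_fun setT (fun x : R => expR (a * x)).
  by apply: measurableT_comp => //; exact: measurable_funM.
rewrite (ge0_integral_normal _ _ me (fun x => expR_ge0 _)).
  transitivity (\int[leb]_x ((expR (a ^+ 2 / 2))%:E * (normal_pdf a 1 x)%:E))%E.
    apply: eq_integral => x _; rewrite -EFinM; congr (_%:E).
    rewrite !normal_pdfE ?oner_eq0// /normal_fun mulrCA -expRD [RHS]mulrCA -expRD.
    by congr (_ * expR _); field.
  rewrite ge0_integralZl//.
  - by rewrite integral_normal_pdf mule1.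
  - by apply/measurable_EFinP; exact: measurable_normal_pdf.
  - by move=> x _; rewrite lee_fin normal_pdf_ge0.
Qed.

Lemma exprn_le_expR k x : 0 <= x -> x ^+ k <= k`!%:R * expR x.
Proof.
case: k => [|k] x0; first by rewrite expr0 fact0 mul1r -[leLHS]expR0 ler_expR.
rewrite -ler_pdivrMl ?ltr0n ?fact_gt0// mulrC.
by rewrite (le_trans _ (expR_ge1Dxn k x0))// lerDr.
Qed.

Lemma continuous_normX k : continuous (fun x : R => `|x| ^+ k).
Proof.
move=> x; apply: (@continuous_comp R R R (fun x => `|x|) (fun x => x ^+ k)).
  exact: (@norm_continuous _ R^o).
exact: exprn_continuous.
Qed.

Lemma gam_moment k : (\int[gam]_x (`|x| ^+ k)%:E < +oo)%E.
Proof.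
have me a : measurable_fun setT (fun x : R => (expR (a * x))%:E).
  by apply/measurable_EFinP; apply: measurableT_comp => //; exact: measurable_funM.
have e0 a x : (0%:E <= (expR (a * x))%:E :> \bar R)%E by rewrite lee_fin expR_ge0.
apply: (@le_lt_trans _ _ (\int[gam]_x ((k`!%:R)%:E * ((expR (1 * x))%:E + (expR (-1 * x))%:E)))%E).
  apply: ge0_le_integral => //.
  - by apply/measurable_EFinP; apply: continuous_measurable_fun; exact: continuous_normX.
  - by apply: emeasurable_funM; [exact: measurable_cst|exact: (emeasurable_funD (me 1) (me (-1)))].
  - move=> x _; rewrite -EFinD -EFinM lee_fin (le_trans (exprn_le_expR _ _))//.
    rewrite ler_wpM2l// mul1r mulN1r; case: (leP 0 x) => x0.
      by rewrite ger0_norm// lerDl expR_ge0.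
    by rewrite ltr0_norm// lerDr expR_ge0.
have mS := emeasurable_funD (me 1) (me (-1)).
have nS (x : R) : setT x -> (0 <= (expR (1 * x))%:E + (expR (-1 * x))%:E)%E.
  by move=> _; rewrite adde_ge0.
have /= -> := @ge0_integralZl _ _ _ gam setT measurableT _ mS (k`!%:R)%:E nS (ler0n _ _).
have -> : (\int[gam]_x ((expR (1 * x))%:E + (expR (-1 * x))%:E) =
   \int[gam]_x (expR (1 * x))%:E + \int[gam]_x (expR (-1 * x))%:E)%E.
  by apply: ge0_integralD => //; exact: me.
by rewrite !gam_expR -EFinD -EFinM ltry.
Qed.

(** Positivity is obtained by contradiction: a zero second moment would make x vanish almost
    everywhere, and the integral of exp x would be 1 instead of exp (1 / 2). *)
Lemma gam_var : exists2 v : R, 0 < v & (\int[gam]_x (x ^+ 2)%:E = v%:E)%E.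
Proof.
have E : (\int[gam]_x (x ^+ 2)%:E = \int[gam]_x (`|x| ^+ 2)%:E)%E.
  by apply: eq_integral => x _; rewrite real_normK ?num_real.
have i0 : (0 <= \int[gam]_x (x ^+ 2)%:E)%E.
  by apply: integral_ge0 => x _; rewrite lee_fin sqr_ge0.
have fin : (\int[gam]_x (x ^+ 2)%:E)%E \is a fin_num.
  by rewrite ge0_fin_numE// E; exact: gam_moment.
have mX2 : measurable_fun setT (fun x : R => (x ^+ 2)%:E).
  by apply/measurable_EFinP; exact: measurable_funX.
exists (fine (\int[gam]_x (x ^+ 2)%:E)%E); last by rewrite fineK.
rewrite fine_gt0// ltey_eq fin/= andbT lt0e i0 andbT; apply/eqP => e0.
have ae : ae_eq gam setT (fun x : R => (x ^+ 2)%:E) (cst 0%E).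
  apply/ae_eq_integral_abs => //; rewrite -[RHS]e0; apply: eq_integral => x _.
  by rewrite gee0_abs// lee_fin sqr_ge0.
have : (\int[gam]_x (expR (1 * x))%:E = \int[gam]_x 1%:E)%E.
  apply: ae_eq_integral => //.
  - by apply/measurable_EFinP; apply: measurableT_comp => //; exact: measurable_funM.
  apply: filterS ae => x /= /(_ Logic.I) [] /eqP.
  by rewrite expf_eq0/= => /eqP -> _; rewrite mulr0 expR0.
rewrite gam_expR gam_cst => -[]; rewrite expr1n => /eqP.
by rewrite -[X in _ == X]expR0 (inj_eq (@expR_inj R)) mul1r invr_eq0 pnatr_eq0.
Qed.

End gaussian.

(** * Families of Gaussian variables *)

Section trig_uniqueness.
Variables (R : realType) (J : finType).
Implicit Types (f g : (J -> R) -> R) (a b : J -> R) (x : J -> R).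

(** Two families with the same characteristic function have the same integrals of these functions.
    By the addition formulas they form an algebra, and the indicator of a box is an iterated
    pointwise limit of bounded members of it. *)
Inductive trigpoly : ((J -> R) -> R) -> Prop :=
| trigpoly_cos a : trigpoly (fun x => cos (\sum_j a j * x j))
| trigpoly_sin a : trigpoly (fun x => sin (\sum_j a j * x j))
| trigpolyD f g : trigpoly f -> trigpoly g -> trigpoly (fun x => f x + g x)
| trigpolyZ k f : trigpoly f -> trigpoly (fun x => k * f x).

Lemma trigpoly_ext f g : f =1 g -> trigpoly f -> trigpoly g.
Proof. by move=> /funext ->. Qed.

Lemma sum_linD a b x : \sum_j (a j + b j) * x j = \sum_j a j * x j + \sum_j b j * x j.
Proof. by rewrite -big_split/=; apply: eq_bigr => j _; rewrite mulrDl. Qed.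

Lemma sum_linB a b x : \sum_j (a j - b j) * x j = \sum_j a j * x j - \sum_j b j * x j.
Proof. by rewrite -sumrB; apply: eq_bigr => j _; rewrite mulrBl. Qed.

Lemma trigpolyM f g : trigpoly f -> trigpoly g -> trigpoly (fun x => f x * g x).
Proof.
move=> tf; elim: tf g => {f}.
- move=> a g; elim=> {g}.
  + move=> b; apply: (@trigpoly_ext (fun x => 2^-1 * (cos (\sum_j (a j + b j) * x j) +
      cos (\sum_j (a j - b j) * x j)))).
      by move=> x; rewrite ?sum_linB sum_linD ?sum_linB cosB cosD; field.
    by apply: trigpolyZ; apply: trigpolyD; exact: trigpoly_cos.
  + move=> b; apply: (@trigpoly_ext (fun x => 2^-1 * (sin (\sum_j (a j + b j) * x j) +
      -1 * sin (\sum_j (a j - b j) * x j)))).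
      by move=> x; rewrite ?sum_linB sum_linD ?sum_linB sinB sinD; field.
    by apply: trigpolyZ; apply: trigpolyD; [|apply: trigpolyZ]; exact: trigpoly_sin.
  + move=> f g _ hf _ hg; apply: trigpoly_ext (trigpolyD hf hg) => x; ring.
  + move=> k f _ hf; apply: trigpoly_ext (trigpolyZ k hf) => x; ring.
- move=> a g; elim=> {g}.
  + move=> b; apply: (@trigpoly_ext (fun x => 2^-1 * (sin (\sum_j (a j + b j) * x j) +
      sin (\sum_j (a j - b j) * x j)))).
      by move=> x; rewrite ?sum_linB sum_linD ?sum_linB sinB sinD; field.
    by apply: trigpolyZ; apply: trigpolyD; exact: trigpoly_sin.
  + move=> b; apply: (@trigpoly_ext (fun x => 2^-1 * (cos (\sum_j (a j - b j) * x j) +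
      -1 * cos (\sum_j (a j + b j) * x j)))).
      by move=> x; rewrite ?sum_linB sum_linD ?sum_linB cosB cosD; field.
    by apply: trigpolyZ; apply: trigpolyD; [|apply: trigpolyZ]; exact: trigpoly_cos.
  + move=> f g _ hf _ hg; apply: trigpoly_ext (trigpolyD hf hg) => x; ring.
  + move=> k f _ hf; apply: trigpoly_ext (trigpolyZ k hf) => x; ring.
- move=> f g _ hf _ hg h th; apply: trigpoly_ext (trigpolyD (hf _ th) (hg _ th)) => x; ring.
- move=> k f _ hf h th; apply: trigpoly_ext (trigpolyZ k (hf _ th)) => x; ring.
Qed.

Lemma trigpoly_cst (k : R) : trigpoly (fun=> k).
Proof.
apply: trigpoly_ext (trigpolyZ k (trigpoly_cos (fun=> 0))) => x.
by rewrite big1 ?cos0 ?mulr1// => j _; rewrite mul0r.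
Qed.

Lemma trigpoly_prod (r : seq J) (F : J -> (J -> R) -> R) :
  (forall j, trigpoly (F j)) -> trigpoly (fun x => \prod_(j <- r) F j x).
Proof.
move=> h; elim: r => [|j r ih].
  by apply: trigpoly_ext (trigpoly_cst 1) => x; rewrite big_nil.
by apply: trigpoly_ext (trigpolyM (h j) ih) => x; rewrite big_cons.
Qed.

(* The iterates of t (3 - t^2) / 2 converge to the sign on [-1, 1], hence
   (s + s^2) / 2 with s such an iterate converges to the indicator of ]0, 1]. *)
Definition newton (t : R) := t * (3 - t ^+ 2) / 2.
Definition step n (t : R) := (iter n newton t + iter n newton t ^+ 2) / 2.

Lemma newton_bound t : `|t| <= 1 -> `|newton t| <= 1.
Proof.
rewrite !ler_norml /newton => /andP[t1 t2]; apply/andP; split.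
  have : 0 <= (t + 1) ^+ 2 * (2 - t) by rewrite mulr_ge0 ?sqr_ge0//; lra.
  by rewrite -subr_ge0; lra.
have : 0 <= (t - 1) ^+ 2 * (2 + t) by rewrite mulr_ge0 ?sqr_ge0//; lra.
by rewrite -subr_ge0; lra.
Qed.

Lemma iter_newton_bound n t : `|t| <= 1 -> `|iter n newton t| <= 1.
Proof. by move=> t1; elim: n => // n ih; rewrite iterS newton_bound. Qed.

Lemma newtonN t : newton (- t) = - newton t.
Proof. by rewrite /newton; field. Qed.

Lemma iter_newtonN n t : iter n newton (- t) = - iter n newton t.
Proof. by elim: n => // n ih; rewrite !iterS ih newtonN. Qed.

(** The factorization 1 - newton s = (1 - (s + s^2) / 2) (1 - s) shows that the distance to 1
    shrinks by a factor at most 1 - t / 2 as long as s >= t, and the iterates increase from t. *)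
Lemma iter_newton_pos n t : 0 < t <= 1 ->
  t <= iter n newton t <= 1 /\ 1 - iter n newton t <= (1 - t / 2) ^+ n.
Proof.
move=> /andP[t0 t1]; elim: n => [|n [/andP[h1 h2] ih]].
  by rewrite expr0/= lexx t1; split=> //; lra.
rewrite iterS exprS; set s := iter n newton t in h1 h2 ih *.
have s1 : s <= newton s.
  rewrite /newton -subr_ge0 (_ : _ - _ = s * ((1 - s) * (1 + s)) / 2); last by field.
  by rewrite !mulr_ge0 ?subr_ge0 ?invr_ge0//; lra.
have s2 : newton s <= 1.
  have := @newton_bound s; rewrite !ler_norml => h.
  have /andP[] // : -1 <= newton s <= 1 by apply: h; rewrite h2 andbT; lra.
rewrite (le_trans h1 s1) s2; split=> //.
have -> : 1 - newton s = (1 - (s + s ^+ 2) / 2) * (1 - s) by rewrite /newton; field.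
apply: ler_pM; rewrite ?subr_ge0//; last first.
  by rewrite lerD2l lerN2 ler_pM2r ?invr_gt0// (le_trans h1)// lerDl sqr_ge0.
by rewrite ler_pdivrMr// mul1r; nra.
Qed.

Lemma cvg_step t : `|t| <= 1 -> step n t @[n --> \oo] --> ((0 < t)%R%:R : R).
Proof.
move=> t1.
have pos (u : R) : 0 < u <= 1 -> iter n newton u @[n --> \oo] --> (1 : R).
  move=> u01; have u2 : `|1 - u / 2| < 1.
    by move: u01 => /andP[? ?]; rewrite ger0_norm; lra.
  have h0 : (fun n => 1 - (1 - u / 2) ^+ n) @ \oo --> (1 - 0 : R).
    by apply: cvgB; [exact: cvg_cst|exact: cvg_expr].
  rewrite subr0 in h0.
  apply: squeeze_cvgr; [|exact: h0|exact: cvg_cst].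
  apply: nearW => n; have [/andP[_ ->] h] := iter_newton_pos n u01.
  by rewrite andbT lerBlDr addrC -lerBlDr.
have fin (l : R) : iter n newton t @[n --> \oo] --> l -> (l + l ^+ 2) / 2 = (0 < t)%R%:R ->
    step n t @[n --> \oo] --> ((0 < t)%R%:R : R).
  move=> h <-; apply: cvgM; last exact: cvg_cst.
  by apply: cvgD => //; rewrite expr2; under eq_fun do rewrite expr2; exact: cvgM.
move: fin; have [t0|t0|t0] := ltgtP t 0 => fin.
- apply: (fin (-1)); last by rewrite sqrrN expr1n addNr mul0r.
  have {1}-> : t = - - t by rewrite opprK.
  under eq_fun do rewrite iter_newtonN.
  by apply: cvgN; apply: pos; rewrite oppr_gt0 t0 (le_trans _ t1)// ltr0_norm.
- apply: (fin 1); last by rewrite expr1n/=; field.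
  by apply: pos; rewrite t0 (le_trans _ t1)// ler_norm.
- apply: (fin 0); last by rewrite expr0n addr0 mul0r.
  rewrite t0 (_ : (fun n => _) = cst 0); first exact: cvg_cst.
  by apply/funext => n /=; elim: n => // n ih; rewrite iterS ih /newton mul0r mul0r.
Qed.

Lemma step_bound n t : `|t| <= 1 -> `|step n t| <= 1.
Proof.
move=> /(iter_newton_bound n); rewrite /step; set s := iter _ _ _.
rewrite !ler_norml => /andP[s1 s2]; apply/andP; split; nra.
Qed.

Lemma trigpoly_step n f : trigpoly f -> trigpoly (fun x => step n (f x)).
Proof.
move=> tf.
have tn : trigpoly (fun x => iter n newton (f x)).
  elim: n => // n ih.
  apply: (trigpoly_ext _ (trigpolyD (trigpolyZ (3 / 2) ih)
     (trigpolyZ (- 2^-1) (trigpolyM ih (trigpolyM ih ih))))) => x.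
  by rewrite iterS /newton; field.
apply: (trigpoly_ext _ (trigpolyD (trigpolyZ (2^-1) tn) (trigpolyZ (2^-1) (trigpolyM tn tn)))) => x.
by rewrite /step; field.
Qed.

Lemma cvg_prodr (r : seq J) (F : J -> nat -> R) (l : J -> R) :
  (forall j, F j n @[n --> \oo] --> l j) ->
  \prod_(j <- r) F j n @[n --> \oo] --> \prod_(j <- r) l j.
Proof.
move=> h; elim: r => [|j r ih].
  by rewrite big_nil; under eq_fun do rewrite big_nil; exact: cvg_cst.
by rewrite big_cons; under eq_fun do rewrite big_cons; exact: cvgM.
Qed.

(** Products of open upper half-lines; [None] leaves a coordinate free, so that the whole space is a
    box. *)
Definition boxed (b : J -> option R) x := forall j, if b j is Some r then r < x j else true.

Section two_families.
Context d (T : measurableType d) (mu : probability T R).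
Variables U V : J -> T -> R.
Hypothesis mU : forall j, measurable_fun setT (U j).
Hypothesis mV : forall j, measurable_fun setT (V j).
Hypothesis eq_cos : forall a, \int[mu]_t cos (\sum_j a j * U j t) = \int[mu]_t cos (\sum_j a j * V j t).
Hypothesis eq_sin : forall a, \int[mu]_t sin (\sum_j a j * U j t) = \int[mu]_t sin (\sum_j a j * V j t).

Let good f := [/\ exists K, forall x, `|f x| <= K,
  measurable_fun setT (fun t => f (fun j => U j t)),
  measurable_fun setT (fun t => f (fun j => V j t)) &
  \int[mu]_t f (fun j => U j t) = \int[mu]_t f (fun j => V j t)].

Lemma bounded_integrable (h : T -> R) K : measurable_fun setT h -> (forall t, `|h t| <= K) ->
  mu.-integrable setT (EFin \o h).
Proof.
move=> mh hK; apply: measurable_bounded_integrable => //.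
  by rewrite (le_lt_trans (probability_le1 _ _))// ltry.
by exists K; split; [exact: num_real|move=> M KM t _; rewrite /= (le_trans (hK t))// ltW].
Qed.

Lemma trigpoly_good f : trigpoly f -> good f.
Proof.
elim=> {f}.
- move=> a; split; first by exists 1 => x; rewrite ler_norml cos_geN1 cos_le1.
  + apply: measurableT_comp; first by apply: continuous_measurable_fun; exact: continuous_cos.
    by apply: measurable_sum => j; exact: measurable_funM.
  + apply: measurableT_comp; first by apply: continuous_measurable_fun; exact: continuous_cos.
    by apply: measurable_sum => j; exact: measurable_funM.
  + exact: eq_cos.
- move=> a; split; first by exists 1 => x; rewrite ler_norml sin_geN1 sin_le1.
  + apply: measurableT_comp; first by apply: continuous_measurable_fun; exact: continuous_sin.
    by apply: measurable_sum => j; exact: measurable_funM.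
  + apply: measurableT_comp; first by apply: continuous_measurable_fun; exact: continuous_sin.
    by apply: measurable_sum => j; exact: measurable_funM.
  + exact: eq_sin.
- move=> f g _ [[Kf bf] fU fV ef] _ [[Kg bg] gU gV eg]; split.
  + by exists (Kf + Kg) => x; rewrite (le_trans (ler_normD _ _))// lerD.
  + exact: measurable_funD.
  + exact: measurable_funD.
  + rewrite !RintegralD// ?ef ?eg//.
    * by apply: (bounded_integrable fV) => t; exact: bf.
    * by apply: (bounded_integrable gV) => t; exact: bg.
    * by apply: (bounded_integrable fU) => t; exact: bf.
    * by apply: (bounded_integrable gU) => t; exact: bg.
- move=> k f _ [[K bf] fU fV ef]; split.
  + by exists (`|k| * K) => x; rewrite normrM ler_wpM2l.
  + exact: measurable_funM.
  + exact: measurable_funM.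
  + rewrite !RintegralZl// ?ef//.
    * by apply: (bounded_integrable fV) => t; exact: bf.
    * by apply: (bounded_integrable fU) => t; exact: bf.
Qed.

Lemma Rintegral_dct (h_ : nat -> T -> R) (h : T -> R) :
  (forall n, measurable_fun setT (h_ n)) -> (forall n t, `|h_ n t| <= 1) ->
  (forall t, h_ n t @[n --> \oo] --> h t) ->
  measurable_fun setT h /\ \int[mu]_t h_ n t @[n --> \oo] --> \int[mu]_t h t.
Proof.
move=> mh bh ch.
have mhl : measurable_fun setT h by apply: (measurable_fun_cvg mh) => t _; exact: ch.
split=> //.
have i1 : mu.-integrable setT (EFin \o cst (1 : R)).
  by apply: (@bounded_integrable _ 1) => // t; rewrite normr1.
have [ih _ c] := @dominated_convergence _ _ R mu setT measurableT
  (fun n => EFin \o h_ n) (EFin \o h) (EFin \o cst 1)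
  (fun n => (measurable_EFinP _ _).2 (mh n)) ((measurable_EFinP _ _).2 mhl)
  (aeW _ (fun t _ => (cvg_comp _ _ (ch t) (fun _ => id)))) i1
  (aeW _ (fun t n _ => bh n t)).
by apply: fine_cvg; rewrite fineK//; exact: integrable_fin_num.
Qed.

Lemma good_lim (f_ : nat -> (J -> R) -> R) f : (forall n, good (f_ n)) ->
  (forall n x, `|f_ n x| <= 1) -> (forall x, f_ n x @[n --> \oo] --> f x) -> good f.
Proof.
move=> hf bf cf.
have [mfU cU] := @Rintegral_dct (fun n t => f_ n (fun j => U j t)) (fun t => f (fun j => U j t))
  (fun n => let: And4 _ h _ _ := hf n in h) (fun n t => bf n _) (fun t => cf _).
have [mfV cV] := @Rintegral_dct (fun n t => f_ n (fun j => V j t)) (fun t => f (fun j => V j t))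
  (fun n => let: And4 _ _ h _ := hf n in h) (fun n t => bf n _) (fun t => cf _).
split=> //.
- exists 1 => x; have c : `|f_ n x| @[n --> \oo] --> `|f x| by apply: cvg_norm.
  rewrite -(cvg_lim _ c)//; apply: limr_le; first by apply/cvg_ex; exists `|f x|.
  exact: nearW.
- have E : (fun n => \int[mu]_t f_ n (fun j => U j t)) = (fun n => \int[mu]_t f_ n (fun j => V j t)).
    by apply/funext => n; have [_ _ _ ->] := hf n.
  by rewrite E in cU; rewrite -(cvg_lim _ cU)// -(cvg_lim _ cV).
Qed.

(** The indicator of r < y is the limit in k of the indicator of sin ((y - r) / (k + 1)) > 0, itself
    the limit in n of [step n] of that sine, a trigonometric polynomial. Products over the
    coordinates and two dominated limits give the boxes. *)
Lemma box_unique (b : J -> option R) : mu [set t | boxed b (fun j => U j t)] = mu [set t | boxed b (fun j => V j t)].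
Proof.
pose F x : R := \prod_j (if b j is Some r then (r < x j)%R%:R else 1).
pose arg k r (y : R) := (y - r) / k.+1%:R.
pose F1 k x : R := \prod_j (if b j is Some r then (0 < sin (arg k r (x j)))%R%:R else 1).
pose F2 k n x : R := \prod_j (if b j is Some r then step n (sin (arg k r (x j))) else 1).
have sb (t : R) : `|sin t| <= 1 by rewrite ler_norml sin_geN1 sin_le1.
have bprod (G : J -> R) : (forall j, `|G j| <= 1) -> `|\prod_j G j| <= 1.
  move=> h; rewrite normr_prod; apply: (@le_trans _ _ (\prod_(j : J) 1)).
    by apply: ler_prod => j _; rewrite normr_ge0 h.
  by rewrite big1.
have tsin k j r : trigpoly (fun x => sin (arg k r (x j))).
  have E (y : J -> R) : \sum_i (i == j)%:R / k.+1%:R * y i = y j / k.+1%:R.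
    rewrite (bigD1 j)//= eqxx mul1r big1 ?addr0 1?mulrC// => i /negPf ->.
    by rewrite !mul0r.
  apply: (trigpoly_ext _ (trigpolyD
     (trigpolyZ (cos (r / k.+1%:R)) (trigpoly_sin (fun i => (i == j)%:R / k.+1%:R)))
     (trigpolyZ (- sin (r / k.+1%:R)) (trigpoly_cos (fun i => (i == j)%:R / k.+1%:R))))) => x.
  by rewrite !E /arg mulrBl sinB; ring.
have g2 k n : good (F2 k n).
  apply: trigpoly_good; apply: trigpoly_prod => j; case: (b j) => [r|].
    exact: trigpoly_step.
  exact: trigpoly_cst.
have g1 k : good (F1 k).
  apply: (good_lim (g2 k)).
    move=> n x; apply: bprod => j; case: (b j) => [r|]; last by rewrite normr1.
    exact: step_bound.
  move=> x; apply: cvg_prodr => j; case: (b j) => [r|]; last exact: cvg_cst.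
  exact: cvg_step.
have gF : good F.
  apply: (good_lim g1).
    move=> n x; apply: bprod => j; case: (b j) => [r|]; last by rewrite normr1.
    by case: (0 < _); rewrite ?normr1 ?normr0.
  move=> x; apply: cvg_prodr => j; case: (b j) => [r|]; last exact: cvg_cst.
  (* At fixed x the indicator is eventually constant: once |x j - r| < k + 1 the angle is below 1 <
     pi in absolute value, and its sine has the sign of x j - r. *)
  apply: cvg_near_cst.
  have [K hK] : exists K : nat, `|x j - r| < K%:R.
    exists (Num.truncn `|x j - r|).+1; exact: truncnS_gt.
  exists K => // k /= Kk; congr ((nat_of_bool _)%:R).
  have k0 : 0 < k.+1%:R :> R by rewrite ltr0n.
  have small : `|arg k r (x j)| < 1.
    rewrite normrM normfV (gtr0_norm k0) ltr_pdivrMr// mul1r (lt_le_trans hK)// ler_nat.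
    exact: leqW.
  have pi1 : 1 < pi :> R by rewrite (lt_le_trans _ (@pi_ge2 R))// ltr1n.
  have [xr|xr|xr] := ltgtP r (x j).
  - rewrite sin_gt0_pi// divr_gt0 ?subr_gt0//=.
    by rewrite (lt_trans (le_lt_trans (ler_norm _) small)).
  - apply/negbTE; rewrite -leNgt -oppr_ge0 -sinN.
    apply: sin_ge0_pi; rewrite -mulNr opprB divr_ge0 ?subr_ge0 ?ltW//=.
    rewrite -opprB mulNr (le_lt_trans _ (lt_trans small pi1))//.
    by rewrite -normrN ler_norm.
  - by rewrite xr /arg subrr mul0r sin0 ltxx.
have FE x : F x = \1_[set x | boxed b x] x.
  rewrite indicE; have [bx|bx] := asboolP (boxed b x).
    rewrite mem_set// /F big1// => j _; have := bx j; case: (b j) => // r ->.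
    by [].
  rewrite memNset//; apply/eqP; rewrite prodf_seq_eq0; apply/hasP.
  have /existsNP[j hj] := bx; exists j; rewrite ?mem_index_enum//=.
  by move: hj; case: (b j) => [r /negP/negPf ->|//]; rewrite eqxx.
have [_ mFU mFV e] := gF.
have key (W : J -> T -> R) : measurable_fun setT (fun t => F (fun j => W j t)) ->
    (\int[mu]_t F (fun j => W j t))%:E = mu [set t | boxed b (fun j => W j t)].
  move=> mF; have mA : measurable [set t | boxed b (fun j => W j t)].
    have -> : [set t | boxed b (fun j => W j t)] = setT `&` (fun t => F (fun j => W j t)) @^-1` [set 1].
      rewrite setTI; apply/seteqP; split=> t /=; rewrite FE indicE.
        by move=> ?; rewrite mem_set.
      case: (boolP (_ \in _)) => [|_ /eqP]; first by rewrite inE.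
      by rewrite eq_sym oner_eq0.
    by apply: mF => //; exact: measurable_set1.
  have I : (\int[mu]_t (F (fun j => W j t))%:E = mu [set t | boxed b (fun j => W j t)])%E.
    transitivity (\int[mu]_t (\1_[set t | boxed b (fun j => W j t)] t)%:E)%E.
      by apply: eq_integral => t _; rewrite FE !indicE.
    by rewrite integral_indic// setIT.
  by rewrite /Rintegral I fineK// fin_num_measure.
by rewrite -key// -key// e.
Qed.

End two_families.
End trig_uniqueness.

(** * Linear forms in a centred Gaussian family *)

Section linear_functionals.
Context (R : realType) d (T : measurableType d) (P : probability T R) (J : finType).
Variable x : J -> T -> R.
Local Notation gam := (normal_prob (0:R) 1).

Definition lin (a : J -> R) t := \sum_j a j * x j t.
Hypothesis jg : forall a, gaussian_rv P (lin a).
Hypothesis sym : forall a,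
  (\int[P]_t (expR (lin a t))%:E = \int[P]_t (expR (- lin a t))%:E)%E.

Lemma lin_measurable a : measurable_fun setT (lin a).
Proof. by have [] := gaussian_law (jg a). Qed.

Lemma coord_measurable j : measurable_fun setT (x j).
Proof.
have := lin_measurable (fun i => (i == j)%:R); congr measurable_fun.
apply/funext => t; rewrite /lin (bigD1 j)//= eqxx mul1r big1 ?addr0// => i /negPf ->.
by rewrite mul0r.
Qed.

Lemma gam_expR_affine (m s : R) :
  (\int[gam]_y (expR (m + s * y))%:E = (expR (m + s ^+ 2 / 2))%:E)%E.
Proof.
under eq_integral do rewrite expRD EFinM.
have me : measurable_fun setT (fun y : R => (expR (s * y))%:E).
  by apply/measurable_EFinP; apply: measurableT_comp => //; exact: measurable_funM.
have ne (y : R) : setT y -> (0 <= (expR (s * y))%:E)%E by rewrite lee_fin expR_ge0.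
have /= -> := @ge0_integralZl _ _ _ gam setT measurableT _ me (expR m)%:E ne (expR_ge0 _).
have -> := gam_expR s.
by rewrite -EFinM -expRD.
Qed.

Definition lin_law_spec a (s : R) := 0 <= s /\
  forall g : R -> R, continuous g -> (forall y, 0 <= g y) ->
    (\int[P]_t (g (lin a t))%:E = \int[gam]_y (g (s * y))%:E)%E.

(** The exponential moment of a normal law is exp (m + s^2 / 2); equality with that of its opposite
    forces m = 0. *)
Lemma lin_law a : exists s, lin_law_spec a s.
Proof.
have [_ [m [s [s0 h]]]] := gaussian_law (jg a).
have m0 : m = 0.
  have := sym a.
  have cN : continuous (fun y : R => expR (- y)).
    move=> y; apply: (@continuous_comp R R R (fun y => - y) expR).
      by apply: cvgN; exact: cvg_id.
    exact: continuous_expR.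
  rewrite (h expR (@continuous_expR R) (@expR_ge0 R)).
  rewrite (h (fun y => expR (- y)) cN (fun y => expR_ge0 _)).
  under [in X in _ = X -> _]eq_integral do rewrite opprD -mulNr.
  rewrite !gam_expR_affine sqrrN => -[] /expR_inj /addIr.
  lra.
exists s; split=> // g cg g0; rewrite (h g cg g0).
by apply: eq_integral => y _; rewrite m0 add0r.
Qed.

Lemma lin_var a s v : lin_law_spec a s -> (\int[gam]_y (y ^+ 2)%:E = v%:E)%E ->
  (\int[P]_t (lin a t ^+ 2)%:E = (s ^+ 2 * v)%:E)%E.
Proof.
move=> [s0 h] hv.
have c2 : continuous (fun y : R => y ^+ 2) by exact: exprn_continuous.
rewrite (h _ c2 (fun y => sqr_ge0 y)).
under eq_integral do rewrite exprMn EFinM.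
have me : measurable_fun setT (fun y : R => (y ^+ 2)%:E).
  by apply/measurable_EFinP; exact: measurable_funX.
have ne (y : R) : setT y -> (0 <= (y ^+ 2)%:E)%E by rewrite lee_fin sqr_ge0.
have /= -> := @ge0_integralZl _ _ _ gam setT measurableT _ me (s ^+ 2)%:E ne (sqr_ge0 _).
by have -> := hv.
Qed.

Lemma lin_conv a b sa sb (g : R -> R) : lin_law_spec a sa -> lin_law_spec b sb ->
  continuous g -> (forall y, 0 <= g y) ->
  (\int[P]_t' \int[P]_t (g (lin a t + lin b t'))%:E =
   \int[gam]_y (g (Num.sqrt (sb ^+ 2 + sa ^+ 2) * y))%:E)%E.
Proof.
move=> [sa0 ha] [sb0 hb] cg g0.
have cadd (c : R) : continuous (fun y => g (y + c)).
  move=> y; apply: (@continuous_comp R R R (fun y => y + c) g); last exact: cg.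
  by apply: cvgD; [exact: cvg_id|exact: cvg_cst].
transitivity (\int[P]_t' \int[gam]_y (g (sa * y + lin b t'))%:E)%E.
  by apply: eq_integral => t' _; exact: (ha _ (cadd (lin b t'))).
pose h (p : T * R) := g (sa * p.2 + lin b p.1).
have mh : measurable_fun setT (EFin \o h).
  apply/measurable_EFinP; apply: (measurableT_comp (continuous_measurable_fun cg)).
  apply: measurable_funD; first by apply: measurable_funM => //; exact: measurable_snd.
  by apply: (measurableT_comp (lin_measurable b)); exact: measurable_fst.
transitivity (\int[P]_t' \int[gam]_y (EFin \o h) (t', y))%E; first by [].
rewrite (@sfinite_Fubini _ _ _ _ R P gam (EFin \o h))//; last by move=> p; rewrite lee_fin g0.
transitivity (\int[gam]_y \int[gam]_w (g (sb * w + sa * y))%:E)%E; last first.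
  exact: gam_rotation.
apply: eq_integral => y _; rewrite /h/=.
under eq_integral do rewrite addrC.
exact: (hb _ (cadd (sa * y))).
Qed.

(** Both sides are integrals against centred normal laws, so it suffices to compare the variances,
    and their sums agree because (c x - e y)^2 + (e x + c y)^2 = x^2 + y^2 holds pointwise. No
    covariance is computed. *)
Lemma lin_rotation a b (c e : R) (g : R -> R) : c ^+ 2 + e ^+ 2 = 1 ->
  continuous g -> (forall y, 0 <= g y) ->
  (\int[P]_t' \int[P]_t (g (lin (fun j => c * a j - e * b j) t + lin (fun j => e * a j + c * b j)%R t'))%:E =
   \int[P]_t' \int[P]_t (g (lin a t + lin b t'))%:E)%E.
Proof.
move=> ce cg g0.
set a' := fun j => c * a j - e * b j; set b' := fun j => (e * a j + c * b j)%R.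
have [sa ha] := lin_law a; have [sb hb] := lin_law b.
have [sa' ha'] := lin_law a'; have [sb' hb'] := lin_law b'.
have [v v0 hv] := @gam_var R.
rewrite (lin_conv ha hb cg g0) (lin_conv ha' hb' cg g0).
suff -> : sb' ^+ 2 + sa' ^+ 2 = sb ^+ 2 + sa ^+ 2 by [].
apply: (mulIf (lt0r_neq0 v0)); apply: EFin_inj.
rewrite !mulrDl !EFinD -(lin_var ha hv) -(lin_var hb hv) -(lin_var ha' hv) -(lin_var hb' hv).
have m2 f : measurable_fun setT (fun t => (lin f t ^+ 2)%:E).
  by apply/measurable_EFinP; apply: measurable_funX; exact: lin_measurable.
have n2 f t : setT t -> (0 <= (lin f t ^+ 2)%:E)%E by rewrite lee_fin sqr_ge0.
rewrite -!ge0_integralD//; last 4 first.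
- exact: n2.
- exact: n2.
- exact: n2.
- exact: n2.
apply: eq_integral => t _; rewrite -!EFinD; congr (_%:E).
have -> : lin a' t = c * lin a t - e * lin b t.
  by rewrite /lin !mulr_sumr -sumrB; apply: eq_bigr => j _; rewrite /a'; ring.
have -> : lin b' t = e * lin a t + c * lin b t.
  by rewrite /lin !mulr_sumr -big_split/=; apply: eq_bigr => j _; rewrite /b'; ring.
transitivity ((c ^+ 2 + e ^+ 2) * (lin b t ^+ 2 + lin a t ^+ 2)); first by ring.
by rewrite ce mul1r.
Qed.

Lemma lin_moment a k : (\int[P]_t (`|lin a t| ^+ k)%:E < +oo)%E.
Proof.
have [s [s0 h]] := lin_law a.
rewrite (h (fun y => `|y| ^+ k) (@continuous_normX R k)); last by move=> y; rewrite exprn_ge0.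
under eq_integral do rewrite normrM exprMn EFinM.
have me : measurable_fun setT (fun y : R => (`|y| ^+ k)%:E).
  by apply/measurable_EFinP; apply: continuous_measurable_fun; exact: continuous_normX.
have ne (y : R) : setT y -> (0 <= (`|y| ^+ k)%:E)%E by rewrite lee_fin exprn_ge0.
have /= -> := @ge0_integralZl _ _ _ gam setT measurableT _ me (`|s| ^+ k)%:E ne (exprn_ge0 _ (normr_ge0 _)).
have fin : (\int[gam]_y (`|y| ^+ k)%:E)%E \is a fin_num.
  by rewrite ge0_fin_numE ?gam_moment//; apply: integral_ge0 => y; exact: ne.
by rewrite -(fineK fin) -EFinM ltry.
Qed.

End linear_functionals.

(** The constant is the ratio E g^4 / (E g^2)^2 of the standard law. It is the same for all
    probability spaces and all families, because a centred Gaussian variable is in law a multiple of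
    g. *)
Lemma gaussian_fourth_moment (R : realType) : exists2 k4 : R, 0 <= k4 &
  forall d (T : measurableType d) (P : probability T R) (J : finType) (x : J -> T -> R),
  (forall a, gaussian_rv P (lin x a)) ->
  (forall a, (\int[P]_t (expR (lin x a t))%:E = \int[P]_t (expR (- lin x a t))%:E)%E) ->
  forall a v, (\int[P]_t (lin x a t ^+ 2)%:E = v%:E)%E ->
    (\int[P]_t (lin x a t ^+ 4)%:E <= (k4 * v ^+ 2)%:E)%E.
Proof.
have [v0 v00 hv0] := @gam_var R.
have m4 (y : R) : `|y| ^+ 4 = y ^+ 4 by rewrite -normrX ger0_norm ?exprn_even_ge0.
have n4 (y : R) : setT y -> (0 <= (y ^+ 4)%:E)%E by rewrite lee_fin exprn_even_ge0.
have fin : (\int[normal_prob (0:R) 1]_y (y ^+ 4)%:E)%E \is a fin_num.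
  rewrite ge0_fin_numE ?integral_ge0//.
  by have := @gam_moment R 4; under eq_integral do rewrite m4.
pose u := fine (\int[normal_prob (0:R) 1]_y (y ^+ 4)%:E)%E.
have u0 : 0 <= u by apply: fine_ge0; exact: integral_ge0.
exists (u / v0 ^+ 2); first by rewrite divr_ge0 ?sqr_ge0.
move=> d T P J x jg sym a v hv.
have [s hs] := lin_law jg sym a.
have := lin_var hs hv0; rewrite hv => -[->].
have [_ h] := hs.
rewrite (h (fun y => y ^+ 4) (@exprn_continuous R 4)); last by move=> y; rewrite exprn_even_ge0.
under eq_integral do rewrite exprMn EFinM.
have me : measurable_fun setT (fun y : R => (y ^+ 4)%:E).
  by apply/measurable_EFinP; exact: measurable_funX.
have s4 : (0 <= (s ^+ 4)%:E)%E by rewrite lee_fin exprn_even_ge0.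
have /= -> := @ge0_integralZl _ _ _ (normal_prob (0:R) 1) setT measurableT _ me (s ^+ 4)%:E n4 s4.
rewrite -(fineK fin) -/u -EFinM lee_fin le_eqVlt; apply/orP; left; apply/eqP; field.
by rewrite gt_eqF.
Qed.

(** * The canonical space of a finite family of real variables *)

Section boxspace.
Variables (R : realType) (J : finType).

Definition boxes : set (set (J -> R)) := [set A | exists b, A = [set x | boxed b x]].
(** The sigma-algebra is generated by boxes because they form a pi-system on which [box_unique]
    compares laws, while measurability into it is checked coordinate by coordinate. *)
Definition boxspace := g_sigma_algebraType boxes.

Lemma boxes_setT : boxes setT.
Proof. by exists (fun=> None); apply/seteqP; split=> x. Qed.

Lemma boxes_setI : setI_closed boxes.
Proof.
move=> _ _ [b ->] [b' ->].
exists (fun j => match b j, b' j with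
  | None, o => o | o, None => o | Some r, Some r' => Some (Num.max r r') end).
apply/seteqP; split=> x /= => [[h h'] j|h].
  have := h j; have := h' j; case: (b j) => [r|]; case: (b' j) => [r'|] //.
  by rewrite gt_max => -> ->.
split=> j; have := h j; case: (b j) => [r|]; case: (b' j) => [r'|] //.
  by rewrite gt_max => /andP[].
by rewrite gt_max => /andP[].
Qed.

Lemma measurable_coord j : measurable_fun setT (fun x : boxspace => x j).
Proof.
apply: (@measurability _ _ _ _ setT _ (@RGenOInfty.G R)).
  exact: RGenOInfty.measurableE.
move=> _ [_ [r ->] <-].
rewrite setTI; apply: sub_sigma_algebra.
exists (fun i => if i == j then Some r else None).
apply/seteqP; split=> x /=; rewrite ?in_itv/= ?andbT => h.
  by move=> i; case: eqP => // ->.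
by have := h j; rewrite eqxx.
Qed.

Lemma measurable_to_box d (T : measurableType d) (X : T -> boxspace) :
  (forall j, measurable_fun setT (fun t => X t j)) -> measurable_fun setT X.
Proof.
move=> mX; apply: (@measurability _ _ _ _ setT X (@boxes)); first by [].
move=> _ [_ [b ->] <-].
rewrite setTI.
have -> : X @^-1` [set x | boxed b x] =
    \bigcap_(j in [set: J]) [set t | if b j is Some r then r < X t j else true].
  apply/seteqP; split=> t.
    by move=> h j _; have := (h : boxed b (X t)) j; rewrite /=; case: (b j).
  by move=> h; suff : boxed b (X t) by []; move=> j; have := h j Logic.I; rewrite /=; case: (b j).
apply: fin_bigcap_measurable; first exact: finite_finset.
move=> j _; case: (b j) => [r|].
  rewrite (_ : [set _ | _] = setT `&` (fun t => X t j) @^-1` `]r, +oo[%classic).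
    by apply: mX.
  by rewrite setTI; apply/seteqP; split=> t /=; rewrite in_itv/= andbT.
by rewrite (_ : [set _ | _] = setT)//; apply/seteqP.
Qed.

End boxspace.

Lemma integral_invariant (R : realType) d d' (T : measurableType d) (T' : measurableType d')
   (mu : {measure set T -> \bar R}) (mu' : {measure set T' -> \bar R}) (phi : T -> T') (f : T' -> \bar R) :
  measurable_fun setT phi -> (forall A, measurable A -> mu (phi @^-1` A) = mu' A) ->
  measurable_fun setT f -> (\int[mu]_t f (phi t) = \int[mu']_t f t)%E.
Proof.
move=> mphi h mf.
have key g : measurable_fun setT g -> (forall t, (0 <= g t)%E) ->
    (\int[mu]_t g (phi t) = \int[mu']_t g t)%E.
  move=> mg g0.
  have := @ge0_integral_pushforward _ _ _ _ R _ mphi mu setT g measurableT mg (fun t _ => g0 t).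
  rewrite preimage_setT => E; rewrite -[LHS]/(\int[mu]_x (g \o phi) x)%E -E.
  apply: eq_measure_integral => A mA _; exact: h.
rewrite integralE [RHS]integralE; congr (_ - _)%E.
  rewrite -key//; last exact: measurable_funepos.
  by apply: eq_integral => x _; rewrite !funeposE.
rewrite -key//; last exact: measurable_funeneg.
by apply: eq_integral => x _; rewrite !funenegE.
Qed.

Lemma Rintegral_prob_cst (R : realType) d (T : measurableType d) (P : probability T R) (k : R) :
  \int[P]_t k = k.
Proof.
rewrite /Rintegral integral_cst// [X in (_ * X)%E](_ : _ = 1%E) ?mule1//.
exact: probability_setT.
Qed.

(** * Rotation invariance of a pair of independent copies *)

Section rotation.
Variables (R : realType) (J : finType) (nu : probability (boxspace R J) R).
Local Notation E := (boxspace R J).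
Local Notation coord := (fun (j : J) (x : E) => x j).
Hypothesis jg : forall a, gaussian_rv nu (lin coord a).
Hypothesis sym : forall a,
  (\int[nu]_t (expR (lin coord a t))%:E = \int[nu]_t (expR (- lin coord a t))%:E)%E.

Definition pair_rot (c e : R) (p : E * E) : E * E :=
  (fun j => c * p.1 j + e * p.2 j, fun j => - e * p.1 j + c * p.2 j).

Lemma measurable_coord1 j : measurable_fun setT (fun p : E * E => p.1 j).
Proof. by apply: (measurableT_comp (measurable_coord j)); exact: measurable_fst. Qed.
Lemma measurable_coord2 j : measurable_fun setT (fun p : E * E => p.2 j).
Proof. by apply: (measurableT_comp (measurable_coord j)); exact: measurable_snd. Qed.

Lemma measurable_rot c e : measurable_fun setT (pair_rot c e).
Proof.
have m (k l : R) j : measurable_fun setT (fun p : E * E => k * p.1 j + l * p.2 j).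
  by apply: measurable_funD; apply: measurable_funM => //;
    [exact: measurable_coord1|exact: measurable_coord2].
by apply: measurable_fun_pair; apply: measurable_to_box => j; exact: m.
Qed.

Lemma trig_rotation c e (g : R -> R) (a b : J -> R) : c ^+ 2 + e ^+ 2 = 1 ->
  continuous g -> (forall y, `|g y| <= 1) ->
  \int[(nu \x nu)%E]_p g (lin coord a (pair_rot c e p).1 + lin coord b (pair_rot c e p).2) =
  \int[(nu \x nu)%E]_p g (lin coord a p.1 + lin coord b p.2).
Proof.
move=> ce cg g1.
have ml a' := lin_measurable jg a'.
have ml1 a' b' : measurable_fun setT (fun p : E * E => lin coord a' p.1 + lin coord b' p.2).
  apply: measurable_funD.
    by apply: (measurableT_comp (ml a')); exact: measurable_fst.
  by apply: (measurableT_comp (ml b')); exact: measurable_snd.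
have mg a' b' : measurable_fun setT (fun p : E * E => g (lin coord a' p.1 + lin coord b' p.2)).
  by apply: (measurableT_comp (continuous_measurable_fun cg)); exact: ml1.
(* The rotation formula is stated for nonnegative functions, and 1 + g is one since |g| <= 1. *)
have cg1 : continuous (fun y => 1 + g y).
  by move=> y; apply: cvgD; [exact: cvg_cst|exact: cg].
have g10 y : 0 <= 1 + g y by have := g1 y; rewrite ler_norml => /andP[h _]; lra.
have key a' b' : \int[(nu \x nu)%E]_p g (lin coord a' p.1 + lin coord b' p.2) =
    fine (\int[nu]_y \int[nu]_x (1 + g (lin coord a' x + lin coord b' y))%:E)%E - 1.
  have -> : (\int[nu]_y \int[nu]_x (1 + g (lin coord a' x + lin coord b' y))%:E =
     \int[(nu \x nu)%E]_p (1 + g (lin coord a' p.1 + lin coord b' p.2))%:E)%E.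
    rewrite (@fubini_tonelli2 _ _ _ _ R nu nu
      (fun p => (1 + g (lin coord a' p.1 + lin coord b' p.2))%:E))//.
      by apply/measurable_EFinP; apply: measurable_funD.
    by move=> p; rewrite lee_fin.
  have c1 : \int[(nu \x nu)%E]_p (1 : R) = 1 := Rintegral_prob_cst (nu \x nu)%E 1.
  have i1 : (nu \x nu)%E.-integrable setT (EFin \o (fun _ : E * E => 1 : R)).
    by apply: (@bounded_integrable _ _ _ (nu \x nu)%E _ 1) => // p; rewrite normr1.
  have i2 := @bounded_integrable _ _ _ (nu \x nu)%E _ 1 (mg a' b') (fun p => g1 _).
  have D := RintegralD measurableT i1 i2.
  by rewrite -[fine _]/(\int[(nu \x nu)%E]_p (1 + g (lin coord a' p.1 + lin coord b' p.2))) D c1 addrC addKr.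
have E1 p : lin coord a (pair_rot c e p).1 + lin coord b (pair_rot c e p).2 =
    lin coord (fun j => c * a j - e * b j) p.1 + lin coord (fun j => e * a j + c * b j) p.2.
  rewrite /lin -!big_split/=; apply: eq_bigr => j _; ring.
under eq_Rintegral do rewrite E1.
apply: (etrans (key _ _)); apply: (etrans _ (esym (key _ _))).
apply: (congr1 (fun x => fine x - 1)).
exact: (lin_rotation jg sym a b ce cg1 g10).
Qed.

Lemma boxes_prod_generate : @measurable _ (E * E)%type `<=`
  <<s [set A `*` B | A in @boxes R J & B in @boxes R J] >>.
Proof.
set G := [set _ | _ in _ & _ in _].
pose GT := g_sigma_algebraType G.
have mf : @measurable_fun _ _ GT E setT fst.
  apply: (@measurability _ _ GT E setT _ (@boxes R J)); first by [].
  move=> _ [A bA <-]; rewrite setTI; apply: sub_sigma_algebra.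
  by exists A => //; exists setT; [exact: boxes_setT|apply/seteqP; split=> p // []].
have ms : @measurable_fun _ _ GT E setT snd.
  apply: (@measurability _ _ GT E setT _ (@boxes R J)); first by [].
  move=> _ [A bA <-]; rewrite setTI; apply: sub_sigma_algebra.
  by exists setT; [exact: boxes_setT|exists A => //; apply/seteqP; split=> p // []].
rewrite measurable_prod_measurableType; apply: smallest_sub.
  exact: smallest_sigma_algebra.
move=> _ [A1 mA1 [B1 mB1 <-]].
have := @measurableI _ GT _ _ (mf measurableT _ mA1) (ms measurableT _ mB1).
by rewrite !setTI; congr (_ _); apply/seteqP; split.
Qed.

(** A product of two boxes is a box indexed by [J + J], so [box_unique] reduces the claim to sines
    and cosines of linear forms of the pair; products of boxes are a generating pi-system. *)
Theorem rotation_invariance c e : c ^+ 2 + e ^+ 2 = 1 -> forall A, measurable A ->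
  (nu \x nu)%E (pair_rot c e @^-1` A) = (nu \x nu)%E A.
Proof.
move=> ce A mA.
pose G : set (set (E * E)%type) := [set A `*` B | A in @boxes R J & B in @boxes R J].
pose m0 (m : measurable_fun setT (pair_rot c e)) : {measure set (E * E)%type -> \bar R} :=
  measure_function_pushforward__canonical__measure_function_Measure (nu \x nu)%E m.
pose m1 := m0 (measurable_rot c e).
have Gm : G `<=` @measurable _ (E * E)%type.
  by move=> _ [A1 bA1 [B1 bB1 <-]]; apply: measurableX; exact: sub_sigma_algebra.
have GT (i : nat) : G ((fun=> setT) i).
  by exists setT; [exact: boxes_setT|exists setT; [exact: boxes_setT|rewrite setXTT]].
have GI : setI_closed G.
  move=> _ _ [A1 bA1 [B1 bB1 <-]] [A2 bA2 [B2 bB2 <-]].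
  exists (A1 `&` A2); first exact: boxes_setI.
  by exists (B1 `&` B2); [exact: boxes_setI|rewrite setXI].
have cover : \bigcup_(k : nat) (fun=> [set: E * E]) k = setT.
  by apply/seteqP; split=> // p _; exists 0%N.
have fin (k : nat) : (m1 ((fun=> setT) k) < +oo)%E.
  by rewrite (_ : m1 _ = (nu \x nu)%E setT)// (le_lt_trans (probability_le1 _ _))// ltry.
suff eqG B : G B -> m1 B = (nu \x nu)%E B.
  exact: (@g_sigma_algebra_measure_unique _ R _ G Gm (fun=> setT) GT cover m1 (nu \x nu)%E
    GI eqG fin A (boxes_prod_generate mA)).
move=> [_ [b ->] [_ [b' ->] <-]].
pose U (k : J + J) (p : E * E) := match k with inl j => p.1 j | inr j => p.2 j end.
pose B0 (k : J + J) := match k with inl j => b j | inr j => b' j end.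
have BE p : ([set x | boxed b x] `*` [set x | boxed b' x]) p = boxed B0 (fun k => U k p).
  apply/propext; split=> [[/= h1 h2] [j|j]|h]; [exact: h1|exact: h2|].
  by split=> j; [exact: (h (inl j))|exact: (h (inr j))].
have mU k : measurable_fun setT (U k).
  by case: k => j; [exact: measurable_coord1|exact: measurable_coord2].
have lE (a : J + J -> R) p : \sum_k a k * U k p =
    lin coord (a \o inl) p.1 + lin coord (a \o inr) p.2.
  by rewrite big_sumType.
transitivity ((nu \x nu)%E [set p | boxed B0 (fun k => U k (pair_rot c e p))]).
  transitivity ((nu \x nu)%E (pair_rot c e @^-1` ([set x | boxed b x] `*` [set x | boxed b' x]))).
    by [].
  by congr ((nu \x nu)%E _); apply/funext => p; exact: (BE (pair_rot c e p)).
rewrite (@box_unique R _ _ _ (nu \x nu)%E (fun k p => U k (pair_rot c e p)) U)//.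
+ by congr ((nu \x nu)%E _); apply/funext => p; symmetry; exact: BE.
+ by move=> k; exact: (measurableT_comp (mU k) (measurable_rot c e)).
+ move=> a; under eq_Rintegral do rewrite lE; under [RHS]eq_Rintegral do rewrite lE.
  apply: trig_rotation => //; first exact: continuous_cos.
  by move=> y; rewrite ler_norml cos_geN1 cos_le1.
+ move=> a; under eq_Rintegral do rewrite lE; under [RHS]eq_Rintegral do rewrite lE.
  apply: trig_rotation => //; first exact: continuous_sin.
  by move=> y; rewrite ler_norml sin_geN1 sin_le1.
Qed.

End rotation.

(** * Random variables with finite moments *)

Section moments.
Context (R : realType) d (T : measurableType d) (mu : probability T R).
Local Notation C := R[i].
Notation Re := (@complex.Re R).
Notation Im := (@complex.Im R).
Implicit Types (f g h : T -> R) (F G : T -> C).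

(** All even moments are finite. The class is stable under sums and products, so every polynomial
    expression below is integrable without a separate estimate. *)
Definition rmom h := measurable_fun setT h /\
  forall k, (\int[mu]_t ((h t ^+ 2) ^+ k)%:E < +oo)%E.

Lemma measurable_powers h k : measurable_fun setT h ->
  measurable_fun setT (fun t => ((h t ^+ 2) ^+ k)%:E).
Proof.
move=> mh; apply/measurable_EFinP.
by apply: measurable_funX; apply: measurable_funX.
Qed.

Lemma powers_ge0 h k t : (0%:E <= ((h t ^+ 2) ^+ k)%:E)%E.
Proof. by rewrite lee_fin exprn_ge0// sqr_ge0. Qed.

Lemma le_int (f_ g_ : T -> \bar R) : measurable_fun setT f_ -> measurable_fun setT g_ ->
  (forall t, 0 <= f_ t)%E -> (forall t, f_ t <= g_ t)%E ->
  (\int[mu]_t f_ t <= \int[mu]_t g_ t)%E.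
Proof. by move=> mf mg f0 fg; apply: ge0_le_integral => // t _; exact: f0. Qed.

Lemma int_cst (k : R) : (\int[mu]_t k%:E = k%:E)%E.
Proof.
rewrite integral_cst// [X in (_ * X)%E](_ : _ = 1%E) ?mule1//.
exact: probability_setT.
Qed.

Lemma rmom_bounded h K : measurable_fun setT h -> (forall t, `|h t| <= K) -> rmom h.
Proof.
move=> mh hK; split=> // k.
apply: (@le_lt_trans _ _ (\int[mu]_t ((K ^+ 2) ^+ k)%:E)%E).
  apply: le_int; [exact: measurable_powers|exact: measurable_cst|by move=> t; exact: powers_ge0|].
  move=> t; rewrite lee_fin; apply: lerXn2r; rewrite ?nnegrE ?sqr_ge0//.
  by rewrite -real_normK ?num_real// lerXn2r ?nnegrE// (le_trans _ (hK t)).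
by rewrite int_cst ltry.
Qed.

Lemma rmom_cst (k : R) : rmom (fun=> k).
Proof. by apply: (@rmom_bounded _ `|k|). Qed.

Lemma rmom_dom h (f g : T -> R) (K : nat -> R) : measurable_fun setT h ->
  rmom f -> rmom g -> (forall k, 0 <= K k) -> (forall k t, (h t ^+ 2) ^+ k <=
    K k * ((f t ^+ 2) ^+ (k.*2) + (g t ^+ 2) ^+ (k.*2) + 1)) -> rmom h.
Proof.
move=> mh [mf hf] [mg hg] K0 hK; split=> // k.
have m1 := measurable_powers k.*2 mf; have m2 := measurable_powers k.*2 mg.
apply: (@le_lt_trans _ _ (\int[mu]_t ((K k)%:E * (((f t ^+ 2) ^+ (k.*2))%:E +
   ((g t ^+ 2) ^+ (k.*2))%:E + 1%:E)))%E).
  apply: le_int.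
  - exact: measurable_powers.
  - by apply: emeasurable_funM => //; apply: emeasurable_funD => //; apply: emeasurable_funD.
  - by move=> t; exact: powers_ge0.
  - by move=> t; rewrite -!EFinD -EFinM lee_fin.
have mS : measurable_fun setT (fun t => ((f t ^+ 2) ^+ (k.*2))%:E + ((g t ^+ 2) ^+ (k.*2))%:E + 1%:E)%E.
  by apply: emeasurable_funD => //; apply: emeasurable_funD.
have n0 t : setT t -> (0 <= ((f t ^+ 2) ^+ (k.*2))%:E + ((g t ^+ 2) ^+ (k.*2))%:E + 1%:E)%E.
  by move=> _; rewrite !adde_ge0 ?powers_ge0.
have /= -> := @ge0_integralZl _ _ _ mu setT measurableT _ mS (K k)%:E n0 (K0 k).
rewrite lte_mul_pinfty ?lee_fin//.
rewrite ge0_integralD//; last first.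
- exact: emeasurable_funD.
- by move=> t _; rewrite adde_ge0 ?powers_ge0.
rewrite ge0_integralD//; [|by move=> t _; exact: powers_ge0..].
apply: lte_add_pinfty; last by rewrite int_cst ltry.
by apply: lte_add_pinfty; [exact: hf|exact: hg].
Qed.

Lemma rmomM f g : rmom f -> rmom g -> rmom (fun t => f t * g t).
Proof.
move=> hf hg; apply: (@rmom_dom _ f g (fun=> 1)) => //.
  by apply: measurable_funM; [exact: hf.1|exact: hg.1].
move=> k t; rewrite mul1r.
have -> : ((f t * g t) ^+ 2) ^+ k = (f t ^+ 2) ^+ k * (g t ^+ 2) ^+ k by rewrite [X in X ^+ k = _]exprMn [LHS]exprMn.
rewrite -addnn !exprD.
have := sqr_ge0 ((f t ^+ 2) ^+ k - (g t ^+ 2) ^+ k).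
have : 0 <= (f t ^+ 2) ^+ k by rewrite exprn_ge0// sqr_ge0.
have : 0 <= (g t ^+ 2) ^+ k by rewrite exprn_ge0// sqr_ge0.
by move: ((f t ^+ 2) ^+ k) ((g t ^+ 2) ^+ k) => a b a0 b0; nra.
Qed.

Lemma rmomD f g : rmom f -> rmom g -> rmom (fun t => f t + g t).
Proof.
move=> hf hg; apply: (@rmom_dom _ f g (fun k => 4 ^+ k)) => //.
- by apply: measurable_funD; [exact: hf.1|exact: hg.1].
- move=> k t; rewrite -addnn !exprD.
set a := f t ^+ 2; set b := g t ^+ 2.
have a0 : 0 <= a by exact: sqr_ge0.
have b0 : 0 <= b by exact: sqr_ge0.
apply: (@le_trans _ _ (4 ^+ k * (a ^+ k + b ^+ k))).
  have le1 : (f t + g t) ^+ 2 <= 4 * Num.max a b.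
    have : (f t + g t) ^+ 2 <= 2 * a + 2 * b by rewrite /a /b; have := sqr_ge0 (f t - g t); nra.
    by rewrite /Num.max; case: ltP; lra.
  apply: (@le_trans _ _ ((4 * Num.max a b) ^+ k)).
    by apply: lerXn2r; rewrite ?nnegrE ?sqr_ge0// (le_trans _ le1)// sqr_ge0.
  rewrite exprMn ler_wpM2l ?exprn_ge0//.
  by rewrite /Num.max; case: ltP => _; rewrite ?lerDl ?lerDr exprn_ge0.
rewrite ler_wpM2l ?exprn_ge0//.
have : 0 <= a ^+ k by exact: exprn_ge0.
have : 0 <= b ^+ k by exact: exprn_ge0.
by move: (a ^+ k) (b ^+ k) => x y x0 y0; have := sqr_ge0 (x - 1 / 2); have := sqr_ge0 (y - 1 / 2); nra.
Qed.

Lemma rmomN f : rmom f -> rmom (fun t => - f t).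
Proof.
move=> hf; have := rmomM (rmom_cst (-1)) hf; congr rmom.
by apply/funext => t; rewrite mulN1r.
Qed.

Lemma rmomB f g : rmom f -> rmom g -> rmom (fun t => f t - g t).
Proof. by move=> hf hg; apply: rmomD => //; exact: rmomN. Qed.

Lemma rmom_sum (I : Type) (r : seq I) (P : pred I) (f_ : I -> T -> R) :
  (forall i, rmom (f_ i)) -> rmom (fun t => \sum_(i <- r | P i) f_ i t).
Proof.
move=> h; elim: r => [|i r ih].
  by under eq_fun do rewrite big_nil; exact: rmom_cst.
under eq_fun do rewrite big_cons; by case: (P i) => //; exact: rmomD.
Qed.

Lemma rmomX f k : rmom f -> rmom (fun t => f t ^+ k).
Proof.
move=> hf; elim: k => [|k ih]; first by under eq_fun do rewrite expr0; exact: rmom_cst.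
by under eq_fun do rewrite exprS; exact: rmomM.
Qed.

Lemma rmom_integrable f : rmom f -> mu.-integrable setT (EFin \o f).
Proof.
move=> [mf hf]; apply/integrableP; split; first exact/measurable_EFinP.
apply: (@le_lt_trans _ _ (\int[mu]_t (((f t ^+ 2) ^+ 1)%:E + 1%:E))%E).
  apply: le_int.
  - by apply: measurableT_comp => //; exact/measurable_EFinP.
  - by apply: emeasurable_funD => //; exact: measurable_powers.
  - by move=> t; exact: abse_ge0.
  - move=> t; rewrite -EFinD lee_fin expr1 -real_normK ?num_real//.
    by have := sqr_ge0 (`|f t| - 1 / 2); nra.
rewrite ge0_integralD//; last 2 first.
- by move=> t _; exact: powers_ge0.
- exact: measurable_powers.
apply: lte_add_pinfty; last by rewrite int_cst ltry.
by have := hf 1%N.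
Qed.

Definition Er f : R := \int[mu]_t f t.

Lemma ErD f g : rmom f -> rmom g -> Er (fun t => f t + g t) = Er f + Er g.
Proof. by move=> hf hg; rewrite /Er RintegralD//; exact: rmom_integrable. Qed.
Lemma ErZ k f : rmom f -> Er (fun t => k * f t) = k * Er f.
Proof. by move=> hf; rewrite /Er RintegralZl//; exact: rmom_integrable. Qed.
Lemma Er_cst k : Er (fun=> k) = k.
Proof. exact: Rintegral_prob_cst. Qed.
Lemma ErN f : rmom f -> Er (fun t => - f t) = - Er f.
Proof. by move=> hf; rewrite -mulN1r -ErZ//; congr Er; apply/funext => t; rewrite mulN1r. Qed.
Lemma ErB f g : rmom f -> rmom g -> Er (fun t => f t - g t) = Er f - Er g.
Proof. by move=> hf hg; rewrite ErD ?ErN//; exact: rmomN. Qed.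
Lemma Er_ge0 f : (forall t, 0 <= f t) -> 0 <= Er f.
Proof. by move=> h; apply: Rintegral_ge0. Qed.
Lemma Er_le f g : rmom f -> rmom g -> (forall t, f t <= g t) -> Er f <= Er g.
Proof. by move=> hf hg h; apply: le_Rintegral => //; exact: rmom_integrable. Qed.
Lemma Er_sum (I : Type) (r : seq I) (P : pred I) (f_ : I -> T -> R) :
  (forall i, rmom (f_ i)) ->
  Er (fun t => \sum_(i <- r | P i) f_ i t) = \sum_(i <- r | P i) Er (f_ i).
Proof.
move=> h; elim: r => [|i r ih].
  by rewrite big_nil -[RHS]Er_cst; congr Er; apply/funext => t; rewrite big_nil.
rewrite big_cons -ih; case: ifP => hP; last first.
  by congr Er; apply/funext => t; rewrite big_cons hP.
rewrite -ErD//; last exact: rmom_sum.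
by congr Er; apply/funext => t; rewrite big_cons hP.
Qed.
Lemma eq_Er f g : f =1 g -> Er f = Er g.
Proof. by move=> /funext ->. Qed.
Lemma Er_sqr f : rmom f -> Er f ^+ 2 <= Er (fun t => f t ^+ 2).
Proof.
move=> hf; have h0 : 0 <= Er (fun t => (f t - Er f) ^+ 2) by apply: Er_ge0 => t; exact: sqr_ge0.
have E : Er (fun t => (f t - Er f) ^+ 2) = Er (fun t => f t ^+ 2) - Er f ^+ 2.
  rewrite (eq_Er (g := fun t => f t ^+ 2 + ((- 2 * Er f) * f t + Er f ^+ 2))); last by move=> t; ring.
  rewrite ErD; [|exact: rmomX|by apply: rmomD; [apply: rmomM => //; exact: rmom_cst|exact: rmom_cst]].
  rewrite ErD; [|by apply: rmomM => //; exact: rmom_cst|exact: rmom_cst].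
  by rewrite ErZ// Er_cst; ring.
by rewrite E subr_ge0 in h0.
Qed.
Lemma Er_EFin f : rmom f -> (Er f)%:E = (\int[mu]_t (f t)%:E)%E.
Proof. by move=> hf; rewrite /Er /Rintegral fineK//; apply: integrable_fin_num => //; exact: rmom_integrable. Qed.

Definition mom F := rmom (Re \o F) /\ rmom (Im \o F).
Definition Ec F : C := Er (Re \o F) +i* Er (Im \o F).

Lemma mom_cst c : mom (fun=> c). Proof. by split; exact: rmom_cst. Qed.
Lemma eq_mom F G : F =1 G -> mom F -> mom G. Proof. by move=> /funext ->. Qed.
Lemma momM F G : mom F -> mom G -> mom (fun t => F t * G t).
Proof.
move=> [F1 F2] [G1 G2]; split.
  by rewrite (_ : _ \o _ = fun t => Re (F t) * Re (G t) - Im (F t) * Im (G t));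
    [apply: rmomB; exact: rmomM|apply/funext => t /=; rewrite Re_mul].
by rewrite (_ : _ \o _ = fun t => Re (F t) * Im (G t) + Im (F t) * Re (G t));
    [apply: rmomD; exact: rmomM|apply/funext => t /=; rewrite Im_mul].
Qed.
Lemma momD F G : mom F -> mom G -> mom (fun t => F t + G t).
Proof.
move=> [F1 F2] [G1 G2]; split.
  by rewrite (_ : _ \o _ = fun t => Re (F t) + Re (G t));
    [exact: rmomD|apply/funext => t /=; rewrite ReD].
by rewrite (_ : _ \o _ = fun t => Im (F t) + Im (G t));
    [exact: rmomD|apply/funext => t /=; rewrite ImD].
Qed.
Lemma momN F : mom F -> mom (fun t => - F t).
Proof. by move=> h; apply: eq_mom (momM (mom_cst (-1)) h) => t; rewrite mulN1r. Qed.
Lemma momB F G : mom F -> mom G -> mom (fun t => F t - G t).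
Proof. by move=> hF hG; apply: momD => //; exact: momN. Qed.
Lemma momJ F : mom F -> mom (fun t => Num.conj (F t)).
Proof.
move=> [F1 F2]; split.
  by rewrite (_ : _ \o _ = Re \o F)//; apply/funext => t /=; rewrite ReJ.
rewrite (_ : _ \o _ = fun t => - Im (F t)); first exact: rmomN.
by apply/funext => t /=; rewrite ImJ.
Qed.
Lemma mom_sum (I : Type) (r : seq I) (P : pred I) (F_ : I -> T -> C) :
  (forall i, mom (F_ i)) -> mom (fun t => \sum_(i <- r | P i) F_ i t).
Proof.
move=> h; elim: r => [|i r ih].
  by under eq_fun do rewrite big_nil; exact: mom_cst.
under eq_fun do rewrite big_cons; by case: (P i) => //; exact: momD.
Qed.
Lemma rmom_n2 F : mom F -> rmom (fun t => n2 (F t)).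
Proof. by move=> [F1 F2]; apply: rmomD; exact: rmomX. Qed.
Lemma mom_realC f : rmom f -> mom (fun t => (f t)%:C).
Proof. by move=> h; split=> //; exact: rmom_cst. Qed.

Lemma EcD F G : mom F -> mom G -> Ec (fun t => F t + G t) = Ec F + Ec G.
Proof.
move=> [F1 F2] [G1 G2]; apply: complexP => /=.
  by rewrite -ErD//; apply: eq_Er => t /=; rewrite ReD.
by rewrite -ErD//; apply: eq_Er => t /=; rewrite ImD.
Qed.
Lemma EcZ c F : mom F -> Ec (fun t => c * F t) = c * Ec F.
Proof.
move=> [F1 F2]; have m k f : rmom f -> rmom (fun t => k * f t).
  by move=> ?; apply: rmomM => //; exact: rmom_cst.
apply: complexP; rewrite ?Re_mul ?Im_mul /=.
  rewrite -(ErZ (Re c) F1) -(ErZ (Im c) F2) -ErB; [|exact: (m _ _ F1)|exact: (m _ _ F2)].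
  by apply: eq_Er => t /=; rewrite Re_mul.
rewrite -(ErZ (Re c) F2) -(ErZ (Im c) F1) -ErD; [|exact: (m _ _ F2)|exact: (m _ _ F1)].
by apply: eq_Er => t /=; rewrite Im_mul.
Qed.
Lemma eq_Ec F G : F =1 G -> Ec F = Ec G. Proof. by move=> /funext ->. Qed.
Lemma EcN F : mom F -> Ec (fun t => - F t) = - Ec F.
Proof. by move=> h; rewrite -mulN1r -EcZ//; apply: eq_Ec => t; rewrite mulN1r. Qed.
Lemma EcB F G : mom F -> mom G -> Ec (fun t => F t - G t) = Ec F - Ec G.
Proof. by move=> hF hG; rewrite EcD ?EcN//; exact: momN. Qed.
Lemma EcZr c F : mom F -> Ec (fun t => F t * c) = Ec F * c.
Proof. by move=> h; rewrite mulrC -EcZ//; apply: eq_Ec => t; rewrite mulrC. Qed.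
Lemma Ec_cst c : Ec (fun=> c) = c.
Proof. by case: c => a b; apply: complexP => /=; rewrite Er_cst. Qed.
Lemma Ec_sum (I : Type) (r : seq I) (P : pred I) (F_ : I -> T -> C) :
  (forall i, mom (F_ i)) ->
  Ec (fun t => \sum_(i <- r | P i) F_ i t) = \sum_(i <- r | P i) Ec (F_ i).
Proof.
move=> h; elim: r => [|i r ih].
  by rewrite big_nil -[RHS](Ec_cst 0); apply: eq_Ec => t; rewrite big_nil.
rewrite big_cons -ih; case: ifP => hP; last first.
  by apply: eq_Ec => t; rewrite big_cons hP.
rewrite -EcD//; last exact: mom_sum.
by apply: eq_Ec => t; rewrite big_cons hP.
Qed.
Lemma Ec_realC f : Ec (fun t => (f t)%:C) = (Er f)%:C.
Proof. by apply: complexP => //=; exact: Er_cst. Qed.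

(** The quadratic E |F - tau c G^*|^2 in the real variable tau is nonnegative; it is evaluated at
    tau = 1 / b. *)
Lemma Ec_CS F G : mom F -> mom G ->
  n2 (Ec (fun t => F t * G t)) <= Er (fun t => n2 (F t)) * Er (fun t => n2 (G t)).
Proof.
move=> hF hG; set c := Ec _; set a := Er _; set b := Er _.
have hFG := momM hF hG.
have key (tau : R) : 0 <= a - 2 * tau * n2 c + tau ^+ 2 * n2 c * b.
  have -> : a - 2 * tau * n2 c + tau ^+ 2 * n2 c * b =
      Er (fun t => n2 (F t - tau%:C * c * Num.conj (G t))).
    rewrite (eq_Er (g := fun t => n2 (F t) + ((- 2 * tau) * Re (Num.conj c * (F t * G t)) +
      (tau ^+ 2 * n2 c) * n2 (G t)))); last first.
      move=> t; case: (F t) => f1 f2; case: (G t) => g1 g2; case: (c) => c1 c2.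
      by rewrite /n2/=; ring.
    have m1 : rmom (fun t => Re (Num.conj c * (F t * G t))).
      by have [] := momM (mom_cst (Num.conj c)) hFG.
    have m2 k f : rmom f -> rmom (fun t => k * f t).
      by move=> ?; apply: rmomM => //; exact: rmom_cst.
    have mF := rmom_n2 hF; have mG := rmom_n2 hG.
    rewrite (ErD mF); last by apply: rmomD; apply: m2.
    rewrite (ErD (m2 _ _ m1) (m2 _ _ mG)).
    rewrite (ErZ _ m1) (ErZ _ mG) -/a -/b.
    have -> : Er (fun t => Re (Num.conj c * (F t * G t))) = n2 c.
      have -> : Er (fun t => Re (Num.conj c * (F t * G t))) = Re (Ec (fun t => Num.conj c * (F t * G t))) by [].
      by rewrite EcZ// -/c mulrC mulCJ.
    ring.
  by apply: Er_ge0 => t; exact: n2_ge0.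
have a0 : 0 <= a by apply: Er_ge0 => t; exact: n2_ge0.
have b0 : 0 <= b by apply: Er_ge0 => t; exact: n2_ge0.
have c0 := n2_ge0 c.
(* If b = 0 the quadratic is affine in tau with slope -2 |c|^2, and a large tau makes it negative
   unless c = 0. *)
have [b1|b1] := eqVneq b 0.
  rewrite b1 mulr0 leNgt; apply/negP => cp.
  have := key ((a + 1) / n2 c).
  rewrite b1 mulr0 addr0 -mulrA divfK ?gt_eqF//; lra.
have bp : 0 < b by rewrite lt0r b1.
have := key b^-1.
have -> : b^-1 ^+ 2 * n2 c * b = n2 c / b by field.
by rewrite -ler_pdivrMr// -mulrA [b^-1 * _]mulrC; lra.
Qed.

Lemma Ec_n2 F : mom F -> n2 (Ec F) <= Er (fun t => n2 (F t)).
Proof.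
move=> hF; have := Ec_CS hF (mom_cst 1).
rewrite (eq_Ec (G := F)); last by move=> t; rewrite mulr1.
by rewrite (eq_Er (f := fun=> n2 1) (g := fun=> 1)) ?Er_cst ?mulr1// => t; rewrite n21.
Qed.

(** The factor 2 comes from bounding the real and imaginary parts separately. *)
Lemma Ec_norm_le F (h : T -> R) : mom F -> rmom h -> (forall t, normc (F t) <= h t) ->
  normc (Ec F) <= 2 * Er h.
Proof.
move=> [F1 F2] hh hF.
have h0 t : 0 <= h t by rewrite (le_trans _ (hF t))// normc_ge0'.
have E0 : 0 <= Er h by exact: Er_ge0.
have key f : rmom f -> (forall t, `|f t| <= h t) -> Er f ^+ 2 <= Er h ^+ 2.
  move=> hf fh; rewrite -real_normK ?num_real// lerXn2r ?nnegrE ?normr_ge0//.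
  have fh1 t : f t <= h t by have := fh t; rewrite ler_norml => /andP[].
  have fh2 t : - h t <= f t by have := fh t; rewrite ler_norml => /andP[].
  by rewrite ler_norml -ErN// (Er_le (rmomN hh) hf fh2) (Er_le hf hh fh1).
have sq (x : R) (z : C) : x ^+ 2 <= n2 z -> `|x| <= normc z.
  move=> xz; rewrite -(@ler_pXn2r _ 2)// ?nnegrE ?normr_ge0 ?normc_ge0'//.
  by rewrite real_normK ?num_real// -n2E.
apply: normc_le_sqr; first by rewrite mulr_ge0.
have k1 := key _ F1 (fun t => le_trans (sq _ _ (Re_le _)) (hF t)).
have k2 := key _ F2 (fun t => le_trans (sq _ _ (Im_le _)) (hF t)).
rewrite /n2 /Ec/= exprMn; have := sqr_ge0 (Er h); lra.
Qed.

Definition mommx m n (F : T -> 'M[C]_(m, n)) := forall i j, mom (fun t => F t i j).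
Definition Emx m n (F : T -> 'M[C]_(m, n)) : 'M[C]_(m, n) := \matrix_(i, j) Ec (fun t => F t i j).

Lemma mommx_cst m n (A : 'M[C]_(m, n)) : mommx (fun=> A).
Proof. by move=> i j; exact: mom_cst. Qed.
Lemma mommxM m n p (F : T -> 'M[C]_(m, n)) (G : T -> 'M[C]_(n, p)) :
  mommx F -> mommx G -> mommx (fun t => F t *m G t).
Proof.
move=> hF hG i j; apply: (eq_mom (F := fun t => \sum_k F t i k * G t k j)).
  by move=> t; rewrite mxE.
by apply: mom_sum => k; exact: momM.
Qed.
Lemma mommxD m n (F G : T -> 'M[C]_(m, n)) : mommx F -> mommx G -> mommx (fun t => F t + G t).
Proof. by move=> hF hG i j; apply: eq_mom (momD (hF i j) (hG i j)) => t; rewrite mxE. Qed.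
Lemma mommxN m n (F : T -> 'M[C]_(m, n)) : mommx F -> mommx (fun t => - F t).
Proof. by move=> hF i j; apply: eq_mom (momN (hF i j)) => t; rewrite mxE. Qed.
Lemma mommxB m n (F G : T -> 'M[C]_(m, n)) : mommx F -> mommx G -> mommx (fun t => F t - G t).
Proof. by move=> hF hG; apply: mommxD => //; exact: mommxN. Qed.
Lemma mommxZ m n (a : T -> C) (F : T -> 'M[C]_(m, n)) : mom a -> mommx F -> mommx (fun t => a t *: F t).
Proof. by move=> ha hF i j; apply: eq_mom (momM ha (hF i j)) => t; rewrite mxE. Qed.
Lemma mommx_adj m n (F : T -> 'M[C]_(m, n)) : mommx F -> mommx (fun t => (F t)^H).
Proof. by move=> hF i j; apply: eq_mom (momJ (hF j i)) => t; rewrite adjE. Qed.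
Lemma mom_tr n (F : T -> 'M[C]_n) : mommx F -> mom (fun t => \tr (F t)).
Proof. by move=> hF; apply: mom_sum => i; exact: hF. Qed.
Lemma rmom_fro2 m n (F : T -> 'M[C]_(m, n)) : mommx F -> rmom (fun t => fro2 (F t)).
Proof. by move=> hF; do 2 apply: rmom_sum => ?; apply: rmom_n2; exact: hF. Qed.
Lemma mom_entry m n (F : T -> 'M[C]_(m, n)) i j : mommx F -> mom (fun t => F t i j).
Proof. by apply. Qed.

Lemma eq_Emx m n (F G : T -> 'M[C]_(m, n)) : F =1 G -> Emx F = Emx G.
Proof. by move=> /funext ->. Qed.
Lemma EmxD m n (F G : T -> 'M[C]_(m, n)) : mommx F -> mommx G ->
  Emx (fun t => F t + G t) = Emx F + Emx G.
Proof.
move=> hF hG; apply/matrixP => i j; rewrite !mxE -EcD//.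
by apply: eq_Ec => t; rewrite mxE.
Qed.
Lemma EmxB m n (F G : T -> 'M[C]_(m, n)) : mommx F -> mommx G ->
  Emx (fun t => F t - G t) = Emx F - Emx G.
Proof.
move=> hF hG; apply/matrixP => i j; rewrite !mxE -EcB//.
by apply: eq_Ec => t; rewrite !mxE.
Qed.
Lemma EmxMl m n p (A : 'M[C]_(m, n)) (F : T -> 'M[C]_(n, p)) : mommx F ->
  Emx (fun t => A *m F t) = A *m Emx F.
Proof.
move=> hF; apply/matrixP => i j; rewrite !mxE.
rewrite (eq_Ec (G := fun t => \sum_k A i k * F t k j)); last by move=> t; rewrite mxE.
rewrite Ec_sum; last by move=> k; apply: momM => //; exact: mom_cst.
by apply: eq_bigr => k _; rewrite mxE EcZ.
Qed.
Lemma EmxMr m n p (A : 'M[C]_(n, p)) (F : T -> 'M[C]_(m, n)) : mommx F ->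
  Emx (fun t => F t *m A) = Emx F *m A.
Proof.
move=> hF; apply/matrixP => i j; rewrite !mxE.
rewrite (eq_Ec (G := fun t => \sum_k F t i k * A k j)); last by move=> t; rewrite mxE.
rewrite Ec_sum; last by move=> k; apply: momM => //; exact: mom_cst.
by apply: eq_bigr => k _; rewrite mxE EcZr.
Qed.
Lemma Emx_cst m n (A : 'M[C]_(m, n)) : Emx (fun=> A) = A.
Proof. by apply/matrixP => i j; rewrite mxE Ec_cst. Qed.
Lemma Ec_tr n (F : T -> 'M[C]_n) : mommx F -> Ec (fun t => \tr (F t)) = \tr (Emx F).
Proof.
move=> hF; rewrite /mxtrace Ec_sum; last by move=> i; exact: hF.
by apply: eq_bigr => i _; rewrite mxE.
Qed.

Definition cmeas F := measurable_fun setT (Re \o F) /\ measurable_fun setT (Im \o F).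

Lemma cmeas_bounded F K : cmeas F -> (forall t, normc (F t) <= K) -> mom F.
Proof.
move=> [m1 m2] hK.
have sq (x : R) (z : C) : x ^+ 2 <= n2 z -> `|x| <= normc z.
  move=> xz; rewrite -(@ler_pXn2r _ 2)// ?nnegrE ?normr_ge0 ?normc_ge0'//.
  by rewrite real_normK ?num_real// -n2E.
split.
  by apply: (rmom_bounded m1 (K := K)) => t; rewrite (le_trans _ (hK t))// sq// Re_le.
by apply: (rmom_bounded m2 (K := K)) => t; rewrite (le_trans _ (hK t))// sq// Im_le.
Qed.
Lemma cmeas_cst c : cmeas (fun=> c). Proof. by split; exact: measurable_cst. Qed.
Lemma cmeasM F G : cmeas F -> cmeas G -> cmeas (fun t => F t * G t).
Proof.
move=> [F1 F2] [G1 G2]; split.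
  rewrite (_ : _ \o _ = fun t => Re (F t) * Re (G t) - Im (F t) * Im (G t)).
    by apply: measurable_funB; exact: measurable_funM.
  by apply/funext => t /=; rewrite Re_mul.
rewrite (_ : _ \o _ = fun t => Re (F t) * Im (G t) + Im (F t) * Re (G t)).
  by apply: measurable_funD; exact: measurable_funM.
by apply/funext => t /=; rewrite Im_mul.
Qed.
Lemma cmeasD F G : cmeas F -> cmeas G -> cmeas (fun t => F t + G t).
Proof.
move=> [F1 F2] [G1 G2]; split.
  rewrite (_ : _ \o _ = fun t => Re (F t) + Re (G t)); first exact: measurable_funD.
  by apply/funext => t /=; rewrite ReD.
rewrite (_ : _ \o _ = fun t => Im (F t) + Im (G t)); first exact: measurable_funD.
by apply/funext => t /=; rewrite ImD.
Qed.
Lemma cmeas_sum (I : Type) (r : seq I) (F_ : I -> T -> C) :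
  (forall i, cmeas (F_ i)) -> cmeas (fun t => \sum_(i <- r) F_ i t).
Proof.
move=> h; elim: r => [|i r ih].
  by under eq_fun do rewrite big_nil; exact: cmeas_cst.
by under eq_fun do rewrite big_cons; exact: cmeasD.
Qed.
Lemma cmeas_prod (I : Type) (r : seq I) (F_ : I -> T -> C) :
  (forall i, cmeas (F_ i)) -> cmeas (fun t => \prod_(i <- r) F_ i t).
Proof.
move=> h; elim: r => [|i r ih].
  by under eq_fun do rewrite big_nil; exact: cmeas_cst.
by under eq_fun do rewrite big_cons; exact: cmeasM.
Qed.
Lemma cmeas_inv F : cmeas F -> (forall t, F t != 0) -> cmeas (fun t => (F t)^-1).
Proof.
move=> [F1 F2] F0.
have n0 t : 0 < n2 (F t).
  rewrite lt0r n2_ge0 andbT; apply/eqP => /n2_eq0 e; by have := F0 t; rewrite e eqxx.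
have mi : measurable_fun setT (fun t => (n2 (F t))^-1).
  (* The inverse of a positive function is written exp (-ln), a composition of measurable
     functions. *)
  rewrite (_ : (fun _ => _) = fun t => expR (- ln (n2 (F t)))).
    apply: measurableT_comp => //; apply: measurableT_comp => //.
    apply: measurableT_comp; first exact: measurable_ln.
    by apply: measurable_funD; exact: measurable_funX.
  by apply/funext => t; rewrite expRN lnK ?posrE.
have E t : (F t)^-1 = ((n2 (F t))^-1)%:C * Num.conj (F t).
  apply: (mulIf (F0 t)); rewrite mulVf// -mulrA [Num.conj _ * _]mulrC mulCJ -rmorphM/=.
  by rewrite mulVf ?gt_eqF.
split.
  rewrite (_ : _ \o _ = fun t => (n2 (F t))^-1 * Re (F t)); first exact: measurable_funM.
  by apply/funext => t /=; rewrite E Re_mulC ReJ.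
rewrite (_ : _ \o _ = fun t => (n2 (F t))^-1 * - Im (F t)).
  by apply: measurable_funM => //; exact: measurableT_comp.
by apply/funext => t /=; rewrite E Im_mulC ImJ.
Qed.

Lemma cmeas_det n (F : T -> 'M[C]_n) : (forall i j, cmeas (fun t => F t i j)) ->
  cmeas (fun t => \det (F t)).
Proof.
move=> h; apply: cmeas_sum => s; apply: cmeasM; first exact: cmeas_cst.
by apply: cmeas_prod => i; exact: h.
Qed.

(** Cramer's rule: the entries of the inverse are rational in the entries of the matrix. *)
Lemma cmeas_invmx n (F : T -> 'M[C]_n) : (forall i j, cmeas (fun t => F t i j)) ->
  (forall t, F t \in unitmx) -> forall i j, cmeas (fun t => invmx (F t) i j).
Proof.
move=> h u i j.
rewrite (_ : (fun _ => _) = fun t => (\det (F t))^-1 * cofactor (F t) j i); last first.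
  by apply/funext => t; rewrite /invmx u !mxE.
apply: cmeasM.
  apply: cmeas_inv; first exact: cmeas_det.
  by move=> t; have := u t; rewrite unitmxE unitfE.
apply: cmeasM; first exact: cmeas_cst.
apply: cmeas_det => i' j'.
rewrite (_ : (fun _ => _) = fun t => F t (lift j i') (lift i j'))//.
by apply/funext => t; rewrite !mxE.
Qed.

Lemma mommx_resolv (u z : C) (dl : R) n N (W : T -> 'M[C]_(n, N)) : dir u z dl -> mommx W ->
  mommx (fun t => resolv z (W t)).
Proof.
move=> hd hW i j; apply: (@cmeas_bounded _ (dl^-1 * Num.sqrt n%:R)).
  apply: cmeas_invmx.
    move=> i' j'; have [[m1 _] [m2 _]] := mommxB (mommxM hW (mommx_adj hW)) (mommx_cst z%:M) i' j'.
    by split.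
  by move=> t; have [] := resolvP hd (W t).
move=> t; have [_ o _ _ _] := resolvP hd (W t).
by rewrite (le_trans (entry_nrm _ _ _))// opb_nrm1.
Qed.

End moments.

Section transfer.
Context (R : realType) d d' (T : measurableType d) (T' : measurableType d')
  (mu : probability T R) (mu' : probability T' R) (phi : T -> T').
Hypothesis mphi : measurable_fun setT phi.
Hypothesis inv : forall A, measurable A -> mu (phi @^-1` A) = mu' A.

Lemma rmom_push h : rmom mu' h -> rmom mu (fun t => h (phi t)).
Proof.
move=> [mh hh]; split; first exact: (measurableT_comp mh mphi).
move=> k; rewrite (integral_invariant (f := fun t => ((h t ^+ 2) ^+ k)%:E) mphi inv); first exact: hh.
exact: measurable_powers.
Qed.

Lemma Er_push h : measurable_fun setT h -> Er mu (fun t => h (phi t)) = Er mu' h.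
Proof.
move=> mh; rewrite /Er /Rintegral (integral_invariant (f := fun t => (h t)%:E) mphi inv)//.
exact/measurable_EFinP.
Qed.

Lemma mom_push F : mom mu' F -> mom mu (fun t => F (phi t)).
Proof. by move=> [F1 F2]; split; [exact: (rmom_push F1)|exact: (rmom_push F2)]. Qed.

Lemma Ec_push F : mom mu' F -> Ec mu (fun t => F (phi t)) = Ec mu' F.
Proof. by move=> [[F1 _] [F2 _]]; apply: complexP => /=; [exact: (Er_push F1)|exact: (Er_push F2)]. Qed.

Lemma mommx_push m n (F : T' -> 'M[R[i]]_(m, n)) : mommx mu' F -> mommx mu (fun t => F (phi t)).
Proof. by move=> hF i j; exact: (mom_push (hF i j)). Qed.

End transfer.

(** * Conditioning on the first of two independent copies *)

Section independent_copy.
Context (R : realType) d (T : measurableType d) (nu : probability T R).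
Local Notation mu := (nu \x nu)%E.

Lemma product_fst A : measurable A -> mu (fst @^-1` A) = nu A.
Proof.
move=> mA; rewrite (_ : fst @^-1` A = A `*` setT); last by apply/seteqP; split=> [[x y]|[x y] []].
by rewrite product_measure1E// [X in (_ * X)%E](_ : _ = 1%E) ?mule1//; exact: probability_setT.
Qed.

Lemma product_snd A : measurable A -> mu (snd @^-1` A) = nu A.
Proof.
move=> mA; rewrite (_ : snd @^-1` A = setT `*` A); last by apply/seteqP; split=> [[x y]|[x y] []].
by rewrite product_measure1E// [X in (X * _)%E](_ : _ = 1%E) ?mul1e//; exact: probability_setT.
Qed.

Definition mommx_fst m n (F : T -> 'M[R[i]]_(m, n)) :=
  @mommx_push _ _ _ _ _ mu nu fst measurable_fst product_fst m n F.
Definition mommx_snd m n (F : T -> 'M[R[i]]_(m, n)) :=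
  @mommx_push _ _ _ _ _ mu nu snd measurable_snd product_snd m n F.

Lemma Er_fubini (h : T * T -> R) (g : T -> R) : rmom mu h -> rmom nu g ->
  (forall x, rmom nu (fun y => h (x, y))) ->
  (forall x, Er nu (fun y => h (x, y)) = g x) -> Er mu h = Er nu g.
Proof.
move=> hh hg hx hE; apply: EFin_inj; rewrite !Er_EFin//.
rewrite -integral12_prod_meas1; last exact: (rmom_integrable hh).
by apply: eq_integral => x _; rewrite -hE Er_EFin.
Qed.

Lemma Er_fubini_ge (h : T * T -> R) (g : T -> R) : rmom mu h -> rmom nu g ->
  (forall x, rmom nu (fun y => h (x, y))) -> (forall t, 0 <= h t) -> (forall x, 0 <= g x) ->
  (forall x, g x <= Er nu (fun y => h (x, y))) -> Er nu g <= Er mu h.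
Proof.
move=> hh hg hx h0 g0 hE; rewrite -lee_fin !Er_EFin//.
have mh : measurable_fun setT (fun t => (h t)%:E) by apply/measurable_EFinP; exact: hh.1.
rewrite (fubini_tonelli1 _ mh); last by move=> t; rewrite lee_fin.
apply: le_int; first by apply/measurable_EFinP; exact: hg.1.
- by apply: measurable_fun_fubini_tonelli_F mh _ => t; rewrite lee_fin.
- by move=> x; rewrite lee_fin.
- by move=> x; rewrite /fubini_F -Er_EFin// lee_fin.
Qed.

Lemma Er_fubini_le (h : T * T -> R) (k : R) : rmom mu h ->
  (forall x, rmom nu (fun y => h (x, y))) -> (forall t, 0 <= h t) ->
  (forall x, Er nu (fun y => h (x, y)) <= k) -> Er mu h <= k.
Proof.
move=> hh hx h0 hE; rewrite -lee_fin !Er_EFin//.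
have mh : measurable_fun setT (fun t => (h t)%:E) by apply/measurable_EFinP; exact: hh.1.
rewrite (fubini_tonelli1 _ mh); last by move=> t; rewrite lee_fin.
rewrite -(int_cst nu k); apply: le_int => //.
- by apply: measurable_fun_fubini_tonelli_F mh _ => t; rewrite lee_fin.
- by move=> x; rewrite /fubini_F; apply: integral_ge0 => y _; rewrite lee_fin.
- by move=> x; rewrite /fubini_F -Er_EFin// lee_fin.
Qed.

Lemma Ec_fubini (h : T * T -> R[i]) (g : T -> R[i]) : mom mu h -> mom nu g ->
  (forall x, mom nu (fun y => h (x, y))) ->
  (forall x, Ec nu (fun y => h (x, y)) = g x) -> Ec mu h = Ec nu g.
Proof.
move=> [h1 h2] [g1 g2] hx hE; apply: complexP => /=.
  by apply: Er_fubini => // x; [case: (hx x)|rewrite /= -hE].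
by apply: Er_fubini => // x; [case: (hx x)|rewrite /= -hE].
Qed.
End independent_copy.

(** * Expansions under small rotations *)

Section jets.
Variable R : realType.
Local Notation C := R[i].

(** A first-order expansion X = X0 + s X1 + O(s^2) with explicit remainder. The same [k] bounds the
    two coefficients, which is what makes jets multiplicative. *)
Definition jet m n (s k : R) (X X0 X1 : 'M[C]_(m, n)) :=
  [/\ 0 <= k, nrm X0 <= k, nrm X1 <= k & nrm (X - X0 - s%:C *: X1) <= s ^+ 2 * k].

(** With X2, Y2 the remainders, the remainder of the product is X2 Y + X0 Y2 + s^2 X1 Y1 + s X1 Y2.
    As |Y| <= 3 l, the terms contribute 3, 1, 1 and 1, whence the 6. *)
Lemma jetM m n p s k l (X X0 X1 : 'M[C]_(m, n)) (Y Y0 Y1 : 'M[C]_(n, p)) : 0 <= s <= 1 ->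
  jet s k X X0 X1 -> jet s l Y Y0 Y1 ->
  jet s (6 * (k * l)) (X *m Y) (X0 *m Y0) (X0 *m Y1 + X1 *m Y0).
Proof.
move=> /andP[s0 s1] [k0 x0 x1 x2] [l0 y0 y1 y2].
have kl : 0 <= k * l by exact: mulr_ge0.
have M m' n' q (A : matrix C m' n') (B : matrix C n' q) (a b : R) : nrm A <= a -> nrm B <= b -> nrm (A *m B) <= a * b.
  by move=> hA hB; rewrite (le_trans (nrmM _ _))// ler_pM.
split; first by rewrite mulr_ge0.
- by rewrite (le_trans (M _ _ _ _ _ _ _ x0 y0))//; lra.
- rewrite (le_trans (nrmD _ _))//; have := M _ _ _ _ _ _ _ x0 y1; have := M _ _ _ _ _ _ _ x1 y0; lra.
set X2 := X - X0 - s%:C *: X1 in x2 *; set Y2 := Y - Y0 - s%:C *: Y1 in y2 *.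
have eX : X = X0 + s%:C *: X1 + X2 by rewrite /X2; apply/matrixP => i j; rewrite !mxE; ring.
have eY : Y = Y0 + s%:C *: Y1 + Y2 by rewrite /Y2; apply/matrixP => i j; rewrite !mxE; ring.
have ss : s ^+ 2 <= 1 by rewrite expr_le1.
have ns A q (B : 'M[C]_(A, q)) : nrm (s%:C *: B) = s * nrm B.
  by rewrite nrmZ /normc/= expr0n/= addr0 sqrtr_sqr ger0_norm.
have bY : nrm Y <= 3 * l.
  rewrite eY (le_trans (nrmD _ _))//.
  have := nrmD Y0 (s%:C *: Y1); rewrite ns.
  have := ler_wpM2r (nrm_ge0 Y1) s1; have := ler_wpM2r l0 ss; lra.
have -> : X *m Y - X0 *m Y0 - s%:C *: (X0 *m Y1 + X1 *m Y0) =
    X2 *m Y + X0 *m Y2 + (s%:C *: X1) *m (s%:C *: Y1) + (s%:C *: X1) *m Y2.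
  rewrite {1}eX mulmxDl [X in X - _ - _]addrC -!addrA; congr (_ + _).
  rewrite {1}eY !mulmxDl !mulmxDr -!scalemxAl -!scalemxAr !scalerDr.
  by apply/matrixP => i j; rewrite !mxE; ring.
have t1 := M _ _ _ _ _ _ _ x2 bY.
have t2 := M _ _ _ _ _ _ _ x0 y2.
have b1 : nrm (s%:C *: X1) <= s * k by rewrite ns ler_wpM2l.
have b2 : nrm (s%:C *: Y1) <= s * l by rewrite ns ler_wpM2l.
have t3 := M _ _ _ _ _ _ _ b1 b2.
have b3 : nrm (s%:C *: X1) <= k by rewrite (le_trans b1)// ler_piMl.
have t4 := M _ _ _ _ _ _ _ b3 y2.
rewrite (le_trans (nrmD _ _))//; have := nrmD (X2 *m Y + X0 *m Y2) ((s%:C *: X1) *m (s%:C *: Y1)).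
have := nrmD (X2 *m Y) (X0 *m Y2).
move: t1 t2 t3 t4; set a := nrm _; set b := nrm _; set c := nrm _; set e := nrm _.
move: (nrm _) (nrm _) => f g.
lra.
Qed.

Lemma jet_cst m n s (A : 'M[C]_(m, n)) : jet s (nrm A) A A 0.
Proof.
by split; rewrite ?nrm0// scaler0 !subr0 subrr nrm0 mulr_ge0// sqr_ge0.
Qed.

Lemma jet_adj m n s k (X X0 X1 : 'M[C]_(m, n)) : jet s k X X0 X1 -> jet s k X^H X0^H X1^H.
Proof.
move=> [k0 a b c]; split; rewrite ?nrm_adj//.
by rewrite -{1}(cjC s) -adj_scale -!adjB nrm_adj.
Qed.
End jets.

Section resolvent_jet.
Variable R : realType.
Local Notation C := R[i].

Lemma nrm_realZ m n (s : R) (A : 'M[C]_(m, n)) : nrm (s%:C *: A) = `|s| * nrm A.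
Proof. by rewrite nrmZ /normc/= expr0n/= addr0 sqrtr_sqr. Qed.

(** Replacing c by 1 is a second-order error: 1 - c <= 1 - c^2 = s^2. *)
Lemma jet_rot m n (s c rho : R) (W V : 'M[C]_(m, n)) : c ^+ 2 + s ^+ 2 = 1 -> 0 <= c ->
  0 < s <= 1 -> nrm W <= rho -> nrm V <= rho -> jet s rho (c%:C *: W + s%:C *: V) W V.
Proof.
move=> cs c0 /andP[s0 s1] hW hV.
have r0 : 0 <= rho by rewrite (le_trans _ hW).
split=> //.
have -> : c%:C *: W + s%:C *: V - W - s%:C *: V = (c - 1)%:C *: W.
  by rewrite rmorphB/= scalerBl scale1r; apply/matrixP => i j; rewrite !mxE; ring.
rewrite nrm_realZ; apply: ler_pM => //.
have c1 : c <= 1 by rewrite -(@ler_pXn2r _ 2)// ?nnegrE// expr1n; nra.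
by rewrite ler0_norm; nra.
Qed.

Lemma rot_square m n (a b : C) (W V : 'M[C]_(m, n)) :
  Num.conj a = a -> Num.conj b = b -> a ^+ 2 + b ^+ 2 = 1 ->
  (a *: W + b *: V) *m (a *: W + b *: V)^H - W *m W^H =
  (a * b) *: (V *m W^H + W *m V^H) + b ^+ 2 *: (V *m V^H - W *m W^H).
Proof.
move=> ha hb ab; rewrite adjD (adj_scale a) (adj_scale b) ha hb mulmxDl !mulmxDr.
rewrite -!scalemxAl -!scalemxAr !scalerA.
move: (W *m W^H) (W *m V^H) (V *m W^H) (V *m V^H) => ww wv vw vv.
apply/matrixP => i j; rewrite !mxE (_ : b ^+ 2 = 1 - a ^+ 2); last by rewrite -ab; ring.
rewrite -[b * b]expr2 (_ : b ^+ 2 = 1 - a ^+ 2); last by rewrite -ab; ring.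
ring.
Qed.

(** The perturbation D = W' W'^H - W W^H is c s H + s^2 G, where H and G are quadratic in (W, V);
    the remainder is quadratic in D, hence the power [rho ^+ 4]. The constant depends on n and on
    the point z, but not on s nor on the matrices. *)
Lemma resolv_jet (u z : C) (dl : R) : dir u z dl -> forall n N, exists2 k : R, 0 <= k &
  forall (W V : 'M[C]_(n, N)) (c s rho : R), c ^+ 2 + s ^+ 2 = 1 -> 0 <= c -> 0 < s <= 1 ->
  1 <= rho -> nrm W <= rho -> nrm V <= rho ->
  jet s (k * rho ^+ 4) (resolv z (c%:C *: W + s%:C *: V)) (resolv z W)
    (- (resolv z W *m (V *m W^H + W *m V^H) *m resolv z W)).
Proof.
move=> hd n N; set q := dl^-1 * Num.sqrt n%:R.
have [_ _ dl0 _] := hd.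
have q0 : 0 <= q by rewrite mulr_ge0 ?sqrtr_ge0// invr_ge0 ltW.
have hq (W : 'M[C]_(n, N)) : nrm (resolv z W) <= q.
  by have [_ o _ _ _] := resolvP hd W; exact: opb_nrm1.
exists (q + 4 * q ^+ 2 + 16 * q ^+ 3); first by rewrite !addr_ge0// mulr_ge0// exprn_ge0.
move=> W V c s rho cs c0 /andP[s0 s1] r1 hW hV.
have r0 : 0 <= rho by lra.
have c1 : c <= 1 by rewrite -(@ler_pXn2r _ 2)// ?nnegrE// expr1n; nra.
set H := V *m W^H + W *m V^H; set W' := c%:C *: W + s%:C *: V.
set Q := resolv z W; set Q' := resolv z W'.
pose G := V *m V^H - W *m W^H.
pose D := (c * s)%:C *: H + (s ^+ 2)%:C *: G.
have DE : W' *m W'^H - W *m W^H = D.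
  by rewrite /D rmorphM rmorphXn/=; apply: rot_square; rewrite ?cjC// -!rmorphXn/= -rmorphD cs.
have [uW _ _ _ _] := resolvP hd W; have [uW' _ _ _ _] := resolvP hd W'.
have zz (a b e : 'M[C]_n) : a - e - (b - e) = a - b by rewrite opprB addrA subrK.
have e1 : Q - Q' = Q *m D *m Q' by have := resolv_id uW uW'; rewrite zz DE.
have e2 : Q - Q' = Q' *m D *m Q.
  have := resolv_id uW' uW; rewrite zz -[_ - W' *m _]opprB DE mulmxN mulNmx.
  by move=> /(congr1 -%R); rewrite opprK opprB.
have M m' n' q' (A : matrix C m' n') (B : matrix C n' q') (a b : R) : nrm A <= a -> nrm B <= b -> nrm (A *m B) <= a * b.
  by move=> hA hB; rewrite (le_trans (nrmM _ _))// ler_pM.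
have hWt : nrm W^H <= rho by rewrite nrm_adj.
have hVt : nrm V^H <= rho by rewrite nrm_adj.
have hH : nrm H <= 2 * rho ^+ 2.
  rewrite [X in _ <= X](_ : _ = rho * rho + rho * rho); last by ring.
  by rewrite (le_trans (nrmD _ _))// lerD// M.
have hG : nrm G <= 2 * rho ^+ 2.
  rewrite [X in _ <= X](_ : _ = rho * rho + rho * rho); last by ring.
  by rewrite (le_trans (nrmD _ _))// nrmN lerD// M.
have rr : 1 <= rho ^+ 2 by nra.
have hD1 : nrm (D - s%:C *: H) <= s ^+ 2 * (4 * rho ^+ 2).
  have -> : D - s%:C *: H = (s * (c - 1))%:C *: H + (s ^+ 2)%:C *: G.
    rewrite /D -addrA [X in _ + X]addrC addrA -scalerBl; congr (_ *: _ + _).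
    by rewrite -rmorphB/=; congr (_%:C); ring.
  have := nrmD ((s * (c - 1))%:C *: H) ((s ^+ 2)%:C *: G); rewrite !nrm_realZ.
  rewrite (ger0_norm (sqr_ge0 s)) normrM (gtr0_norm s0) ler0_norm; last lra.
  have b1 : s * - (c - 1) <= s ^+ 2 by nra.
  have b2 := ler_pM (_ : 0 <= s * - (c - 1)) (nrm_ge0 H) b1 hH.
  have b3 : s ^+ 2 * nrm G <= s ^+ 2 * (2 * rho ^+ 2) by rewrite ler_wpM2l// sqr_ge0.
  have b4 : 0 <= s * - (c - 1) by rewrite mulr_ge0 ?(ltW s0)// oppr_ge0 subr_le0.
  by have := b2 b4; lra.
have hD : nrm D <= s * (4 * rho ^+ 2).
  have := nrmD ((c * s)%:C *: H) ((s ^+ 2)%:C *: G); rewrite !nrm_realZ.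
  rewrite (ger0_norm (sqr_ge0 s)) ger0_norm; last by rewrite mulr_ge0// ltW.
  have b2 := ler_pM (_ : 0 <= c * s) (nrm_ge0 H) (_ : c * s <= s) hH.
  have b3 := ler_pM (sqr_ge0 s) (nrm_ge0 G) (_ : s ^+ 2 <= s) hG.
  have b4 : 0 <= c * s by rewrite mulr_ge0// ltW.
  have b5 : c * s <= s by nra.
  have b6 : s ^+ 2 <= s by nra.
  by have := b2 b4 b5; have := b3 b6; rewrite -/D; lra.
have k1 : rho ^+ 2 <= rho ^+ 4 by rewrite -[4%N]/(2 + 2)%N exprD; nra.
have k2 : 1 <= rho ^+ 4 by lra.
have r4 := le_trans ler01 k2.
have q2 := exprn_ge0 2 q0; have q3 := exprn_ge0 3 q0.
split.
- by rewrite mulr_ge0 ?exprn_ge0// !addr_ge0// mulr_ge0.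
- by rewrite (le_trans (hq W))//; nra.
- rewrite nrmN.
  have b := M _ _ _ _ _ _ _ (M _ _ _ _ _ _ _ (hq W) hH) (hq W).
  rewrite (le_trans b)//.
  have -> : q * (2 * rho ^+ 2) * q = 2 * q ^+ 2 * rho ^+ 2 by ring.
  have : q ^+ 2 * rho ^+ 2 <= q ^+ 2 * rho ^+ 4 by rewrite ler_wpM2l.
  have : 0 <= q * rho ^+ 4 by rewrite mulr_ge0.
  have : 0 <= q ^+ 3 * rho ^+ 4 by rewrite mulr_ge0.
  by have : 0 <= q ^+ 2 * rho ^+ 4 by [rewrite mulr_ge0]; lra.
(* The resolvent identity iterated once, with one factor Q' kept: Q' = Q - Q D Q + Q D Q' D Q. Only
   the bound on Q' is then needed, not a convergent series. *)
have -> : Q' - Q - s%:C *: - (Q *m H *m Q) = - (Q *m (D - s%:C *: H) *m Q) + Q *m D *m (Q' *m D *m Q).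
  have -> : Q *m D *m (Q' *m D *m Q) = Q *m D *m Q - (Q - Q').
    by rewrite [in RHS]e1 -mulmxBr [in RHS]e2.
  rewrite mulmxBr mulmxBl -scalemxAr -scalemxAl scalerN.
  by move: (Q *m D *m Q) (Q *m H *m Q) => A B; apply/matrixP => i j; rewrite !mxE; ring.
rewrite (le_trans (nrmD _ _))// nrmN.
have b1 := M _ _ _ _ _ _ _ (M _ _ _ _ _ _ _ (hq W) hD1) (hq W).
have b2 := M _ _ _ _ _ _ _ (M _ _ _ _ _ _ _ (hq W) hD) (M _ _ _ _ _ _ _ (M _ _ _ _ _ _ _ (hq W') hD) (hq W)).
rewrite (le_trans (lerD b1 b2))//.
rewrite (_ : _ + _ = s ^+ 2 * (4 * q ^+ 2 * rho ^+ 2 + 16 * q ^+ 3 * rho ^+ 4)); last by ring.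
rewrite ler_wpM2l ?sqr_ge0//.
have : q ^+ 2 * rho ^+ 2 <= q ^+ 2 * rho ^+ 4 by rewrite ler_wpM2l.
have : 0 <= q * rho ^+ 4 by rewrite mulr_ge0.
lra.
Qed.
End resolvent_jet.

(** Finite moments are checked along the syntax of the expression; the leaves are constants and
    hypotheses of the context. *)
Ltac mstep := match goal with
   | |- rmom ?m (fun _ => ?c) => exact (@rmom_cst _ _ _ m c)
   | |- mom ?m (fun _ => ?c) => exact (@mom_cst _ _ _ m c)
   | |- mommx ?m (fun _ => ?c) => exact (@mommx_cst _ _ _ m _ _ c)
   | |- rmom ?m (fun t => n2 (@?f t)) => apply: (@rmom_n2 _ _ _ m f)
   | |- rmom ?m (fun t => fro2 (@?f t)) => apply: (@rmom_fro2 _ _ _ m _ _ f)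
   | |- rmom ?m (fun t => GRing.add (@?f t) (@?g t)) => apply: (@rmomD _ _ _ m f g)
   | |- rmom ?m (fun t => GRing.mul (@?f t) (@?g t)) => apply: (@rmomM _ _ _ m f g)
   | |- rmom ?m (fun t => GRing.opp (@?f t)) => apply: (@rmomN _ _ _ m f)
   | |- rmom ?m (fun t => GRing.exp (@?f t) ?k) => apply: (@rmomX _ _ _ m f k)
   | |- mom ?m (fun t => GRing.add (@?f t) (@?g t)) => apply: (@momD _ _ _ m f g)
   | |- mom ?m (fun t => GRing.mul (@?f t) (@?g t)) => apply: (@momM _ _ _ m f g)
   | |- mom ?m (fun t => GRing.opp (@?f t)) => apply: (@momN _ _ _ m f)
   | |- mom ?m (fun t => mxtrace (@?f t)) => apply: (@mom_tr _ _ _ m _ f)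
   | |- mom ?m (fun t => Num.conj (@?f t)) => apply: (@momJ _ _ _ m f)
   | |- mom ?m (fun t => fun_of_matrix (@?f t) ?i ?j) => apply: (@mom_entry _ _ _ m _ _ f i j)
   | |- mommx ?m (fun t => GRing.add (@?f t) (@?g t)) => apply: (@mommxD _ _ _ m _ _ f g)
   | |- mommx ?m (fun t => GRing.opp (@?f t)) => apply: (@mommxN _ _ _ m _ _ f)
   | |- mommx ?m (fun t => mulmx (@?f t) (@?g t)) => apply: (@mommxM _ _ _ m _ _ _ f g)
   | |- mommx ?m (fun t => map_mx _ (trmx (@?f t))) => apply: (@mommx_adj _ _ _ m _ _ f)
   | |- mommx ?m (fun t => GRing.scale (@?a t) (@?f t)) => apply: (@mommxZ _ _ _ m _ _ a f)
   | H : rmom ?m _ |- rmom ?m _ => exact H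
   | H : mom ?m _ |- mom ?m _ => exact H
   | H : mommx ?m _ |- mommx ?m _ => exact H
   end.
Ltac mtac := repeat mstep.

(** * Circular Gaussian matrices *)

Lemma normc_real (R : realType) (a : R) : normc a%:C = `|a|.
Proof. by rewrite /normc/= expr0n/= addr0 sqrtr_sqr. Qed.

(** Cauchy-Schwarz for c = sqrt a times (c / sqrt a). An index with a i = 0 contributes nothing,
    since then c i = 0. *)
Lemma n2_sum_CS (R : realType) (I : finType) (c : I -> R[i]) (a b : I -> R) :
  (forall i, 0 <= a i) -> (forall i, 0 <= b i) -> (forall i, n2 (c i) <= a i * b i) ->
  n2 (\sum_i c i) <= (\sum_i a i) * (\sum_i b i).
Proof.
move=> a0 b0 h; pose f i := (Num.sqrt (a i))%:C; pose g i := c i / f i.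
have fE i : n2 (f i) = a i by rewrite n2C sqr_sqrtr.
have hz i : a i = 0 -> c i = 0.
  by move=> ai; apply: n2_eq0; apply/eqP; rewrite eq_le n2_ge0 andbT; have := h i; rewrite ai mul0r.
have -> : \sum_i c i = \sum_i f i * g i.
  apply: eq_bigr => i _; rewrite /g mulrCA; have [/hz ->|ai] := eqVneq (a i) 0; first by rewrite mul0r.
  by rewrite divff ?mulr1//; apply: contra_neq ai => fi; rewrite -fE fi n20.
apply: (le_trans (n2_CS _ _ _)).
apply: ler_pM; try by apply: sumr_ge0 => i _.
  by under eq_bigr do rewrite fE.
apply: ler_sum => i _; rewrite /g n2M n2V fE.
have [ai|ai] := eqVneq (a i) 0; first by rewrite hz// n20 mul0r.
by rewrite ler_pdivrMr ?lt0r ?ai ?a0// mulrC.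
Qed.

Lemma expr_mono (R : realType) k (x y : R) : 0 <= x -> x <= y -> x ^+ k <= y ^+ k.
Proof. by move=> x0 xy; apply: lerXn2r => //; rewrite nnegrE// (le_trans x0). Qed.

Lemma ler_of_inv_nat (R : realType) (a b k : R) : 0 <= k ->
  (forall K, (0 < K)%N -> a <= b + k / K%:R) -> a <= b.
Proof.
move=> k0 h; rewrite leNgt; apply/negP => ba.
have e0 : 0 < a - b by rewrite subr_gt0.
have [K /= hK] : exists K : nat, k / (a - b) < K%:R.
  by exists (Num.bound (k / (a - b))); apply: archi_boundP; rewrite divr_ge0// ltW.
have K0 : 0 < K%:R :> R by rewrite (le_lt_trans _ hK)// divr_ge0// ltW.
have := h K; rewrite -(ltr_nat R) K0 => /(_ isT).
rewrite ltr_pdivrMr// in hK.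
rewrite -lerBlDl ler_pdivlMr//; lra.
Qed.

(** Cauchy-Schwarz applied twice: |sum a|^4 <= K^3 sum |a|^4. *)
Lemma n2_sum_sqr (R : realType) K (a : 'I_K -> R[i]) :
  n2 (\sum_j a j) ^+ 2 <= K%:R ^+ 3 * \sum_j n2 (a j) ^+ 2.
Proof.
have cs (I : finType) (c : I -> R[i]) : n2 (\sum_j c j) <= #|I|%:R * \sum_j n2 (c j).
  have := n2_CS xpredT (fun=> 1) c; under eq_bigr do rewrite mul1r.
  move=> h; apply: (le_trans h); rewrite ler_wpM2r ?sumr_ge0//.
  by rewrite (eq_bigr (fun=> 1)) => [|i _]; rewrite ?n21// sumr_const.
have h1 := cs _ a; have h2 := cs _ (fun j => (n2 (a j))%:C).
rewrite card_ord -rmorph_sum/= n2C in h1 h2.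
have E : \sum_j n2 (n2 (a j))%:C = \sum_j n2 (a j) ^+ 2 by apply: eq_bigr => j _; rewrite n2C.
rewrite E in h2.
apply: (@le_trans _ _ ((K%:R * \sum_j n2 (a j)) ^+ 2)).
  by apply: lerXn2r; rewrite ?nnegrE ?mulr_ge0// sumr_ge0.
by rewrite exprMn [_ ^+ 3]exprSr -mulrA ler_wpM2l// sqr_ge0.
Qed.

Lemma sin_le_id (R : realType) (x : R) : 0 <= x -> sin x <= x.
Proof.
rewrite le_eqVlt => /predU1P[<-|x0]; first by rewrite sin0.
have [c _] := @MVT R sin cos 0 x x0 (fun y _ => is_derive_sin y) (continuous_subspaceT (@continuous_sin R)).
rewrite sin0 !subr0 => ->.
by rewrite ler_piMl ?cos_le1// ltW.
Qed.

Lemma scale_neg_inv (R : realType) m n (z : R[i]) : z != 0 ->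
  forall X : 'M[R[i]]_(m, n), X = - z *: (- z^-1 *: X).
Proof. by move=> z0 X; rewrite scalerA mulrNN divff// scale1r. Qed.

Lemma combine_bounds (R : realType) (a b x y : R) : a <= 16 * x -> b <= 16 * y ->
  8 * a + 8 * b <= 128 * x + 128 * y.
Proof. lra. Qed.

Lemma tr_combo (R : realType) n (a : R[i]) (A B D : 'M[R[i]]_n) :
  \tr A - \tr B - a * \tr D = \tr (A - B - a *: D).
Proof. by rewrite !raddfB/= mxtraceZ. Qed.

(** The first-order coefficient as produced by the nested uses of [jetM], sorted into the three
    terms of the integration by parts. *)
Lemma jet_shape (R : realType) n N (q h B : 'M[R[i]]_n) (v w : 'M[R[i]]_(n, N))
    (vt wt : 'M[R[i]]_(N, n)) (F : 'M[R[i]]_N) :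
  q *m v *m F *m wt *m 0 + (q *m v *m F *m vt +
    (q *m v *m 0 + (q *m (- w) + (- h) *m v) *m F) *m wt) *m B =
  q *m v *m F *m vt *m B - q *m w *m F *m wt *m B - h *m v *m F *m wt *m B.
Proof. by rewrite !mulmx0 !add0r !mulmxDl mulmxN !mulNmx addrA. Qed.

(** * Integration by parts and concentration for a circular Gaussian matrix *)

Section gaussian_matrix.
Variables (R : realType) (n N : nat).
Local Notation C := R[i].
Local Notation J := ('I_n * 'I_N * bool)%type.
Local Notation E := (boxspace R J).
Local Notation coord := (fun (j : J) (x : E) => x j).
Notation Re := (@complex.Re R).
Notation Im := (@complex.Im R).

Definition Wm (x : E) : 'M[C]_(n, N) := \matrix_(a, j) (x (a, j, true) +i* x (a, j, false)).

Variable nu : probability E R.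
Hypothesis jg : forall a, gaussian_rv nu (lin coord a).
Hypothesis sym : forall a,
  (\int[nu]_t (expR (lin coord a t))%:E = \int[nu]_t (expR (- lin coord a t))%:E)%E.
Local Notation mu := (nu \x nu)%E.

Lemma rmom_lin a : rmom nu (lin coord a).
Proof.
split; first exact: (lin_measurable jg).
move=> k; rewrite (_ : (fun t => _) = fun t => (`|lin coord a t| ^+ (2 * k))%:E).
  exact: (lin_moment jg sym).
by apply/funext => t; rewrite exprM real_normK ?num_real.
Qed.

Lemma lin_coord j x : lin coord (fun j' => (j' == j)%:R) x = x j.
Proof.
rewrite /lin (bigD1 j)//= eqxx mul1r big1 ?addr0// => j' /negPf ->.
by rewrite mul0r.
Qed.

Lemma mommx_Wm : mommx nu Wm.
Proof.
move=> a j; split.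
  have := rmom_lin (fun j' => (j' == (a, j, true))%:R); congr rmom.
  by apply/funext => x /=; rewrite lin_coord mxE.
have := rmom_lin (fun j' => (j' == (a, j, false))%:R); congr rmom.
by apply/funext => x /=; rewrite lin_coord mxE.
Qed.

Let coefR (G : 'M[C]_(N, n)) (p : J) : R := if p.2 then Re (G p.1.2 p.1.1) else - Im (G p.1.2 p.1.1).
Let coefI (G : 'M[C]_(N, n)) (p : J) : R := if p.2 then Im (G p.1.2 p.1.1) else Re (G p.1.2 p.1.1).

Lemma lin_pair (a : J -> R) x : lin coord a x =
  \sum_i \sum_j (a (i, j, true) * x (i, j, true) + a (i, j, false) * x (i, j, false)).
Proof.
rewrite /lin pair_bigA/= (eq_bigr (fun p : J => a (p.1, p.2) * x (p.1, p.2))); last by move=> [].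
rewrite -(pair_bigA _ (fun p q => a (p, q) * x (p, q)))/=; apply: eq_bigr => -[i j] _.
by rewrite big_bool.
Qed.

Lemma Re_trGW G x : Re (\tr (G *m Wm x)) = lin coord (coefR G) x.
Proof.
rewrite lin_pair /mxtrace Re_sum.
rewrite exchange_big/=; apply: eq_bigr => j _; rewrite mxE Re_sum; apply: eq_bigr => i _.
by rewrite mxE Re_mul /coefR/=; ring.
Qed.

Lemma Im_trGW G x : Im (\tr (G *m Wm x)) = lin coord (coefI G) x.
Proof.
rewrite lin_pair /mxtrace Im_sum.
rewrite exchange_big/=; apply: eq_bigr => j _; rewrite mxE Im_sum; apply: eq_bigr => i _.
by rewrite mxE Im_mul /coefI/=; ring.
Qed.

Variable k4 : R.
Hypothesis k40 : 0 <= k4.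
Hypothesis hk4 : forall a v, (\int[nu]_t (lin coord a t ^+ 2)%:E = v%:E)%E ->
    (\int[nu]_t (lin coord a t ^+ 4)%:E <= (k4 * v ^+ 2)%:E)%E.
(** [eta] controls a linear form in all entries at once, [kap] the action on one vector. In the
    Hankel model the first is of order L / N and the second bounded; only these bounds and
    circularity are retained here. *)
Variables eta kap : R.
Hypothesis eta0 : 0 <= eta.
Hypothesis kap0 : 0 <= kap.
Hypothesis EV0 : Emx nu Wm = 0.
Hypothesis EVV : forall a j b k, Ec nu (fun x => Wm x a j * Wm x b k) = 0.
Hypothesis h_eta : forall G : 'M[C]_(N, n), Er nu (fun x => n2 (\tr (G *m Wm x))) <= eta * fro2 G.
Hypothesis h_kapl : forall x : 'cV[C]_n, Er nu (fun v => fro2 ((Wm v)^H *m x)) <= kap * fro2 x.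
Hypothesis h_kapr : forall y : 'cV[C]_N, Er nu (fun v => fro2 (Wm v *m y)) <= kap * fro2 y.

Let mW := mommx_Wm.

Lemma fourth_lin a : Er nu (fun t => lin coord a t ^+ 4) <= k4 * Er nu (fun t => lin coord a t ^+ 2) ^+ 2.
Proof.
have h2 := rmomX 2 (rmom_lin a); have h4 := rmomX 4 (rmom_lin a).
by rewrite -lee_fin (Er_EFin h4); apply: hk4; rewrite (Er_EFin h2).
Qed.

(** |w|^4 <= 2 ((Re w)^4 + (Im w)^4), and each part is a real Gaussian form whose variance is at
    most that of the trace. *)
Lemma fourth_trace G : Er nu (fun x => n2 (\tr (G *m Wm x)) ^+ 2) <= 4 * k4 * (eta * fro2 G) ^+ 2.
Proof.
have hE : Er nu (fun x => n2 (\tr (G *m Wm x)) ^+ 2) <=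
    Er nu (fun x => 2 * (lin coord (coefR G) x ^+ 4 + lin coord (coefI G) x ^+ 4)).
  have r1 := rmom_lin (coefR G); have r2 := rmom_lin (coefI G).
  apply: Er_le; mtac.
  move=> x; rewrite /n2 Re_trGW Im_trGW.
  move: (lin _ _ _) (lin _ _ _) => a b.
  by rewrite -![_ ^+ 4]/(_ ^+ (2 * 2)) !exprM; have := sqr_ge0 (a ^+ 2 - b ^+ 2); lra.
apply: (le_trans hE); rewrite ErZ; last by apply: rmomD; apply: rmomX; exact: rmom_lin.
rewrite ErD; [|by apply: rmomX; exact: rmom_lin..].
have bnd (a : J -> R) : (forall x, lin coord a x ^+ 2 <= n2 (\tr (G *m Wm x))) ->
    Er nu (fun t => lin coord a t ^+ 4) <= k4 * (eta * fro2 G) ^+ 2.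
  move=> ha; apply: (le_trans (fourth_lin a)); rewrite ler_wpM2l//.
  apply: lerXn2r; rewrite ?nnegrE ?mulr_ge0//; first by apply: Er_ge0 => t; exact: sqr_ge0.
  apply: (le_trans _ (h_eta G)); apply: Er_le => //; first exact: rmomX (rmom_lin a).
  by mtac.
have := bnd (coefR G) _; have := bnd (coefI G) _.
set e1 := Er _ _; set e2 := Er _ _ => b1 b2.
have h1 : e2 <= k4 * (eta * fro2 G) ^+ 2 by apply: b2 => x; rewrite -Re_trGW Re_le.
have h2 : e1 <= k4 * (eta * fro2 G) ^+ 2 by apply: b1 => x; rewrite -Im_trGW Im_le.
by lra.
Qed.

Definition Kop (F : 'M[C]_N) : 'M[C]_n := Emx nu (fun x => Wm x *m F *m (Wm x)^H).
Definition Ktop (X : 'M[C]_n) : 'M[C]_N := Emx nu (fun x => (Wm x)^H *m X *m Wm x).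

Lemma mom_qf m (F : E -> 'M[C]_m) x : mommx nu F -> mom nu (fun t => qf (F t) x).
Proof. by move=> hF; rewrite /qf; mtac. Qed.

Lemma bf_Emx m p (F : E -> 'M[C]_(m, p)) x y : mommx nu F ->
  bf (Emx nu F) x y = Ec nu (fun t => bf (F t) x y).
Proof.
move=> hF; have h1 : mommx nu (fun t => x^H *m F t) by mtac.
by rewrite /bf -EmxMl// -EmxMr// mxE.
Qed.

Lemma qf_Emx m (F : E -> 'M[C]_m) x : mommx nu F -> qf (Emx nu F) x = Ec nu (fun t => qf (F t) x).
Proof. exact: bf_Emx. Qed.

Lemma accr_Emx m (F : E -> 'M[C]_m) v : mommx nu F -> (forall t, accr v (F t)) -> accr v (Emx nu F).
Proof.
move=> hF h x; rewrite qf_Emx//; have hq := mom_qf x hF.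
rewrite -EcZ//; apply: Er_ge0 => t; exact: h.
Qed.

Lemma KopB X Y : Kop (X - Y) = Kop X - Kop Y.
Proof.
rewrite /Kop -EmxB; [|by mtac..].
by apply: eq_Emx => t; rewrite mulmxBr mulmxBl.
Qed.
Lemma KtopB X Y : Ktop (X - Y) = Ktop X - Ktop Y.
Proof.
rewrite /Ktop -EmxB; [|by mtac..].
by apply: eq_Emx => t; rewrite mulmxBr mulmxBl.
Qed.

Lemma accr_cong m p v (X : 'M[C]_m) (A : 'M[C]_(m, p)) : accr v X -> accr v (A^H *m X *m A).
Proof. by move=> h x; rewrite qf_cong. Qed.

Lemma Kop_accr v X : accr v X -> accr v (Kop X).
Proof.
move=> h; apply: accr_Emx; first by mtac.
by move=> t; have := accr_cong (Wm t)^H h; rewrite adjK.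
Qed.
Lemma Ktop_accr v X : accr v X -> accr v (Ktop X).
Proof. by move=> h; apply: accr_Emx; [mtac|move=> t; exact: accr_cong]. Qed.

(* Cauchy-Schwarz in the random variable, not only in the vectors: the norm of
   [V^H x] is controlled in mean square only. *)
Lemma opb_Ecov m p q r k (F : E -> 'M[C]_(p, m)) (G : E -> 'M[C]_(q, r)) (X : 'M[C]_(p, q)) :
  mommx nu F -> mommx nu G ->
  (forall x : 'cV_m, Er nu (fun t => fro2 (F t *m x)) <= kap * fro2 x) ->
  (forall y : 'cV_r, Er nu (fun t => fro2 (G t *m y)) <= kap * fro2 y) ->
  opb k X -> opb (kap * k) (Emx nu (fun t => (F t)^H *m X *m G t)).
Proof.
move=> mF mG hF hG hX; have [k0 _] := hX.
apply: opb_bf => [|x y]; first exact: mulr_ge0.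
apply: normc_le_sqr; first by rewrite !mulr_ge0.
rewrite bf_Emx; last by mtac.
have e t : bf ((F t)^H *m X *m G t) x y = \tr (X *m (G t *m y *m (F t *m x)^H)).
  by rewrite mulmxA [RHS]mxtrace_mulC trmx11 adjM /bf !mulmxA.
rewrite (eq_Ec _ e).
have -> : Ec nu (fun t => \tr (X *m (G t *m y *m (F t *m x)^H))) =
   Ec nu (fun t => \sum_i (X *m G t *m y) i 0 * (F t *m x)^H 0 i).
  apply: eq_Ec => t; rewrite !mulmxA mxtrace_mulC trmx11 mxE.
  by apply: eq_bigr => i _; rewrite mulrC.
set a := fun t => \sum_i _.
have m1 i : mom nu (fun t => (X *m G t *m y) i 0) by mtac.
have m2 i : mom nu (fun t => (F t *m x)^H 0 i) by mtac.
have ma : mom nu a by apply: mom_sum => i; exact: momM.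
rewrite Ec_sum; last by move=> i; exact: momM.
have step : n2 (\sum_i Ec nu (fun t => (X *m G t *m y) i 0 * (F t *m x)^H 0 i)) <=
    (\sum_i Er nu (fun t => n2 ((X *m G t *m y) i 0))) * (\sum_i Er nu (fun t => n2 ((F t *m x)^H 0 i))).
  apply: n2_sum_CS => i; [by apply: Er_ge0..|exact: Ec_CS].
apply: (le_trans step); rewrite -!Er_sum; [|by move=> i; mtac..].
have b1 : Er nu (fun t => \sum_i n2 ((X *m G t *m y) i 0)) <= k ^+ 2 * (kap * fro2 y).
  apply: (@le_trans _ _ (Er nu (fun t => k ^+ 2 * fro2 (G t *m y)))).
    apply: Er_le; [by apply: rmom_sum => i; mtac|by mtac|].
    by move=> t; rewrite -fro2_cV -mulmxA; exact: opb_fro2.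
  by rewrite ErZ; [rewrite ler_wpM2l// sqr_ge0|mtac].
have b2 : Er nu (fun t => \sum_i n2 ((F t *m x)^H 0 i)) <= kap * fro2 x.
  apply: le_trans (hF x); apply: Er_le; [by apply: rmom_sum => i; mtac|by mtac|].
  by move=> t; rewrite fro2_cV; apply: ler_sum => i _; rewrite adjE n2J.
have s0 (I : finType) (f : I -> E -> C) : 0 <= Er nu (fun t => \sum_i n2 (f i t)).
  by apply: Er_ge0 => t; apply: sumr_ge0.
apply: (le_trans (ler_pM (s0 _ _) (s0 _ _) b1 b2)).
by rewrite !exprMn !nrm2; lra.
Qed.

Lemma Kop_opb k X : opb k X -> opb (kap * k) (Kop X).
Proof.
move=> h; have mWt : mommx nu (fun x => (Wm x)^H) by mtac.
have -> : Kop X = Emx nu (fun t => ((Wm t)^H)^H *m X *m (Wm t)^H).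
  by apply: eq_Emx => t; rewrite adjK.
exact: opb_Ecov.
Qed.
Lemma Ktop_opb k X : opb k X -> opb (kap * k) (Ktop X).
Proof. exact: opb_Ecov. Qed.

Lemma Kop_adj F B : \tr (Kop F *m B) = \tr (F *m Ktop B).
Proof.
rewrite /Kop /Ktop -EmxMr; last by mtac.
rewrite -EmxMl; last by mtac.
rewrite -!Ec_tr; [|by mtac..].
by apply: eq_Ec => t; rewrite -!mulmxA mxtrace_mulC !mulmxA.
Qed.

(** The matrices that represent the entries of [Ktop] as traces, so that the fluctuations of [Ktop]
    of the resolvent become fluctuations of traces tr (Q B), to which concentration applies. *)
Definition Bcov (j k : 'I_N) : 'M[C]_n :=
  \matrix_(b, a) Ec nu (fun v => Num.conj (Wm v a j) * Wm v b k).

Lemma Ktop_entry X j k : Ktop X j k = \tr (X *m Bcov j k).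
Proof.
pose D v : 'M[C]_n := \matrix_(b, a) (Num.conj (Wm v a j) * Wm v b k).
have mD : mommx nu D.
  move=> b a; apply: (eq_mom (F := fun v => Num.conj (Wm v a j) * Wm v b k)); last by mtac.
  by move=> v; rewrite [RHS]mxE.
have -> : Bcov j k = Emx nu D.
  by apply/matrixP => b a; rewrite [LHS]mxE [RHS]mxE; apply: eq_Ec => v; rewrite [RHS]mxE.
rewrite -EmxMl// -Ec_tr; last by mtac.
rewrite mxE; apply: eq_Ec => v; rewrite mxE /mxtrace.
under eq_bigr do rewrite mxE mulr_suml.
rewrite exchange_big/=; apply: eq_bigr => a _; rewrite [RHS]mxE; apply: eq_bigr => b _.
by rewrite adjE [D v b a]mxE; ring.
Qed.

Lemma EVXV (X : 'M[C]_(N, n)) : Emx nu (fun x => Wm x *m X *m Wm x) = 0.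
Proof.
apply/matrixP => a k; rewrite !mxE.
rewrite (eq_Ec nu (G := fun x => \sum_b \sum_j (Wm x a j * Wm x b k) * X j b)); last first.
  move=> x; rewrite mxE; apply: eq_bigr => b _; rewrite !mxE mulr_suml.
  by apply: eq_bigr => j _; rewrite !mxE; ring.
have m0 a' j' b' k' : mom nu (fun x => Wm x a' j' * Wm x b' k') by mtac.
rewrite Ec_sum; last by move=> b; apply: mom_sum => j; mtac.
rewrite big1// => b _; rewrite Ec_sum; last by move=> j; mtac.
by rewrite big1// => j _; rewrite EcZr// EVV mul0r.
Qed.

Definition W1 (t : E * E) := Wm t.1.
Definition W2 (t : E * E) := Wm t.2.
(** A polynomial envelope, with all moments, of the norms that occur in the remainders; the leading
    1 allows powers of it to be compared. *)
Definition rho (t : E * E) := 1 + fro2 (W1 t) + fro2 (W2 t).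

Lemma mommx_W1 : mommx mu W1. Proof. exact: mommx_fst mommx_Wm. Qed.
Lemma mommx_W2 : mommx mu W2. Proof. exact: mommx_snd mommx_Wm. Qed.
Let m1 := mommx_W1. Let m2 := mommx_W2.
Lemma rmom_rho : rmom mu rho.
Proof. by rewrite /rho; mtac. Qed.
Lemma rho_ge1 t : 1 <= rho t.
Proof. by rewrite /rho -addrA lerDl addr_ge0. Qed.
Lemma W1_rho t : nrm (W1 t) <= rho t.
Proof.
rewrite /rho -nrm2; have := nrm_ge0 (W1 t); have := fro2_ge0 (W2 t).
by move: (nrm _) (fro2 _) => a b b0 a0; have := sqr_ge0 (a - 1); nra.
Qed.
Lemma W2_rho t : nrm (W2 t) <= rho t.
Proof.
rewrite /rho -[fro2 (W2 t)]nrm2; have := nrm_ge0 (W2 t); have := fro2_ge0 (W1 t).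
by move: (nrm _) (fro2 _) => a b b0 a0; have := sqr_ge0 (a - 1); nra.
Qed.
Lemma W1_rot c s t : W1 (pair_rot c s t) = c%:C *: W1 t + s%:C *: W2 t.
Proof. by apply/matrixP => a j; rewrite !mxE; apply: complexP; rewrite ?ReD ?ImD ?Re_mulC ?Im_mulC. Qed.
Lemma W2_rot c s t : W2 (pair_rot c s t) = c%:C *: W2 t + s%:C *: - W1 t.
Proof.
apply/matrixP => a j; rewrite !mxE; apply: complexP;
by rewrite ?ReD ?ImD ?Re_mulC ?Im_mulC ?ReN ?ImN/= mulrN mulNr addrC.
Qed.

(* (cW + sV, -sW + cV) has the law of (W, V); letting s -> 0 gives an integration
   by parts without densities. *)
Lemma rotation_derivative (Phi Phi1 : E * E -> C) (h : E * E -> R) :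
  mom mu Phi -> mom mu Phi1 -> rmom mu h ->
  (forall c s t, c ^+ 2 + s ^+ 2 = 1 -> 0 <= c -> 0 < s <= 1 ->
     normc (Phi (pair_rot c s t) - Phi t - s%:C * Phi1 t) <= s ^+ 2 * h t) ->
  Ec mu Phi1 = 0.
Proof.
move=> h0 h1 hh hb.
have key s : 0 < s <= 1 -> normc (Ec mu Phi1) <= s * (2 * Er mu h).
  move=> s01; have /andP[s0 s1] := s01; pose c := Num.sqrt (1 - s ^+ 2).
  have cs : c ^+ 2 + s ^+ 2 = 1 by rewrite sqr_sqrtr ?subrK// subr_ge0 expr_le1// ltW.
  have inv A (mA : measurable A) := rotation_invariance jg sym cs mA.
  have mr : measurable_fun setT (pair_rot c s : E * E -> E * E) := measurable_rot c s.
  have hr := mom_push mr inv h0.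
  have Er0 := Ec_push mr inv h0.
  have hs1 : mom mu (fun t => s%:C * Phi1 t) by mtac.
  have hd : mom mu (fun t => Phi (pair_rot c s t) - Phi t) by mtac.
  have := Ec_norm_le (momB hd hs1) (rmomM (rmom_cst mu (s ^+ 2)) hh) (fun t => hb c s t cs (sqrtr_ge0 _) s01).
  rewrite EcB// EcB// Er0 subrr sub0r EcZ// normcN normcM ErZ//.
  rewrite normc_real gtr0_norm// expr2 mulrCA -mulrA.
  by rewrite ler_pM2l// mulrCA.
have E0 := normc_ge0' (Ec mu Phi1).
apply: Normc.eq0_normc; apply/eqP; rewrite eq_le E0 andbT leNgt; apply/negP => pos.
set e := normc _ in key E0 pos.
have H0 : 0 <= 2 * Er mu h.
  by have := key 1; rewrite ltr01 lexx mul1r => /(_ isT); lra.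
set H := 2 * Er mu h in key H0.
have d0 : 0 < e + H + 1 by lra.
(* If e > 0, this choice of s lies in ]0, 1] and makes s H smaller than e. *)
have := key (e / (2 * (e + H + 1))).
rewrite divr_gt0//; last lra.
rewrite ler_pdivrMr; last lra.
have -> : e <= 1 * (2 * (e + H + 1)) by lra.
move=> /(_ isT).
rewrite mulrAC ler_pdivlMr; last lra.
by nra.
Qed.

(** * Moments of the resolvent of a Gaussian matrix *)

Section resolvent_moments.
Variables (u z : C) (dl : R).
Hypothesis hd : dir u z dl.
Local Notation Q := (fun x : E => resolv z (Wm x)).

Local Notation Q1 t := (resolv z (W1 t)).

Lemma mommx_Q : mommx nu Q. Proof. exact: (mommx_resolv hd mommx_Wm). Qed.
Let mQ := mommx_Q.
Let mQ1 : mommx mu (fun t => resolv z (W1 t)) := mommx_fst mommx_Q.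

(** The rotation derivative of tr (Q(W) V F W^H B). The derivative turns V into -W and W^H into V^H,
    and differentiating Q gives the last term; the single factor V makes the result start with a
    covariance. *)
Lemma ibp_pair (F : 'M[C]_N) (B : 'M[C]_n) :
  Ec mu (fun t =>
    \tr (Q1 t *m W2 t *m F *m (W2 t)^H *m B) - \tr (Q1 t *m W1 t *m F *m (W1 t)^H *m B)
    - \tr (Q1 t *m (W2 t *m (W1 t)^H + W1 t *m (W2 t)^H) *m Q1 t *m W2 t *m F *m (W1 t)^H *m B)) = 0.
Proof.
have [k k0 hk] := resolv_jet hd n N.
pose q t := resolv z (W1 t).
pose X t := q t *m W2 t *m F *m (W1 t)^H *m B.
pose K := 6 * (6 * (6 * (6 * (k * 1) * nrm F) * 1) * nrm B) * Num.sqrt n%:R.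
apply: (rotation_derivative (Phi := fun t => \tr (X t)) (h := fun t => K * rho t ^+ 6)).
- by rewrite /X /q; mtac.
- by mtac.
- by have hr := rmom_rho; mtac.
move=> c s t cs c0 s01; have /andP[s0 s1] := s01.
have r1 := rho_ge1 t; have r0 : 0 <= rho t by lra.
have s01' : 0 <= s <= 1 by rewrite ltW.
have j1 := hk (W1 t) (W2 t) c s (rho t) cs c0 s01 r1 (W1_rho t) (W2_rho t).
have j2 := jet_rot cs c0 s01 (W2_rho t) (_ : nrm (- W1 t) <= rho t).
have {}j2 := j2 (eq_ind_r (fun x => x <= rho t) (W1_rho t) (nrmN _)).
have j3 := jet_adj (jet_rot cs c0 s01 (W1_rho t) (W2_rho t)).
have J := jetM s01' (jetM s01' (jetM s01' (jetM s01' j1 j2) (jet_cst s F)) j3) (jet_cst s B).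
move: J; rewrite -W1_rot -W2_rot => -[_ _ _ J].
rewrite -/(q t) in J.
set X1 := (X in s%:C *: X) in J.
have EX : \tr X1 = \tr (q t *m W2 t *m F *m (W2 t)^H *m B) - \tr (q t *m W1 t *m F *m (W1 t)^H *m B)
    - \tr (q t *m (W2 t *m (W1 t)^H + W1 t *m (W2 t)^H) *m q t *m W2 t *m F *m (W1 t)^H *m B).
  by rewrite /X1 /q jet_shape !raddfB.
clearbody X1.
rewrite [X in normc X](_ : _ = \tr (X (pair_rot c s t) - X t - s%:C *: X1)); last first.
  by rewrite -tr_combo EX.
have := normc_trM (X (pair_rot c s t) - X t - s%:C *: X1) 1%:M.
rewrite mulmx1 => h; apply: (le_trans h); rewrite [nrm 1%:M]/nrm fro21.
apply: (le_trans (ler_wpM2r (sqrtr_ge0 _) J)).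
by rewrite /K le_eqVlt; apply/orP; left; apply/eqP; ring.
Qed.

(** [ibp_pair] averaged over V at fixed W. The first term gives [Kop F]; in the last one, V (W^H Q)
    V has mean zero by circularity, and V^H Q V has mean [Ktop (Q x)]. *)
Lemma integration_by_parts (F : 'M[C]_N) (B : 'M[C]_n) :
  Ec nu (fun x => \tr (Q x *m Wm x *m (1%:M + Ktop (Q x)) *m F *m (Wm x)^H *m B)) =
  \tr (Emx nu Q *m Kop F *m B).
Proof.
have mK : mommx nu (fun x => Ktop (Q x)).
  by move=> j k; rewrite (_ : (fun x => _) = fun x => \tr (Q x *m Bcov j k)); [mtac|
    apply/funext => x; exact: Ktop_entry].
have h := ibp_pair F B.
have E1 : Ec mu (fun t =>
    \tr (Q1 t *m W2 t *m F *m (W2 t)^H *m B) - \tr (Q1 t *m W1 t *m F *m (W1 t)^H *m B)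
    - \tr (Q1 t *m (W2 t *m (W1 t)^H + W1 t *m (W2 t)^H) *m Q1 t *m W2 t *m F *m (W1 t)^H *m B)) =
  Ec nu (fun x => \tr (Q x *m Kop F *m B) - \tr (Q x *m Wm x *m F *m (Wm x)^H *m B)
     - \tr (Q x *m Wm x *m Ktop (Q x) *m F *m (Wm x)^H *m B)).
  apply: Ec_fubini; [by mtac|by mtac|by move=> x; rewrite /W1 /W2/=; mtac|].
  move=> x; rewrite /W1 /W2/=; set q := resolv z _; set w := Wm x.
  rewrite EcB; [|by mtac..]; rewrite EcB; [|by mtac..]; congr (_ - _ - _).
    rewrite Ec_tr; last by mtac.
    congr (\tr _); rewrite EmxMr; last by mtac.
    congr (_ *m _); rewrite /Kop -EmxMl; last by mtac.
    by apply: eq_Emx => y; rewrite !mulmxA.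
    exact: Ec_cst.
  rewrite Ec_tr; last by mtac.
  congr (\tr _).
  rewrite (eq_Emx nu (G := fun y => q *m (Wm y *m (w^H *m q) *m Wm y) *m (F *m w^H *m B)
    + (q *m w) *m ((Wm y)^H *m q *m Wm y) *m (F *m w^H *m B))); last first.
    by move=> y; rewrite mulmxDr !mulmxDl !mulmxA.
  rewrite EmxD; [|by mtac..].
  rewrite !EmxMr; [|by mtac..]; rewrite !EmxMl; [|by mtac..].
  by rewrite EVXV mulmx0 mul0mx add0r /Ktop !mulmxA.
rewrite E1 in h.
have mm1 : mom nu (fun x => \tr (Q x *m Kop F *m B)) by mtac.
have mm2 : mom nu (fun x => \tr (Q x *m Wm x *m F *m (Wm x)^H *m B)) by mtac.
have mm3 : mom nu (fun x => \tr (Q x *m Wm x *m Ktop (Q x) *m F *m (Wm x)^H *m B)) by mtac.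
rewrite EcB in h; [|exact: momB|by []].
rewrite EcB in h; [|by []..].
rewrite (eq_Ec nu (G := fun x => \tr (Q x *m Wm x *m F *m (Wm x)^H *m B) +
   \tr (Q x *m Wm x *m Ktop (Q x) *m F *m (Wm x)^H *m B))); last first.
  by move=> x; rewrite mulmxDr mulmx1 !mulmxDl raddfD.
rewrite EcD// -EmxMr// -EmxMr; last by mtac.
rewrite -Ec_tr; last by mtac.
by move: h => /eqP; rewrite -addrA -opprD subr_eq0 => /eqP ->.
Qed.

(** The product of the squared operator bounds of W^H Q and of Q. *)
Let Kc : R := (dl^-1 + normc z * dl^-2) * dl^-2.

Section concentration.
Variable B : 'M[C]_n.
(** [G1] and [G2] are the holomorphic and antiholomorphic parts of the gradient of [f], up to sign,
    and [xi] is minus the derivative of [f] at W in the direction V. *)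
Let f x := \tr (Q x *m B).
Let G1 x := (Wm x)^H *m Q x *m B *m Q x.
Let G2 x := Q x *m B *m Q x *m Wm x.
Let xi t := \tr (Q1 t *m (W2 t *m (W1 t)^H + W1 t *m (W2 t)^H) *m Q1 t *m B).

Lemma mom_f : mom nu f. Proof. by rewrite /f; mtac. Qed.

Lemma fro2_G1 x : fro2 (G1 x) <= Kc * fro2 B.
Proof.
have [_ _ dl0 _] := hd.
have [_ o _ _ o'] := resolvP hd (Wm x).
rewrite /G1 -!nrm2 -2!mulmxA; apply: (@le_trans _ _ ((Num.sqrt (dl^-1 + normc z * dl^-2) * (dl^-1 * nrm B)) ^+ 2)).
  rewrite lerXn2r ?nnegrE ?mulr_ge0 ?sqrtr_ge0 ?invr_ge0 ?(ltW dl0)//.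
  rewrite mulmxA (le_trans (opb_nrm _ o'))// ler_wpM2l ?sqrtr_ge0//.
  exact: opb_nrmr.
rewrite !exprMn sqr_sqrtr; last by rewrite addr_ge0 ?mulr_ge0 ?exprn_ge0 ?invr_ge0 ?(ltW dl0)// exprn_ge0// ltW.
by rewrite /Kc exprVn; lra.
Qed.

Lemma fro2_G2 x : fro2 (G2 x) <= Kc * fro2 B.
Proof.
have [_ _ dl0 _] := hd.
have [_ o _ _ _] := resolvP hd (Wm x).
have o' := resolv_opbW (Wm x) hd.
rewrite /G2 -!nrm2 -!mulmxA; apply: (@le_trans _ _ ((dl^-1 * (Num.sqrt (dl^-1 + normc z * dl^-2) * nrm B)) ^+ 2)).
  rewrite lerXn2r ?nnegrE ?mulr_ge0 ?sqrtr_ge0 ?invr_ge0 ?(ltW dl0)//.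
  rewrite (le_trans (opb_nrm _ o))// ler_wpM2l ?invr_ge0 ?(ltW dl0)//.
  exact: opb_nrmr.
rewrite !exprMn sqr_sqrtr; last by rewrite addr_ge0 ?mulr_ge0 ?exprn_ge0 ?invr_ge0 ?(ltW dl0)// exprn_ge0// ltW.
by rewrite /Kc exprVn; lra.
Qed.

Lemma xi_split t : xi t = \tr (G1 t.1 *m W2 t) + Num.conj (\tr ((G2 t.1)^H *m W2 t)).
Proof.
rewrite -tr_adj adjM adjK /xi /G1 /G2 mulmxDr !mulmxDl raddfD/=; congr (_ + _).
  by rewrite -!mulmxA [LHS]mxtrace_mulC -!mulmxA [LHS]mxtrace_mulC -!mulmxA.
by rewrite -!mulmxA [LHS]mxtrace_mulC -!mulmxA [LHS]mxtrace_mulC -!mulmxA.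
Qed.

Lemma mom_xi : mom mu xi. Proof. by rewrite /xi; mtac. Qed.

Lemma n2D_sqr (a b : C) : n2 (a + b) ^+ 2 <= 8 * (n2 a ^+ 2 + n2 b ^+ 2).
Proof.
apply: (@le_trans _ _ ((2 * n2 a + 2 * n2 b) ^+ 2)).
  by apply: expr_mono => //; exact: n2D.
by have := sqr_ge0 (n2 a - n2 b); lra.
Qed.

(** At fixed W, [xi] is the sum of a linear and an antilinear Gaussian form in V, whose coefficients
    have Frobenius norm bounded uniformly in W. The bound is therefore obtained conditionally on W;
    64 is 8 times 4 + 4. *)
Lemma fourth_xi : Er mu (fun t => n2 (xi t) ^+ 2) <= 64 * k4 * (eta * (Kc * fro2 B)) ^+ 2.
Proof.
have hxi := mom_xi.
have mG1 x : mom nu (fun y => \tr (G1 x *m Wm y)) by mtac.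
have mG2 x : mom nu (fun y => \tr ((G2 x)^H *m Wm y)) by mtac.
apply: Er_fubini_le; first by mtac.
- move=> x; rewrite (_ : (fun y => _) = fun y => n2 (\tr (G1 x *m Wm y) + Num.conj (\tr ((G2 x)^H *m Wm y))) ^+ 2).
    by have := mG1 x; have := mG2 x => h1 h2; mtac.
  by apply/funext => y; rewrite xi_split.
- by move=> t; exact: sqr_ge0.
move=> x; apply: (@le_trans _ _ (Er nu (fun y => 8 * (n2 (\tr (G1 x *m Wm y)) ^+ 2 + n2 (\tr ((G2 x)^H *m Wm y)) ^+ 2)))).
  have h1 := mG1 x; have h2 := mG2 x.
  apply: Er_le; [|by mtac|].
    rewrite (_ : (fun y => _) = fun y => n2 (\tr (G1 x *m Wm y) + Num.conj (\tr ((G2 x)^H *m Wm y))) ^+ 2); first by mtac.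
    by apply/funext => y; rewrite xi_split.
  by move=> y; rewrite xi_split (le_trans (n2D_sqr _ _))// n2J.
have r1 : rmom nu (fun y => n2 (\tr (G1 x *m Wm y)) ^+ 2) by have h1 := mG1 x; mtac.
have r2 : rmom nu (fun y => n2 (\tr ((G2 x)^H *m Wm y)) ^+ 2) by have h2 := mG2 x; mtac.
rewrite (ErZ _ (rmomD r1 r2)) (ErD r1 r2).
have key G : fro2 G <= Kc * fro2 B -> Er nu (fun y => n2 (\tr (G *m Wm y)) ^+ 2) <= 4 * k4 * (eta * (Kc * fro2 B)) ^+ 2.
  move=> hG; apply: (le_trans (fourth_trace G)); rewrite ler_wpM2l ?mulr_ge0//.
  have h0 : 0 <= Kc * fro2 B := le_trans (fro2_ge0 _) hG.
  by apply: expr_mono; [exact: mulr_ge0|exact: ler_wpM2l].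
have a1 := key _ (fro2_G1 x).
have a2 : Er nu (fun y => n2 (\tr ((G2 x)^H *m Wm y)) ^+ 2) <= 4 * k4 * (eta * (Kc * fro2 B)) ^+ 2.
  by apply: key; rewrite [fro2 _]fro2_adj fro2_G2.
set X := _ * k4 * _ in a1 a2.
rewrite [leRHS](_ : _ = 8 * (X + X)); last by rewrite /X; ring.
apply: ler_wpM2l; [exact: ler0n|exact: (lerD a1 a2)].
Qed.

Let diff c s t := f (pair_rot c s t).1 - f t.1.

Lemma rmom_diff c s : c ^+ 2 + s ^+ 2 = 1 -> mom mu (diff c s).
Proof.
move=> cs; have inv A (mA : measurable A) := rotation_invariance jg sym cs mA.
have mr : measurable_fun setT (pair_rot c s : E * E -> E * E) := measurable_rot c s.
have m3 : mom mu (fun t => f t.1) by rewrite /f -/(W1 _); mtac.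
exact: (momB (mom_push mr inv m3) m3).
Qed.

(** A single rotation of angle with sine s costs 8 s^4 E |xi|^4, up to the remainder of
    [resolv_jet]. [H] depends on the dimension, but its factor s^8 beats the K^4 lost in adding up K
    rotations. *)
Lemma fourth_diff : exists2 H, 0 <= H & forall c s, c ^+ 2 + s ^+ 2 = 1 -> 0 <= c -> 0 < s <= 1 ->
  Er mu (fun t => n2 (diff c s t) ^+ 2) <= 8 * (s ^+ 4 * Er mu (fun t => n2 (xi t) ^+ 2) + s ^+ 8 * H).
Proof.
have [k k0 hk] := resolv_jet hd n N.
pose h t := k * rho t ^+ 4 * nrm B.
have hr := rmom_rho; have mh : rmom mu (fun t => h t ^+ 4) by rewrite /h; mtac.
have h0 t : 0 <= h t by rewrite /h mulr_ge0// mulr_ge0// exprn_ge0// (le_trans ler01)// rho_ge1.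
exists (Er mu (fun t => h t ^+ 4)); first by apply: Er_ge0 => t; rewrite exprn_ge0.
move=> c s cs c0 s01; have /andP[s0 s1] := s01.
have hxi := mom_xi; have hdf := rmom_diff cs.
have mx : rmom mu (fun t => n2 (xi t) ^+ 2) by mtac.
have mx4 := rmomM (rmom_cst mu (s ^+ 4)) mx; have mh8 := rmomM (rmom_cst mu (s ^+ 8)) mh.
have md := rmomX 2 (rmom_n2 hdf).
rewrite -(ErZ _ mx) -(ErZ _ mh) -(ErD mx4 mh8) -(ErZ _ (rmomD mx4 mh8)).
apply: (Er_le md (rmomM (rmom_cst mu 8) (rmomD mx4 mh8))) => t.
have j := hk (W1 t) (W2 t) c s (rho t) cs c0 s01 (rho_ge1 t) (W1_rho t) (W2_rho t).
move: j; rewrite -W1_rot => -[_ _ _ j].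
set X1 := (X in s%:C *: X) in j.
have eX : \tr (X1 *m B) = - xi t by rewrite /X1 mulNmx raddfN.
clearbody X1.
set Y := _ - _ - _ in j.
have e : diff c s t = \tr (Y *m B) + s%:C * (- xi t).
  rewrite -eX /Y !mulmxBl -scalemxAl -tr_combo subrK.
  by rewrite /diff /f /W1.
rewrite e (le_trans (n2D_sqr _ _))// ler_wpM2l// addrC lerD//.
  by rewrite n2M n2C n2N exprMn -exprM.
have b : n2 (\tr (Y *m B)) <= (s ^+ 2 * h t) ^+ 2.
  rewrite n2E; apply: expr_mono => //.
  apply: (le_trans (normc_trM _ _)); rewrite /h mulrA ler_wpM2r//.
apply: (@le_trans _ _ (((s ^+ 2 * h t) ^+ 2) ^+ 2)).
  by apply: expr_mono.
by rewrite -exprM exprMn -exprM.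
Qed.

Lemma pair_rot_comp a b (t : E * E) :
  (pair_rot (cos b) (sin b) (pair_rot (cos a) (sin a) t)).1 = (pair_rot (cos (a + b)) (sin (a + b)) t).1.
Proof. by apply/funext => j /=; rewrite cosD sinD; ring. Qed.

(* W is turned into V in K rotations of angle pi / (2 K), whose increments have
   the same law; the bound is the limit K -> oo. *)
Lemma fourth_copy : Er mu (fun t => n2 (f t.2 - f t.1) ^+ 2) <= 128 * Er mu (fun t => n2 (xi t) ^+ 2).
Proof.
have [H H0 hH] := fourth_diff.
have Xi0 : 0 <= Er mu (fun t => n2 (xi t) ^+ 2) by apply: Er_ge0 => t; exact: sqr_ge0.
have H20 : 0 <= 128 * (16 * H) by apply: mulr_ge0 => //; exact: mulr_ge0.
apply: (ler_of_inv_nat H20).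
move=> K K0; have K0' : 0 < K%:R :> R by rewrite ltr0n.
pose th : R := pi / 2 / K%:R.
have /andP[p0 p2] := @pihalf_02 R.
have th0 : 0 < th by rewrite divr_gt0.
have th2 : th <= 2 / K%:R by rewrite ler_wpM2r ?invr_ge0 ?ltW.
have K1 : 1 <= K%:R :> R by rewrite ler1n.
have thp : th <= pi / 2 by rewrite ler_pdivrMr//; apply: ler_peMr => //; exact: ltW.
have s0 : 0 < sin th by apply: sin_gt0_pi; rewrite th0/= (le_lt_trans thp)//; lra.
have c0 : 0 <= cos th by apply: cos_ge0_pihalf; rewrite thp andbT; lra.
have s2 : sin th <= 2 / K%:R by rewrite (le_trans _ th2)// sin_le_id// ltW.
have s01 : 0 < sin th <= 1 by rewrite s0 sin_le1.
have cs := cos2Dsin2 th.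
pose phi j := pair_rot (cos (j%:R * th)) (sin (j%:R * th)) : E * E -> E * E.
pose g j t := f (phi j t).1.
have g0 t : g 0%N t = f t.1.
  by rewrite /g /phi mul0r cos0 sin0; congr f; apply/funext => a /=; rewrite mul1r mul0r addr0.
have gK t : g K t = f t.2.
  rewrite /g /phi (_ : K%:R * th = pi / 2) ?cos_pihalf ?sin_pihalf; last by rewrite mulrC divfK// gt_eqF.
  by congr f; apply/funext => a /=; rewrite mul1r mul0r add0r.
have gS j t : g j.+1 t - g j t = diff (cos th) (sin th) (phi j t).
  by rewrite /diff /g /phi pair_rot_comp -natr1 mulrDl mul1r.
have mr j : measurable_fun setT (phi j) := measurable_rot _ _.
have inv j A (mA : measurable A) : mu (phi j @^-1` A) = mu A := rotation_invariance jg sym (cos2Dsin2 _) mA.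
have hdf := rmom_diff cs.
have md : rmom mu (fun t => n2 (diff (cos th) (sin th) t) ^+ 2) by mtac.
have md' (j : 'I_K) : rmom mu (fun t => n2 (diff (cos th) (sin th) (phi j t)) ^+ 2) by exact: (rmom_push (mr j) (inv j) md).
have mf2 : mom mu (fun t => f t.2) by rewrite /f -/(W2 _); have := mommx_snd mommx_Q => h; mtac.
have mf1 : mom mu (fun t => f t.1) by rewrite /f -/(W1 _); mtac.
apply: (@le_trans _ _ (Er mu (fun t => K%:R ^+ 3 * \sum_(j < K) n2 (diff (cos th) (sin th) (phi j t)) ^+ 2))).
  have l1 := rmomX 2 (rmom_n2 (momB mf2 mf1)).
  have l2 := rmomM (rmom_cst mu (K%:R ^+ 3)) (rmom_sum (index_enum _) xpredT md').
  apply: (Er_le l1 l2) => t; rewrite -g0 -gK (_ : g K t - g 0%N t = \sum_(j < K) diff (cos th) (sin th) (phi j t)); first exact: n2_sum_sqr.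
  by under eq_bigr do rewrite -gS; rewrite -(big_mkord xpredT (fun j => g j.+1 t - g j t)) telescope_sumr.
rewrite (ErZ _ (rmom_sum (index_enum _) xpredT md')) (Er_sum _ _ md').
rewrite (eq_bigr (fun=> Er mu (fun t => n2 (diff (cos th) (sin th) t) ^+ 2))); last first.
  by move=> j _; exact: (Er_push (mr j) (inv j) md.1).
rewrite sumr_const card_ord -(mulr_natl (Er _ _) K) mulrA -exprSr.
have h := hH _ _ cs c0 s01.
apply: (le_trans (ler_wpM2l (_ : 0 <= K%:R ^+ 4) h)); first by rewrite exprn_ge0// ltW.
set s := sin th in s0 s2 *; set X := Er _ _ in Xi0 *.
(* K sin th <= 2 because pi / 2 <= 2; the resulting 16 and the factor 8 of one step make the
   constant 128. *)
have Ks : K%:R ^+ 4 * s ^+ 4 <= 16.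
  rewrite -exprMn (_ : 16 = 2 ^+ 4 :> R); last by ring.
  apply: expr_mono; first by rewrite mulr_ge0// ltW.
  by rewrite mulrC -ler_pdivlMr.
have s4 : s ^+ 4 <= 16 / K%:R.
  rewrite ler_pdivlMr// (le_trans _ Ks)// mulrC ler_wpM2r ?exprn_ge0 ?(ltW s0)//.
  by rewrite ler_eXnr// ler1n.
have -> : K%:R ^+ 4 * (8 * (s ^+ 4 * X + s ^+ 8 * H)) = 8 * (K%:R ^+ 4 * s ^+ 4 * X) + 8 * (K%:R ^+ 4 * s ^+ 4 * (s ^+ 4 * H)).
  by rewrite (_ : s ^+ 8 = s ^+ 4 * s ^+ 4); [ring|rewrite -exprD].
have b1 : K%:R ^+ 4 * s ^+ 4 * X <= 16 * X by rewrite ler_wpM2r.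
have s40 : 0 <= s ^+ 4 by rewrite exprn_ge0 ?ltW.
have b2 : K%:R ^+ 4 * s ^+ 4 * (s ^+ 4 * H) <= 16 * (16 / K%:R * H).
  have K40 : 0 <= K%:R ^+ 4 :> R by rewrite exprn_ge0// ltW.
  by apply: ler_pM; [exact: mulr_ge0|exact: mulr_ge0|exact: Ks|exact: ler_wpM2r].
have -> : 128 * (16 * H) / K%:R = 128 * (16 / K%:R * H) by rewrite -!mulrA [H * _]mulrC.
exact: combine_bounds.
Qed.

(** f(x) - E f is an average of f(x) - f(y) over an independent y, so Jensen's inequality bounds the
    centred moment by that of the difference of two copies. *)
Lemma concentration4 : Er nu (fun x => n2 (f x - Ec nu f) ^+ 2) <= 128 * (64 * k4) * (eta * (Kc * fro2 B)) ^+ 2.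
Proof.
have mf := mom_f.
have mf2 : mom mu (fun t => f t.2) by rewrite /f -/(W2 _); have := mommx_snd mommx_Q => h; mtac.
have mf1 : mom mu (fun t => f t.1) by rewrite /f -/(W1 _); mtac.
have me (x : E) : mom nu (fun y => f y - f x) := momB mf (mom_cst nu (f x)).
apply: (@le_trans _ _ (Er mu (fun t => n2 (f t.2 - f t.1) ^+ 2))).
  have r1 := rmomX 2 (rmom_n2 (momB mf2 mf1)).
  have r2 := rmomX 2 (rmom_n2 (momB mf (mom_cst nu (Ec nu f)))).
  have r3 x := rmomX 2 (rmom_n2 (me x)).
  apply: (Er_fubini_ge r1 r2 r3) => [t|x|x]; [exact: sqr_ge0|exact: sqr_ge0|].
  have h := me x.
  have e : Ec nu (fun y => f y - f x) = Ec nu f - f x.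
    exact: (etrans (EcB mf (mom_cst nu (f x))) (congr1 (fun y => Ec nu f - y) (Ec_cst nu (f x)))).
  rewrite -n2N opprB -e.
  apply: (le_trans _ (Er_sqr (rmom_n2 h))); apply: expr_mono => //.
  exact: Ec_n2.
by apply: (le_trans fourth_copy); have := fourth_xi; lra.
Qed.

Lemma concentration2 : Er nu (fun x => n2 (f x - Ec nu f)) <= Num.sqrt (128 * (64 * k4)) * (eta * (Kc * fro2 B)).
Proof.
have mf := mom_f.
have [_ _ dl0 _] := hd.
have Kc0 : 0 <= Kc.
  have i1 : 0 <= dl^-1 by rewrite invr_ge0 ltW.
  have i2 : 0 <= dl^-2 by rewrite invr_ge0 exprn_ge0// ltW.
  by apply: mulr_ge0 => //; apply: addr_ge0 => //; exact: mulr_ge0.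
have h := rmom_n2 (momB mf (mom_cst nu (Ec nu f))).
have a0 : 0 <= Er nu (fun x => n2 (f x - Ec nu f)) by exact: Er_ge0.
have b0 : 0 <= Num.sqrt (128 * (64 * k4)) * (eta * (Kc * fro2 B)).
  by apply: mulr_ge0; [exact: sqrtr_ge0|apply: mulr_ge0 => //; exact: mulr_ge0].
rewrite -(@ler_pXn2r _ 2)//.
apply: (le_trans (Er_sqr h)); rewrite exprMn sqr_sqrtr; last by apply: mulr_ge0; [exact: ler0n|apply: mulr_ge0 => //; exact: ler0n].
exact: concentration4.
Qed.

End concentration.

Lemma KopZ a X : Kop (a *: X) = a *: Kop X.
Proof.
rewrite -[RHS]mul_scalar_mx /Kop -EmxMl; last by mtac.
by apply: eq_Emx => x; rewrite mul_scalar_mx -scalemxAr -scalemxAl.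
Qed.

Lemma Bcov_duality b k : \sum_a \sum_j n2 (Bcov j k b a) <= eta * Er nu (fun v => n2 (Wm v b k)).
Proof.
set s := \sum_a _; set e := Er _ _.
pose G : 'M[C]_(N, n) := \matrix_(j, a) Bcov j k b a.
have sG : fro2 G = s by rewrite /fro2 exchange_big/=; do 2 (apply: eq_bigr => ? _); rewrite mxE.
have s0 : 0 <= s by rewrite -sG.
have e0 : 0 <= e by exact: Er_ge0.
have mG : mom nu (fun v => Num.conj (\tr (G *m Wm v))) by mtac.
have mb : mom nu (fun v => Wm v b k) by mtac.
have E1 : Ec nu (fun v => Wm v b k * Num.conj (\tr (G *m Wm v))) = s%:C.
  have m3 a j : mom nu (fun v => Num.conj (Wm v a j) * Wm v b k) by mtac.
  have m4 a j := momM (mom_cst nu (Num.conj (Bcov j k b a))) (m3 a j).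
  rewrite (eq_Ec nu (G := fun v => \sum_a \sum_j Num.conj (Bcov j k b a) * (Num.conj (Wm v a j) * Wm v b k))); last first.
    move=> v; rewrite /mxtrace cj_sum mulr_sumr exchange_big/=; apply: eq_bigr => j _.
    rewrite [(G *m Wm v) j j]mxE cj_sum mulr_sumr; apply: eq_bigr => a _.
    by rewrite [G j a]mxE cjM; ring.
  rewrite Ec_sum; last by move=> a; exact: mom_sum.
  rewrite /s rmorph_sum; apply: eq_bigr => a _; rewrite Ec_sum; last by move=> j; exact: m4.
  rewrite rmorph_sum; apply: eq_bigr => j _; rewrite (EcZ _ (m3 a j)).
  transitivity ((n2 (Bcov j k b a))%:C); last by [].
  by rewrite -mulCJ mulrC; congr (_ * _); rewrite [RHS]mxE.
have h := Ec_CS mb mG; rewrite E1 n2C in h.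
have h2 : Er nu (fun v => n2 (Num.conj (\tr (G *m Wm v)))) <= eta * s.
  by rewrite -sG (eq_Er nu (g := fun v => n2 (\tr (G *m Wm v)))) // => v; rewrite n2J.
have h3 := le_trans h (ler_wpM2l e0 h2).
have [->|s1] := eqVneq s 0; first exact: mulr_ge0.
have sp : 0 < s by rewrite lt0r s1.
by move: h3; rewrite expr2 mulrA ler_pM2r// mulrC.
Qed.

Lemma mean_fro2_adj m (X : 'M[C]_(n, m)) : Er nu (fun v => fro2 ((Wm v)^H *m X)) <= kap * fro2 X.
Proof.
rewrite (eq_Er nu (g := fun v => \sum_j fro2 ((Wm v)^H *m col j X))); last first.
  by move=> v; rewrite fro2_col; apply: eq_bigr => j _; rewrite !colE mulmxA.
rewrite Er_sum; last by move=> j; mtac.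
by rewrite [in leRHS]fro2_col mulr_sumr; apply: ler_sum => j _; exact: h_kapl.
Qed.

(** Bounding each [Bcov] separately would lose the factor [eta]; summing the duality bound over b
    and k leaves eta E |V|_F^2, and E |V|_F^2 <= kap n. *)
Lemma sum_Bcov : \sum_j \sum_k fro2 (Bcov j k) <= eta * (kap * n%:R).
Proof.
have mb b k : rmom nu (fun v => n2 (Wm v b k)) by mtac.
apply: (@le_trans _ _ (eta * Er nu (fun v => fro2 (Wm v)))).
  rewrite /fro2 Er_sum; last by move=> b; exact: rmom_sum.
  rewrite mulr_sumr; under [leRHS]eq_bigr => b _ do rewrite Er_sum// mulr_sumr.
  rewrite [leRHS]exchange_big/= [leLHS]exchange_big/=; apply: ler_sum => k _.
  rewrite exchange_big/=; apply: ler_sum => b _.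
  by rewrite exchange_big/=; exact: Bcov_duality.
rewrite ler_wpM2l// -(fro21 R n).
apply: le_trans (mean_fro2_adj 1%:M); apply: Er_le; [by mtac|by mtac|].
by move=> v; rewrite mulmx1 fro2_adj.
Qed.

Let EQ := Emx nu Q.
Let F := invmx (1%:M + Ktop EQ).
Let Rt := - z^-1 *: F.
Let Rr := - z^-1 *: invmx (1%:M + Kop Rt).

Lemma pos_EQ : pos u z EQ.
Proof. by split; apply: accr_Emx => // t; have [_ _ [p1 p2] _ _] := resolvP hd (Wm t). Qed.

Lemma pos_Ktop X : pos u z X -> pos u z (Ktop X).
Proof. by case=> p1 p2; split; exact: Ktop_accr. Qed.
Lemma pos_Kop X : pos u z X -> pos u z (Kop X).
Proof. by case=> p1 p2; split; exact: Kop_accr. Qed.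

(** Integration by parts with F the inverse of 1 + Kt(E Q) and test matrix Rr A. The deterministic
    part of Kt(Q) then cancels against F and reproduces the fixed-point equation; what is left
    contains only Kt(Q - E Q). *)
Lemma master_identity A : \tr ((EQ - Rr) *m A) =
  Ec nu (fun x => \tr (Q x *m Wm x *m Ktop (Q x - EQ) *m F *m (Wm x)^H *m (Rr *m A))).
Proof.
have z0 := dir_neq0 hd.
have [uF oRt pRt eRt] := pos_fix hd (pos_Ktop pos_EQ).
have [uR oR pR eR] := pos_fix hd (pos_Kop pRt).
rewrite -/F -/Rt in oRt pRt eRt; rewrite -/F -/Rt -/Rr in uR oR pR eR.
have FE : (1%:M + Ktop EQ) *m F = 1%:M by rewrite mulmxV.
have KF : Kop F = - z *: Kop Rt.
  by rewrite -(KopZ (- z) Rt); congr Kop; exact: scale_neg_inv z0 F.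
have mK : mommx nu (fun x => Ktop (Q x - EQ)).
  by move=> j k; rewrite (_ : (fun x => _) = fun x => \tr ((Q x - EQ) *m Bcov j k)); [mtac|
    apply/funext => x; exact: Ktop_entry].
have m5 : mom nu (fun x => \tr (Q x *m Wm x *m Ktop (Q x - EQ) *m F *m (Wm x)^H *m (Rr *m A))) by mtac.
have m6 : mom nu (fun x => \tr ((1%:M + z *: Q x) *m (Rr *m A))) by mtac.
have h := integration_by_parts F (Rr *m A).
rewrite (eq_Ec nu (G := fun x => \tr ((1%:M + z *: Q x) *m (Rr *m A)) +
   \tr (Q x *m Wm x *m Ktop (Q x - EQ) *m F *m (Wm x)^H *m (Rr *m A)))) in h; last first.
  move=> x; have [_ _ _ e _] := resolvP hd (Wm x); rewrite -e.
  have -> : (1%:M + Ktop (Q x)) = (1%:M + Ktop EQ) + Ktop (Q x - EQ) by rewrite KtopB -addrA; congr (_ + _); rewrite addrC subrK.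
  rewrite -[Q x *m Wm x *m _ *m F]mulmxA [(_ + Ktop (_ - _)) *m F]mulmxDl FE.
  by rewrite mulmxDr mulmx1 !mulmxDl raddfD/= !mulmxA.
rewrite (EcD m6 m5) in h.
have e6 : Ec nu (fun x => \tr ((1%:M + z *: Q x) *m (Rr *m A))) = \tr ((1%:M + z *: EQ) *m (Rr *m A)).
  have mz : mommx nu (fun x => z *: Q x) by mtac.
  rewrite Ec_tr; last by mtac.
  congr (\tr _); rewrite EmxMr; last by mtac.
  congr (_ *m _); rewrite EmxD//; last exact: mommx_cst.
  rewrite Emx_cst; congr (_ + _); rewrite -mul_scalar_mx -EmxMl//.
  by apply: eq_Emx => x; rewrite mul_scalar_mx.
rewrite e6 KF in h.
have -> : Ec nu (fun x => \tr (Q x *m Wm x *m Ktop (Q x - EQ) *m F *m (Wm x)^H *m (Rr *m A))) =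
   \tr (EQ *m (- z *: Kop Rt) *m (Rr *m A)) - \tr ((1%:M + z *: EQ) *m (Rr *m A)).
  by rewrite -h addrC addKr.
rewrite -raddfB/= -mulmxBl; congr (\tr _).
have -> : EQ *m (- z *: Kop Rt) - (1%:M + z *: EQ) = - (1%:M + EQ *m (z *: (1%:M + Kop Rt))).
  by rewrite scalerDr mulmxDr -!scalemxAr mulmx1 scaleNr -opprD addrC addrA.
rewrite [RHS]mulmxA; congr (_ *m A).
by rewrite mulNmx mulmxDl mul1mx -(mulmxA EQ) eR mulmxN mulmx1 opprD opprK addrC.
Qed.

(** The first factor comes from the variances of the traces tr (Q B_jk), the second from the mean
    square of the matrix they are paired with in [master_bound]. *)
Definition master_cst : R := Num.sqrt (128 * (64 * k4)) * Kc * kap *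
  (n2 z * dl^-2 * (dl^-1 + normc z * dl^-2) * (kap * dl^-2)).

(** The error is a sum over (j, k) of tr ((Q - E Q) B_jk) times an entry of a matrix Y. By
    Cauchy-Schwarz it is controlled by the sum of the variances, at most C eta^2 n since [eta]
    enters once through concentration and once through [sum_Bcov], and by E |Y|_F^2, at most C n. *)
Lemma master_bound A : opb 1 A ->
  n2 (\tr ((EQ - Rr) *m A)) <= master_cst * (eta * n%:R) ^+ 2.
Proof.
move=> oA; have [_ _ dl0 _] := hd.
have i1 : 0 <= dl^-1 by rewrite invr_ge0 ltW.
have i2 : 0 <= dl^-2 by rewrite invr_ge0 exprn_ge0// ltW.
have kq0 : 0 <= dl^-1 + normc z * dl^-2 by apply: addr_ge0 => //; exact: mulr_ge0.
have Kc0 : 0 <= Kc by exact: mulr_ge0.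
have z0 := dir_neq0 hd.
have [uF oRt pRt eRt] := pos_fix hd (pos_Ktop pos_EQ).
have [uR oR pR eR] := pos_fix hd (pos_Kop pRt).
rewrite -/F -/Rt in oRt pRt eRt; rewrite -/F -/Rt -/Rr in uR oR pR eR.
have oF : opb (normc z * dl^-1) F.
  rewrite (scale_neg_inv z0 F).
  by rewrite -(normcN z); exact: opbZ.
rewrite master_identity.
pose Y x := F *m (Wm x)^H *m (Rr *m A) *m (Q x *m Wm x).
have mY : mommx nu Y by rewrite /Y; mtac.
pose fB (p : 'I_N * 'I_N) x := \tr ((Q x - EQ) *m Bcov p.1 p.2).
have mfB p : mom nu (fB p) by rewrite /fB; mtac.
have mYp (p : 'I_N * 'I_N) : mom nu (fun x => Y x p.2 p.1) by mtac.
have mp p := momM (mfB p) (mYp p).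
rewrite (eq_Ec nu (G := fun x => \sum_(p : 'I_N * 'I_N) fB p x * Y x p.2 p.1)); last first.
  move=> x; transitivity (\tr (Ktop (Q x - EQ) *m Y x)).
    by rewrite /Y !mulmxA [RHS]mxtrace_mulC !mulmxA [RHS]mxtrace_mulC !mulmxA.
  rewrite /mxtrace; rewrite -(pair_bigA _ (fun j k => fB (j, k) x * Y x k j))/=.
  by apply: eq_bigr => j _; rewrite mxE; apply: eq_bigr => k _; rewrite Ktop_entry.
rewrite (Ec_sum _ _ mp).
pose k8 := Num.sqrt (128 * (64 * k4)).
have k80 : 0 <= k8 := sqrtr_ge0 _.
pose a (p : 'I_N * 'I_N) := k8 * (eta * (Kc * fro2 (Bcov p.1 p.2))).
pose b (p : 'I_N * 'I_N) := Er nu (fun x => n2 (Y x p.2 p.1)).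
have b0 p : 0 <= b p by exact: Er_ge0.
have a0 p : 0 <= a p by apply: mulr_ge0 => //; apply: mulr_ge0 => //; exact: mulr_ge0.
have ab p : n2 (Ec nu (fun x => fB p x * Y x p.2 p.1)) <= a p * b p.
  apply: (le_trans (Ec_CS (mfB p) (mYp p))); rewrite (ler_wpM2r (b0 p))//.
  have := concentration2 (Bcov p.1 p.2).
  rewrite (eq_Er nu (g := fun x => n2 (fB p x)))// => x.
  rewrite Ec_tr; last by mtac.
  by rewrite EmxMr// /fB mulmxBl raddfB.
apply: (le_trans (n2_sum_CS a0 b0 ab)).
have sa : \sum_p a p <= k8 * (eta * (Kc * (eta * (kap * n%:R)))).
  rewrite -mulr_sumr -mulr_sumr -mulr_sumr.
  rewrite ler_wpM2l// ler_wpM2l// ler_wpM2l//.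
  by rewrite -(pair_bigA _ (fun j k => fro2 (Bcov j k)))/=; exact: sum_Bcov.
pose kq := dl^-1 + normc z * dl^-2.
have sb : \sum_p b p <= n2 z * dl^-2 * kq * (kap * (dl^-2 * n%:R)).
  rewrite -(Er_sum (index_enum _) xpredT (fun p => rmom_n2 (mYp p))).
  apply: (@le_trans _ _ (Er nu (fun x => n2 z * dl^-2 * kq * fro2 ((Wm x)^H *m (Rr *m A))))).
    apply: Er_le; [by apply: rmom_sum => p; exact: rmom_n2|by mtac|].
    move=> x; rewrite -(pair_bigA _ (fun j k => n2 (Y x k j)))/= exchange_big/= -/(fro2 (Y x)).
    rewrite -!nrm2 /Y; set G := _^H *m _.
    have -> : F *m (Wm x)^H *m (Rr *m A) = F *m G by rewrite /G [RHS]mulmxA.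
    have o' := resolv_opbW (Wm x) hd.
    have h : nrm (F *m G *m (Q x *m Wm x)) <= Num.sqrt kq * (normc z * dl^-1 * nrm G).
      by rewrite (le_trans (opb_nrmr _ o'))// ler_wpM2l ?sqrtr_ge0//; exact: opb_nrm.
    apply: (le_trans (expr_mono 2 (nrm_ge0 _) h)); rewrite !exprMn (sqr_sqrtr kq0) -n2E exprVn.
    by rewrite le_eqVlt; apply/orP; left; apply/eqP; rewrite /kq; ring.
  have m0 : rmom nu (fun x => fro2 ((Wm x)^H *m (Rr *m A))) by mtac.
  rewrite (ErZ _ m0); apply: ler_wpM2l; first by apply: mulr_ge0 => //; exact: mulr_ge0.
  apply: (le_trans (mean_fro2_adj _)); apply: ler_wpM2l => //.
  have := opb_fro (opbM oR oA); rewrite mulr1 exprVn; exact.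
have s0 (c : 'I_N * 'I_N -> R) : (forall p, 0 <= c p) -> 0 <= \sum_p c p by move=> hc; apply: sumr_ge0.
apply: (le_trans (ler_pM (s0 _ a0) (s0 _ b0) sa sb)).
by rewrite /master_cst -/k8 -/kq le_eqVlt; apply/orP; left; apply/eqP; ring.
Qed.

End resolvent_moments.
End gaussian_matrix.

(** * Block indices and Fourier coefficients *)

Section block_indices.
Variables (R : realType) (M L : nat).
Local Notation n := (blockdim M L).
Local Notation C := R[i].

Lemma blockdimE : n = (M * L)%N.
Proof. by rewrite /blockdim sum_nat_const card_ord. Qed.

Definition bm (a : 'I_n) : 'I_M := @tagnat.sig1 M (fun=> L) a.
Definition bi (a : 'I_n) : 'I_L := @tagnat.sig2 M (fun=> L) a.
Definition bk (m : 'I_M) (i : 'I_L) : 'I_n := @tagnat.Rank M (fun=> L) m i.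

Lemma bkK a : bk (bm a) (bi a) = a. Proof. exact: tagnat.sig2K. Qed.
Lemma bm_bk m i : bm (bk m i) = m. Proof. exact: tagnat.Rank1K. Qed.
Lemma bi_bk m i : bi (bk m i) = i.
Proof. by apply: val_inj; rewrite /bi /bk /= tagnat.Rank2K. Qed.

Lemma sum_block (V : nmodType) (F : 'I_n -> V) : \sum_a F a = \sum_m \sum_i F (bk m i).
Proof.
rewrite pair_bigA/= (reindex (fun p : 'I_M * 'I_L => bk p.1 p.2))//=.
exists (fun a => (bm a, bi a)) => [[m i] _|a _] /=; first by rewrite bm_bk bi_bk.
exact: bkK.
Qed.

Lemma WmxE N (w : 'I_M -> nat -> C) a j : Wmx L N w a j = w (bm a) (bi a + j)%N.
Proof. by rewrite !mxE. Qed.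

Lemma PsiE N (S : 'I_M -> R -> R) (X : 'M[C]_N) a b :
  Psi L S X a b = if bm a == bm b then psi (S (bm a)) L X (bi a) (bi b) else 0.
Proof.
rewrite /Psi /mxdiag mxE -/(bm a) -/(bm b) -/(bi a) -/(bi b).
by case: eqP => _; rewrite ?conform_mx_id ?mxE.
Qed.

Lemma PsibarE N (S : 'I_M -> R -> R) (X : 'M[C]_n) j k :
  Psibar N S X j k = M%:R^-1 * \sum_m psi (S m) N (\matrix_(i, i') X (bk m i) (bk m i')) j k.
Proof.
rewrite /Psibar mxE summxE; congr (_ * _); apply: eq_bigr => m _; congr (psi _ _ _ _ _).
Qed.

End block_indices.

(** * Complex exponentials on the unit interval *)

Section exponentials.
Variable R : realType.
Local Notation C := R[i].
Notation Re := (@complex.Re R).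
Notation Im := (@complex.Im R).

Lemma expiD (x y : R) : expi (x + y) = expi x * expi y.
Proof. by apply: complexP; rewrite ?Re_mul ?Im_mul /expi/= ?cosD ?sinD; ring. Qed.
Lemma expi0 : expi 0 = 1 :> C.
Proof. by rewrite /expi cos0 sin0. Qed.
Lemma expiN (x : R) : expi (- x) = Num.conj (expi x).
Proof. by rewrite /expi cosN sinN. Qed.
Lemma expi_2pi : expi (2 * pi) = 1 :> C.
Proof. by rewrite /expi mulr_natl cos2pi sin2pi. Qed.
Lemma expi_2pi_int (k : int) : expi (2 * pi * k%:~R) = 1 :> C.
Proof.
have h (m : nat) : expi (2 * pi * m%:R) = 1 :> C.
  elim: m => [|m ih]; first by rewrite mulr0 expi0.
  by rewrite -[m.+1%:R]natr1 mulrDr mulr1 expiD ih expi_2pi mulr1.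
case: k => m; first exact: h.
by rewrite NegzE mulrNz mulrN expiN h rmorph1.
Qed.

Local Notation leb := (@lebesgue_measure R).
(** Lebesgue measure on [0, 1] seen as a probability, so that the calculus of [mom] and [Ec] applies
    to spectral integrals. *)
Definition P01 : probability (measurableTypeR R) R := uniform_prob (@ltr01 R).

Lemma Er_P01 (f : measurableTypeR R -> R) : rmom P01 f ->
  \int[leb]_(x in `[0, 1]) f x = Er P01 f.
Proof.
move=> hf; rewrite /Er /Rintegral; congr fine.
have key (g : measurableTypeR R -> \bar R) : measurable_fun setT g -> (forall x, 0 <= g x)%E ->
    (\int[P01]_x g x = \int[leb]_(x in `[0%R, 1%R]) g x)%E.
  by move=> mg g0; rewrite integral_uniform// subr0 invr1 mul1e.
have mf : measurable_fun setT (fun x => (f x)%:E) by apply/measurable_EFinP; exact: hf.1.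
rewrite [LHS]integralE [RHS]integralE; congr (_ - _)%E; rewrite key//.
  exact: measurable_funepos.
exact: measurable_funeneg.
Qed.

Lemma Ec_P01 (f g : measurableTypeR R -> C) : mom P01 g -> {in `[0, 1], f =1 g} ->
  cintegral leb `[0, 1] f = Ec P01 g.
Proof.
move=> [g1 g2] fg; apply: complexP => /=.
  rewrite -(Er_P01 g1); apply: eq_Rintegral => x; rewrite inE => hx /=.
  by rewrite fg.
rewrite -(Er_P01 g2); apply: eq_Rintegral => x; rewrite inE => hx /=.
by rewrite fg.
Qed.

Lemma mom_expi (a : R) : mom P01 (fun x => expi (a * x)).
Proof.
have ml : measurable_fun setT (fun x : measurableTypeR R => a * x) by exact: measurable_funM.
split; apply: (@rmom_bounded _ _ _ _ _ 1) => /=.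
- exact: (measurableT_comp (continuous_measurable_fun (@continuous_cos R)) ml).
- by move=> x; exact: cos_max.
- exact: (measurableT_comp (continuous_measurable_fun (@continuous_sin R)) ml).
- by move=> x; exact: sin_max.
Qed.

Lemma is_derive_linear (F f : R -> R) (a : R) : (forall y, is_derive y (1 : R) F (f y)) ->
  forall x, is_derive x (1 : R) (fun y => F (a * y)) (a * f (a * x)).
Proof.
move=> h x; have hl : is_derive x (1 : R) (fun y => a * y) a.
  by have := is_deriveZ a (is_derive_id x (1 : R)); rewrite /GRing.scale/= mulr1.
have := @is_derive1_comp R F (fun y => a * y) x _ _ (h (a * x)) hl.
by rewrite mulrC.
Qed.

Lemma Rintegral_derivative (F f : R -> R) : (forall x, is_derive x (1 : R) F (f x)) ->
  continuous f -> \int[leb]_(x in `[0, 1]) f x = F 1 - F 0.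
Proof.
move=> hF cf; rewrite /Rintegral.
rewrite (@continuous_FTC2 R f F 0 1)//.
- exact: continuous_subspaceT.
- have cF x : {for x, continuous F} by apply: differentiable_continuous; apply/derivable1_diffP.
  split; first by move=> x _; case: (hF x).
    exact/cvg_at_right_filter/cF.
  exact/cvg_at_left_filter/cF.
- by move=> x _; rewrite derive1E; case: (hF x).
Qed.

Lemma expi_orthogonal (k : int) : Ec P01 (fun x => expi (2 * pi * x * k%:~R)) = (k == 0)%:R.
Proof.
have E0 : (fun x : R => expi (2 * pi * x * k%:~R)) = fun x => expi ((2 * pi * k%:~R) * x).
  by apply/funext => x; congr expi; ring.
rewrite E0; set a := 2 * pi * k%:~R.
have [k0|k0] := eqVneq k 0.
  rewrite (_ : (fun x => _) = fun=> 1) ?Ec_cst//.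
  by apply/funext => x; rewrite /a k0 mulr0 mul0r expi0.
have a0 : a != 0 by rewrite mulf_neq0 ?intr_eq0// mulf_neq0 ?gt_eqF ?pi_gt0 ?ltr0n.
have [e1 e2] := mom_expi a.
have [ca sa] : cos a = 1 /\ sin a = 0.
  by have := expi_2pi_int k; rewrite -/a /expi => -[-> ->].
have ca' : continuous (fun x => cos (a * x)).
  by move=> x; apply: continuous_comp; [exact: mulrl_continuous|exact: continuous_cos].
have sa' : continuous (fun x => sin (a * x)).
  by move=> x; apply: continuous_comp; [exact: mulrl_continuous|exact: continuous_sin].
apply: complexP => /=; rewrite -Er_P01//=.
  have h x : is_derive x (1 : R) (fun x => a^-1 * sin (a * x)) (cos (a * x)).
    have := is_deriveZ a^-1 (is_derive_linear a (@is_derive_sin R) x).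
    by rewrite /GRing.scale/= mulrA mulVf// mul1r.
  by rewrite (Rintegral_derivative h ca') mulr1 mulr0 sin0 sa !mulr0 subr0.
have h x : is_derive x (1 : R) (fun x => - a^-1 * cos (a * x)) (sin (a * x)).
  have := is_deriveZ (- a^-1) (is_derive_linear a (@is_derive_cos R) x).
  by rewrite /GRing.scale/= mulrA mulNr mulVf// mulN1r opprK.
by rewrite (Rintegral_derivative h sa') mulr1 mulr0 cos0 ca subrr.
Qed.
End exponentials.

Lemma conj_entry (R : realType) m n (A : 'M[R[i]]_(m, n)) i j : (A^H) i j = Num.conj (A j i).
Proof. exact: adjE. Qed.

(** * The operators Psi in terms of Fourier coefficients *)

Section fourier.
Variable R : realType.
Local Notation C := R[i].
Variables (S : R -> R) (Cs : R).
Hypothesis mS : measurable_fun (`[0, 1] : set (measurableTypeR R)) S.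
Hypothesis S0 : forall nu, nu \in `[0, 1] -> 0 < S nu.
Hypothesis SC : forall nu, nu \in `[0, 1] -> S nu <= Cs.
Local Notation leb := (@lebesgue_measure R).

(** The density is only controlled on [0, 1]; outside it is set to 0. *)
Definition S01 : measurableTypeR R -> R := (S : measurableTypeR R -> R) \_ `[0, 1].

Lemma S01E nu : nu \in `[0, 1] -> S01 nu = S nu.
Proof. by move=> h; rewrite /S01 patchE mem_set. Qed.

Lemma S01_bound nu : 0 <= S01 nu <= Cs.
Proof.
rewrite /S01 patchE; case: ifPn => h.
  by rewrite inE in h; rewrite ltW ?S0// SC.
have h0 : (0 : R) \in `[0, 1] by rewrite in_itv/= lexx ler01.
by rewrite lexx/= (le_trans (ltW (S0 h0)))// SC.
Qed.

Lemma rmom_S01 : rmom (P01 R) S01.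
Proof.
apply: (@rmom_bounded _ _ _ _ _ Cs).
  by rewrite /S01; apply/(measurable_restrictT _ _).1.
by move=> nu; have /andP[a b] := S01_bound nu; rewrite ger0_norm.
Qed.

Definition phase (k : int) (x : measurableTypeR R) : C := expi (2 * pi * x * k%:~R).

Lemma mom_phase k : mom (P01 R) (phase k).
Proof.
apply: eq_mom (mom_expi (2 * pi * k%:~R)) => x; rewrite /phase; congr expi; ring.
Qed.

Lemma phaseD k l x : phase (k + l) x = phase k x * phase l x.
Proof. by rewrite /phase -expiD rmorphD/= mulrDr. Qed.
Lemma phaseN k x : phase (- k) x = Num.conj (phase k x).
Proof. by rewrite /phase -expiN rmorphN/= mulrN. Qed.

Lemma fourier_coefE k : fourier_coef S k = Ec (P01 R) (fun x => (S01 x)%:C * phase k x).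
Proof.
apply: Ec_P01; first by apply: momM; [exact: mom_realC rmom_S01|exact: mom_phase].
by move=> x hx; rewrite S01E.
Qed.

(** The quadratic form is expanded into exponentials, so that only Fourier coefficients of S remain.
    In this Toeplitz form the operator can be compared with covariances of the samples. *)
Lemma psiE K K' (X : 'M[C]_K') i j : psi S K X i j =
  K'%:R^-1 * \sum_a \sum_b X a b * fourier_coef S (b%:Z - a%:Z + i%:Z - j%:Z).
Proof.
rewrite /psi mxE.
have mS' := mom_realC rmom_S01.
have mt (a b : 'I_K') := momM mS' (mom_phase (b%:Z - a%:Z + i%:Z - j%:Z)).
rewrite (@Ec_P01 _ _ (fun x => K'%:R^-1 * \sum_(a < K') \sum_(b < K') X a b *
  ((S01 x)%:C * phase (b%:Z - a%:Z + i%:Z - j%:Z) x))).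
- rewrite EcZ; last by apply: mom_sum => a; apply: mom_sum => b; apply: momM => //; exact: mom_cst.
  congr (_ * _); rewrite Ec_sum; last by move=> a; apply: mom_sum => b; apply: momM => //; exact: mom_cst.
  apply: eq_bigr => a _; rewrite Ec_sum; last by move=> b; apply: momM => //; exact: mom_cst.
  by apply: eq_bigr => b _; rewrite EcZ// fourier_coefE.
- apply: momM; first exact: mom_cst.
  by apply: mom_sum => a; apply: mom_sum => b; apply: momM => //; exact: mom_cst.
move=> x hx; rewrite S01E//.
have pE (m : nat) : expi (2 * pi * m%:R * x) = phase m x by rewrite /phase; congr expi; ring.
have dE m (l : 'I_m) : dvec m x l 0 = phase l x by rewrite mxE pE.
have qE : ((avec K' x)^H *m X *m avec K' x) 0 0 =
    K'%:R^-1 * \sum_a \sum_b X a b * phase (b%:Z - a%:Z) x.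
  rewrite /avec adj_scale -scalemxAr -!scalemxAl scalerA mxE; congr (_ * _).
    by rewrite cjC -rmorphM/= -expr2 exprVn sqr_sqrtr ?ler0n// fmorphV/= rmorph_nat.
  rewrite mxE; under eq_bigr do rewrite mxE mulr_suml.
  rewrite exchange_big/=; apply: eq_bigr => a _; apply: eq_bigr => b _.
  by rewrite conj_entry !dE phaseD phaseN; ring.
rewrite mxE qE [(dvec K x *m _) i j]mxE big_ord1 conj_entry !dE.
rewrite [_%:C * (_ * _)]mulrCA -mulrA; congr (_ * _).
rewrite mulr_sumr mulr_suml; apply: eq_bigr => a _.
rewrite mulr_sumr mulr_suml; apply: eq_bigr => b _.
by rewrite !phaseD !phaseN; ring.
Qed.
End fourier.

Lemma rmom_lin_gen (R : realType) d (T : measurableType d) (P : probability T R) (J : finType)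
    (x : J -> T -> R) : (forall a, gaussian_rv P (lin x a)) ->
  (forall a, (\int[P]_t (expR (lin x a t))%:E = \int[P]_t (expR (- lin x a t))%:E)%E) ->
  forall a, rmom P (lin x a).
Proof.
move=> jg sym a; split; first exact: (lin_measurable jg).
move=> k; rewrite (_ : (fun t => _) = fun t => (`|lin x a t| ^+ (2 * k))%:E).
  exact: (lin_moment jg sym).
by apply/funext => t; rewrite exprM real_normK ?num_real.
Qed.

Lemma lin_unit (R : realType) (T : Type) (J : finType) (x : J -> T -> R) j t :
  \sum_j' (j' == j)%:R * x j' t = x j t.
Proof.
rewrite (bigD1 j)//= eqxx mul1r big1 ?addr0// => j' /negPf ->.
by rewrite mul0r.
Qed.

(** * Consequences of circular symmetry *)

Section circular_family.
Context (R : realType) d (Omega : measurableType d) (P : probability Omega R) (I : finType).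
Variable v : I -> Omega -> R[i].
Hypothesis hv : circular_gaussian P v.
Local Notation C := R[i].
Local Notation J := (I * bool)%type.
Local Notation Re := (@complex.Re R).
Local Notation Im := (@complex.Im R).

Definition coords (u : I -> Omega -> C) (j : J) (t : Omega) : R :=
  if j.2 then Re (u j.1 t) else Im (u j.1 t).

Lemma lin_coords a t : lin (coords v) a t =
  \sum_i (a (i, true) * Re (v i t) + a (i, false) * Im (v i t)).
Proof.
rewrite /lin (eq_bigr (fun p : J => a (p.1, p.2) * coords v (p.1, p.2) t)); last by move=> [].
rewrite -(pair_bigA _ (fun p q => a (p, q) * coords v (p, q) t))/=; apply: eq_bigr => i _.
by rewrite big_bool.
Qed.

Lemma coords_gaussian a : gaussian_rv P (lin (coords v) a).
Proof.
case: hv => jg _ _; have := jg (fun i => a (i, true)) (fun i => a (i, false)).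
by congr gaussian_rv; apply/funext => t; rewrite lin_coords.
Qed.

Lemma measurable_coords j : measurable_fun setT (coords v j).
Proof. exact: (coord_measurable coords_gaussian). Qed.

Definition turned (theta : R) : I -> Omega -> C := fun i t => expi theta * v i t.

Lemma measurable_turned theta j : measurable_fun setT (coords (turned theta) j).
Proof.
case: j => i b; have m1 := measurable_coords (i, true); have m2 := measurable_coords (i, false).
case: b; rewrite /coords/=.
  rewrite (_ : (fun t => _) = fun t => cos theta * coords v (i, true) t - sin theta * coords v (i, false) t).
    by apply: measurable_funB; exact: measurable_funM.
  by apply/funext => t; rewrite Re_mul.
rewrite (_ : (fun t => _) = fun t => cos theta * coords v (i, false) t + sin theta * coords v (i, true) t).
  by apply: measurable_funD; exact: measurable_funM.
by apply/funext => t; rewrite Im_mul.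
Qed.

Definition to_box (u : I -> Omega -> C) (t : Omega) : boxspace R J := fun j => coords u j t.

(** Circular symmetry is assumed on rectangles. Boxes are rectangles and form a generating
    pi-system, so it extends to all events. *)
Lemma turned_law theta A : measurable A ->
  P (to_box (turned theta) @^-1` A) = P (to_box v @^-1` A).
Proof.
move=> mA.
have m1 : measurable_fun setT (to_box (turned theta)) := measurable_to_box (measurable_turned theta).
have m2 : measurable_fun setT (to_box v) := measurable_to_box measurable_coords.
pose p1 : {measure set (boxspace R J) -> \bar R} :=
  measure_function_pushforward__canonical__measure_function_Measure P m1.
pose p2 : {measure set (boxspace R J) -> \bar R} :=
  measure_function_pushforward__canonical__measure_function_Measure P m2.
have bT (k : nat) : @boxes R J ((fun=> setT) k) by exact: boxes_setT.
have cover : \bigcup_(k : nat) (fun=> [set: boxspace R J]) k = setT.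
  by apply/seteqP; split=> // p _; exists 0%N.
have fin (k : nat) : (p1 ((fun=> setT) k) < +oo)%E.
  by rewrite (le_lt_trans (probability_le1 P _)) ?ltry//; rewrite preimage_setT.
have sub : @boxes R J `<=` @measurable _ (boxspace R J) by exact: sub_sigma_algebra.
suff eqb B : @boxes R J B -> p1 B = p2 B.
  rewrite -[LHS]/(p1 A) -[RHS]/(p2 A).
  exact: (@g_sigma_algebra_measure_unique _ R (boxspace R J) (@boxes R J) sub (fun=> setT) bT cover p1 p2 (@boxes_setI R J) eqb fin A mA).
move=> [b ->]; case: hv => _ circ _.
pose half (o : option R) : set (measurableTypeR R) := if o is Some r then `]r, +oo[%classic else setT.
have mh o : measurable (half o) by case: o => [r|]; [exact: measurable_itv|exact: measurableT].
pose Bx i := half (b (i, true)) `*` half (b (i, false)).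
have mB i : measurable (Bx i) by exact: measurableX.
have E (u : I -> Omega -> C) : to_box u @^-1` [set x | boxed b x] =
    [set t | forall i, Bx i (Re (u i t), Im (u i t))].
  have hE o x : half o x <-> is_true (if o is Some r then r < x else true).
    by case: o => [r|]/=; rewrite ?in_itv/= ?andbT.
  apply/seteqP; split=> t /=.
    by move=> h i; split; apply/hE; [exact: (h (i, true))|exact: (h (i, false))].
  by move=> h [i c]; have [/hE h1 /hE h2] := h i; case: c.
rewrite -[p1 _]/(P _) -[p2 _]/(P _) !E.
exact: (circ theta Bx mB).
Qed.

Lemma turned_integral theta (f : boxspace R J -> \bar R) : measurable_fun setT f ->
  (\int[P]_t f (to_box (turned theta) t) = \int[P]_t f (to_box v t))%E.
Proof.
move=> mf.
have m1 : measurable_fun setT (to_box (turned theta)) := measurable_to_box (measurable_turned theta).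
have m2 : measurable_fun setT (to_box v) := measurable_to_box measurable_coords.
pose p2 : {measure set (boxspace R J) -> \bar R} :=
  measure_function_pushforward__canonical__measure_function_Measure P m2.
rewrite (@integral_invariant R _ _ _ _ P p2 (to_box (turned theta)) f m1 (turned_law theta) mf).
by rewrite (@integral_invariant R _ _ _ _ P p2 (to_box v) f m2 (fun A mA => erefl) mf).
Qed.

(** The angle pi turns the family into its opposite. *)
Lemma coords_sym a : (\int[P]_t (expR (lin (coords v) a t))%:E =
  \int[P]_t (expR (- lin (coords v) a t))%:E)%E.
Proof.
pose f (x : boxspace R J) : \bar R := (expR (- \sum_j a j * x j))%:E.
have mf : measurable_fun setT f.
  apply/measurable_EFinP; apply: measurableT_comp => //; apply: measurableT_comp => //.
  by apply: measurable_sum => j; apply: measurable_funM => //; exact: measurable_coord.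
have := turned_integral pi mf.
have E t : f (to_box (turned pi) t) = (expR (lin (coords v) a t))%:E.
  congr (expR _)%:E; rewrite -sumrN; apply: eq_bigr => -[i b] _; rewrite /to_box /coords /turned/=.
  have -> : expi pi = - 1 :> C by rewrite /expi cospi sinpi; apply: complexP => /=; rewrite ?oppr0.
  by case: b => /=; rewrite mulN1r ?ReN ?ImN mulrN opprK.
by under eq_integral do rewrite E.
Qed.

Lemma mom_v i : mom P (v i).
Proof.
split.
  have := rmom_lin_gen coords_gaussian coords_sym (fun j' => (j' == (i, true))%:R); congr rmom.
  by apply/funext => t; rewrite /lin lin_unit.
have := rmom_lin_gen coords_gaussian coords_sym (fun j' => (j' == (i, false))%:R); congr rmom.
by apply/funext => t; rewrite /lin lin_unit.
Qed.

(** A quarter turn multiplies v_i v_j by i^2 = -1 without changing the law, so the moment equals its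
    opposite. *)
Lemma pseudo_covariance i j : Ec P (fun t => v i t * v j t) = 0.
Proof.
pose c (x : boxspace R J) (k : I) : C := x (k, true) +i* x (k, false).
have cv (u : I -> Omega -> C) t k : c (to_box u t) k = u k t.
  by rewrite /c /to_box /coords/=; case: (u k t).
have mc k : cmeas (fun x => c x k) by split; exact: measurable_coord.
have [p1 p2] := cmeasM (mc i) (mc j).
have E : Ec P (fun t => turned (pi / 2) i t * turned (pi / 2) j t) = Ec P (fun t => v i t * v j t).
  apply: complexP => /=; rewrite /Er /Rintegral; congr fine.
    have F u : (\int[P]_t (Re (c (to_box u t) i * c (to_box u t) j))%:E = \int[P]_t (Re (u i t * u j t))%:E)%E.
      by apply: eq_integral => t _; rewrite !cv.
    have /measurable_EFinP h := p1.
    exact: (etrans (esym (F (turned (pi / 2)))) (etrans (turned_integral (pi / 2) h) (F v))).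
  have F u : (\int[P]_t (Im (c (to_box u t) i * c (to_box u t) j))%:E = \int[P]_t (Im (u i t * u j t))%:E)%E.
    by apply: eq_integral => t _; rewrite !cv.
  have /measurable_EFinP h := p2.
  exact: (etrans (esym (F (turned (pi / 2)))) (etrans (turned_integral (pi / 2) h) (F v))).
have e2 : expi (pi / 2) * expi (pi / 2) = - 1 :> C.
  by apply: complexP; rewrite ?Re_mul ?Im_mul /expi/= cos_pihalf sin_pihalf; ring.
have mvv := momM (mom_v i) (mom_v j).
have N : Ec P (fun t => turned (pi / 2) i t * turned (pi / 2) j t) = - Ec P (fun t => v i t * v j t).
  rewrite -(EcN mvv); apply: eq_Ec => t; rewrite /turned mulrACA e2 mulN1r.
  by [].
move: E; rewrite N => /eqP; rewrite eq_sym -subr_eq0 opprK -mulr2n mulrn_eq0/= => /eqP.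
by [].
Qed.

Lemma cexpectationE (F : Omega -> C) : cexpectation P F = Ec P F.
Proof. by rewrite /cexpectation /Ec /Er /Rintegral unlock. Qed.

End circular_family.

(** * The Hankel model *)

Lemma sum_pair (A B : finType) (V : nmodType) (F : A * B -> V) :
  \sum_p F p = \sum_a \sum_b F (a, b).
Proof. by rewrite pair_bigA/=; apply: eq_bigr => -[]. Qed.

Lemma n2_sum_card (R : realType) (Q : finType) (A : pred Q) (F : Q -> R[i]) D :
  (#|A| <= D)%N -> n2 (\sum_(q | A q) F q) <= D%:R * \sum_(q | A q) n2 (F q).
Proof.
move=> hD; have := n2_CS A (fun=> 1) F; under eq_bigr do rewrite mul1r.
move=> h; apply: (le_trans h); rewrite ler_wpM2r ?sumr_ge0//.
by rewrite (eq_bigr (fun=> 1)) => [|i _]; rewrite ?n21// sumr_const ler_nat.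
Qed.

Lemma spectral_expansion (R : realType) K (g : 'I_K -> R[i]) (s : measurableTypeR R -> R) :
  rmom (P01 R) s ->
  (Er (P01 R) (fun x => s x * n2 (\sum_k g k * phase k x)))%:C =
  \sum_k \sum_k' g k * Num.conj (g k') * Ec (P01 R) (fun x => (s x)%:C * phase (k%:Z - k'%:Z) x).
Proof.
move=> hs; have ms := mom_realC hs.
have m1 (k k' : 'I_K) := momM ms (mom_phase R (k%:Z - k'%:Z)).
have m2 (k k' : 'I_K) := momM (mom_cst (P01 R) (g k * Num.conj (g k'))) (m1 k k').
rewrite -Ec_realC (eq_Ec (P01 R) (G := fun x => \sum_k \sum_k' g k * Num.conj (g k') *
  ((s x)%:C * phase (k%:Z - k'%:Z) x))); last first.
  move=> x; rewrite rmorphM/= -mulCJ cj_sum mulr_suml mulr_sumr; apply: eq_bigr => k _.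
  rewrite mulr_sumr mulr_sumr; apply: eq_bigr => k' _.
  by rewrite cjM phaseD phaseN; ring.
rewrite Ec_sum; last by move=> k; exact: mom_sum.
apply: eq_bigr => k _; rewrite Ec_sum; last by move=> k'; exact: m2.
by apply: eq_bigr => k' _; rewrite (EcZ _ (m1 k k')).
Qed.

Lemma Parseval (R : realType) K (g : 'I_K -> R[i]) :
  Er (P01 R) (fun x => n2 (\sum_k g k * phase k x)) = \sum_k n2 (g k).
Proof.
have h := spectral_expansion g (rmom_cst (P01 R) 1).
have inj (a b : R) : a%:C = b%:C -> a = b by case.
apply: inj; rewrite (eq_Er (P01 R) (g := fun x => 1 * n2 (\sum_k g k * phase k x))); last by move=> x; rewrite mul1r.
rewrite h rmorph_sum/=; apply: eq_bigr => k _.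
rewrite (bigD1 k)//= [X in _ + X]big1 => [|k' kk'].
  rewrite subrr (eq_Ec (P01 R) (G := phase 0)); last by move=> x; rewrite mul1r.
  by rewrite expi_orthogonal eqxx mulr1 addr0 mulCJ.
rewrite (eq_Ec (P01 R) (G := phase (k%:Z - k'%:Z))); last by move=> x; rewrite mul1r.
rewrite expi_orthogonal subr_eq0 (_ : (k%:Z == k'%:Z) = false) ?mulr0//.
by apply/negbTE; rewrite eqz_nat eq_sym.
Qed.

Section hankel_model.
Context (R : realType) d (Omega : measurableType d) (P : probability Omega R).
Variables (M L N : nat) (w : 'I_M -> nat -> Omega -> R[i]) (S : 'I_M -> R -> R) (Cs : R).
Local Notation C := R[i].
Local Notation n := (blockdim M L).
Local Notation I := ('I_M * 'I_(N + L - 1))%type.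
Local Notation J := ('I_n * 'I_N * bool)%type.
Local Notation Re := (@complex.Re R).
Local Notation Im := (@complex.Im R).
Definition vfam (p : I) (t : Omega) : C := w p.1 p.2 t.
Hypothesis N0 : (0 < N)%N.
Hypothesis M0 : (0 < M)%N.
Hypothesis L0 : (0 < L)%N.
Hypothesis hv : circular_gaussian P vfam.
Hypothesis mS : forall m, measurable_fun (`[0, 1] : set (measurableTypeR R)) (S m).
Hypothesis S0 : forall m nu, nu \in `[0, 1] -> 0 < S m nu.
Hypothesis SC : forall m nu, nu \in `[0, 1] -> S m nu <= Cs.
Hypothesis cov : forall (m m' : 'I_M) (k k' : 'I_(N + L - 1)),
  cexpectation P (fun t => w m k t * (w m' k' t)^*) =
  fourier_coef (S m) (k%:Z - k'%:Z) / N%:R * (m == m')%:R.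

Let mv p : mom P (vfam p) := mom_v hv p.

Lemma covE p q : Ec P (fun t => vfam p t * Num.conj (vfam q t)) =
  fourier_coef (S p.1) (p.2%:Z - q.2%:Z) / N%:R * (p.1 == q.1)%:R.
Proof. by rewrite -cexpectationE; exact: cov. Qed.

(** In the spectral domain, the variance of a linear form is the mean over m of integrals of S_m
    |h_m|^2, up to normalization; bounding S_m by [Cs] and applying Parseval shows that the
    covariance matrix of the samples has norm at most Cs / N. *)
Lemma cov_bound (g : I -> C) : Er P (fun t => n2 (\sum_p g p * vfam p t)) <=
  Cs / N%:R * \sum_p n2 (g p).
Proof.
have m1 p q := momM (mv p) (momJ (mv q)).
have m2 p q := momM (mom_cst P (g p * Num.conj (g q))) (m1 p q).
pose h m x := \sum_k g (m, k) * phase k x.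
have rS m := rmom_S01 (mS m) (S0 m) (SC m).
have E : Er P (fun t => n2 (\sum_p g p * vfam p t)) =
    N%:R^-1 * \sum_m Er (P01 R) (fun x => S01 (S m) x * n2 (h m x)).
  have inj (a b : R) : a%:C = b%:C -> a = b by case.
  apply: inj; rewrite -Ec_realC rmorphM/= rmorph_sum/=.
  rewrite (eq_Ec P (G := fun t => \sum_p \sum_q g p * Num.conj (g q) * (vfam p t * Num.conj (vfam q t)))); last first.
    move=> t; rewrite -mulCJ cj_sum mulr_suml; apply: eq_bigr => p _.
    by rewrite mulr_sumr; apply: eq_bigr => q _; rewrite cjM; ring.
  rewrite Ec_sum; last by move=> p; exact: mom_sum.
  rewrite mulr_sumr sum_pair.
  apply: eq_bigr => m _; rewrite spectral_expansion// mulr_sumr; apply: eq_bigr => k _.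
  rewrite Ec_sum; last by move=> q; exact: m2.
  rewrite sum_pair (bigD1 m)//= [X in _ + X]big1 => [|m' mm']; last first.
    rewrite big1// => k' _; rewrite (EcZ _ (m1 _ _)) covE/= eq_sym (negbTE mm').
    by rewrite !mulr0.
  rewrite addr0 mulr_sumr; apply: eq_bigr => k' _.
  rewrite (EcZ _ (m1 _ _)) covE/= eqxx mulr1 -(fourier_coefE (mS m) (S0 m) (SC m)).
  by rewrite fmorphV/= rmorph_nat; ring.
rewrite E [Cs / _]mulrC -mulrA.
rewrite ler_wpM2l ?invr_ge0 ?ler0n// sum_pair mulr_sumr.
apply: ler_sum => m _; rewrite -Parseval.
have mh : rmom (P01 R) (fun x => n2 (h m x)).
  by apply: rmom_n2; apply: mom_sum => k; apply: momM; [exact: mom_cst|exact: mom_phase].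
rewrite -(ErZ _ mh); apply: Er_le; [exact: rmomM|exact: (rmomM (rmom_cst _ _))|].
by move=> x; rewrite ler_wpM2r//; have /andP[] := S01_bound (S0 m) (SC m) x.
Qed.

Lemma Cs_ge0 : 0 <= Cs.
Proof.
have h0 : (0 : R) \in `[0, 1] by rewrite in_itv/= lexx ler01.
by apply: le_trans (SC (Ordinal M0) h0); exact: ltW (S0 _ h0).
Qed.

(** Coefficients that multiply the same sample are added first; if at most D of them coincide, this
    costs a factor D. *)
Lemma grouped_cov_bound (Q : finType) (phi : Q -> I) (D : nat) (F : Q -> C) :
  (forall p, (#|[pred q | phi q == p]| <= D)%N) ->
  Er P (fun t => n2 (\sum_q F q * vfam (phi q) t)) <= Cs / N%:R * (D%:R * \sum_q n2 (F q)).
Proof.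
move=> hD; rewrite (eq_Er P (g := fun t => n2 (\sum_p (\sum_(q | phi q == p) F q) * vfam p t))); last first.
  move=> t; rewrite (partition_big phi xpredT)//=; congr n2; apply: eq_bigr => p _.
  by rewrite mulr_suml; apply: eq_bigr => q /eqP ->.
apply: (le_trans (cov_bound _)).
rewrite ler_wpM2l ?divr_ge0 ?Cs_ge0//.
rewrite [X in _ <= _ * X](partition_big phi xpredT)//= mulr_sumr; apply: ler_sum => p _.
exact: (n2_sum_card F (hD p)).
Qed.

Lemma pos_subproof (i : 'I_L) (j : 'I_N) : (i + j < N + L - 1)%N.
Proof. by have := ltn_ord i; have := ltn_ord j; lia. Qed.
Definition pos_ord i j : 'I_(N + L - 1) := Ordinal (pos_subproof i j).
Definition loc (q : 'I_n * 'I_N) : I := (bm q.1, pos_ord (bi q.1) q.2).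
Definition Wt t : 'M[C]_(n, N) := Wmx L N (fun m k => w m k t).

Lemma WtE t a j : Wt t a j = vfam (loc (a, j)) t.
Proof. by rewrite /Wt WmxE. Qed.

Definition Xt t : boxspace R J := fun q => if q.2 then Re (Wt t q.1.1 q.1.2) else Im (Wt t q.1.1 q.1.2).

Lemma XtE t q : Xt t q = coords vfam (loc q.1, q.2) t.
Proof. by case: q => [[a j] b]; rewrite /Xt /coords/= !WtE. Qed.

Lemma Wm_Xt t : Wm (Xt t) = Wt t.
Proof. by apply/matrixP => a j; rewrite mxE /Xt/=; case: (Wt t a j). Qed.

Lemma measurable_Xt : measurable_fun setT Xt.
Proof.
apply: measurable_to_box => q; rewrite (_ : (fun t => _) = coords vfam (loc q.1, q.2)).
  exact: (measurable_coords hv).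
by apply/funext => t; rewrite XtE.
Qed.

HB.instance Definition _ := isMeasurableFun.Build _ _ _ _ Xt measurable_Xt.

(** Repeated entries of the matrix count as separate coordinates, so this Gaussian law is in general
    degenerate; the abstract estimates ask only for Gaussian linear forms, never for a density. *)
Definition Wlaw : probability (boxspace R J) R := distribution P Xt.
Let inv A (mA : measurable A) : P (Xt @^-1` A) = Wlaw A := erefl.
Local Notation coord := (fun (j : J) (x : boxspace R J) => x j).

Lemma lin_Xt a t : lin coord a (Xt t) =
  lin (coords vfam) (fun p => \sum_(q : J | (loc q.1, q.2) == p) a q) t.
Proof.
rewrite /lin (partition_big (fun q : J => (loc q.1, q.2)) xpredT)//=.
by apply: eq_bigr => p _; rewrite mulr_suml; apply: eq_bigr => q /eqP <-; rewrite XtE.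
Qed.

Lemma measurable_lin a : measurable_fun setT (lin coord a : boxspace R J -> R).
Proof. by apply: measurable_sum => j; apply: measurable_funM => //; exact: measurable_coord. Qed.

Lemma Wlaw_gaussian a : gaussian_rv Wlaw (lin coord a).
Proof.
split; first exact: measurable_lin.
have [_ [m [s h]]] := coords_gaussian hv (fun p => \sum_(q : J | (loc q.1, q.2) == p) a q).
exists m, s => B mB; rewrite -(h B mB).
by congr (P _); apply/funext => t /=; rewrite lin_Xt.
Qed.

Lemma Wlaw_sym a : (\int[Wlaw]_t (expR (lin coord a t))%:E = \int[Wlaw]_t (expR (- lin coord a t))%:E)%E.
Proof.
have m1 : measurable_fun setT (fun x : boxspace R J => (expR (lin coord a x))%:E).
  by apply/measurable_EFinP; apply: measurableT_comp => //; exact: measurable_lin.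
have m2 : measurable_fun setT (fun x : boxspace R J => (expR (- lin coord a x))%:E).
  by apply/measurable_EFinP; apply: measurableT_comp => //; apply: measurableT_comp => //; exact: measurable_lin.
rewrite -(@integral_invariant R _ _ _ _ P Wlaw Xt _ measurable_Xt inv m1).
rewrite -(@integral_invariant R _ _ _ _ P Wlaw Xt _ measurable_Xt inv m2).
under eq_integral do rewrite lin_Xt; under [RHS]eq_integral do rewrite lin_Xt.
exact: (coords_sym hv).
Qed.

Let mW := mommx_Wm Wlaw_gaussian Wlaw_sym.

Lemma Er_Wlaw h : rmom Wlaw h -> Er Wlaw h = Er P (fun t => h (Xt t)).
Proof. by move=> [mh _]; rewrite (Er_push measurable_Xt inv mh). Qed.
Lemma Ec_Wlaw F : mom Wlaw F -> Ec Wlaw F = Ec P (fun t => F (Xt t)).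
Proof. by move=> mF; rewrite (Ec_push measurable_Xt inv mF). Qed.

Lemma Wlaw_pseudo a j b k : Ec Wlaw (fun x => @Wm R n N x a j * Wm x b k) = 0.
Proof.
rewrite Ec_Wlaw; last by apply: momM; exact: mW.
rewrite (eq_Ec P (G := fun t => vfam (loc (a, j)) t * vfam (loc (b, k)) t)); first exact: (pseudo_covariance hv).
by move=> t; rewrite !Wm_Xt !WtE.
Qed.

(** A sample occurs at most L times in the whole matrix, whence the L. It occurs at most once in
    each row and column, and [kap_N] adds the contributions of the N columns and of the n rows, each
    Cs / N. *)
Definition eta_N : R := Cs / N%:R * L%:R.
Definition kap_N : R := Cs * (1 + n%:R / N%:R).

Lemma Wlaw_trace (G : 'M[C]_(N, n)) : Er Wlaw (fun x => n2 (\tr (G *m Wm x))) <= eta_N * fro2 G.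
Proof.
rewrite Er_Wlaw; last by mtac.
rewrite (eq_Er P (g := fun t => n2 (\sum_(q : 'I_n * 'I_N) G q.2 q.1 * vfam (loc q) t))); last first.
  move=> t; rewrite Wm_Xt; congr n2; rewrite sum_pair /mxtrace exchange_big/=.
  by apply: eq_bigr => j _; rewrite mxE; apply: eq_bigr => a _; rewrite WtE.
apply: (le_trans (grouped_cov_bound (D := L) _ _)).
  move=> [m k]; rewrite -[leqRHS]card_ord.
  (* Once the sample is fixed, the row inside the block determines the block and the column, so the
     entries equal to it inject into the L rows of a block. *)
  apply: (@leq_card_in _ _ (fun q : 'I_n * 'I_N => bi q.1)) => //.
  move=> [a j] [a' j']; rewrite !inE /loc/= => /eqP[e1 e2] /eqP[e3 e4] e5.
  have ea : a = a' by rewrite -(bkK a) -(bkK a') e1 e3 e5.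
  congr (_, _); first exact: ea.
  apply: val_inj; have /eqP := congr1 val (etrans e2 (esym e4)).
  by rewrite /= e5 eqn_add2l => /eqP.
rewrite /eta_N mulrA ler_wpM2l ?mulr_ge0 ?divr_ge0 ?Cs_ge0//.
by rewrite sum_pair /fro2 exchange_big.
Qed.

Lemma Wlaw_left (x : 'cV[C]_n) : Er Wlaw (fun v => fro2 ((Wm v)^H *m x)) <= kap_N * fro2 x.
Proof.
rewrite Er_Wlaw; last by mtac.
rewrite (eq_Er P (g := fun t => \sum_j n2 (\sum_a Num.conj (x a 0) * vfam (loc (a, j)) t))); last first.
  move=> t; rewrite Wm_Xt fro2_cV; apply: eq_bigr => j _.
  rewrite (_ : \sum_a _ = Num.conj (((Wt t)^H *m x) j 0)) ?[RHS]n2J//.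
  rewrite mxE cj_sum; apply: eq_bigr => a _.
  by rewrite conj_entry cjM conjCK mulrC WtE.
have ms j : rmom P (fun t => n2 (\sum_a Num.conj (x a 0) * vfam (loc (a, j)) t)).
  by apply: rmom_n2; apply: mom_sum => a; apply: momM; [exact: mom_cst|exact: mv].
rewrite Er_sum//; apply: (@le_trans _ _ (\sum_(j < N) Cs / N%:R * fro2 x)).
  apply: ler_sum => j _.
  apply: (le_trans (grouped_cov_bound (D := 1) (phi := fun a => loc (a, j)) _ _)).
    move=> [m k]; apply/card_le1_eqP => a b; rewrite !inE /loc/= => /eqP[e1 e2] /eqP[e3 e4].
    have e5 : bi a = bi b.
      by apply: val_inj; have /eqP := congr1 val (etrans e2 (esym e4)); rewrite /= eqn_add2r => /eqP.
    by rewrite -(bkK a) -(bkK b) e1 e3 e5.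
  rewrite mul1r ler_wpM2l ?divr_ge0 ?Cs_ge0// fro2_cV.
  by apply: ler_sum => a _; rewrite n2J.
rewrite sumr_const card_ord -[_ *+ N]mulr_natl mulrA mulrCA divff ?pnatr_eq0 -?lt0n// mulr1.
by rewrite ler_wpM2r// /kap_N mulrDr mulr1 lerDl mulr_ge0 ?divr_ge0 ?Cs_ge0.
Qed.

Lemma Wlaw_right (y : 'cV[C]_N) : Er Wlaw (fun v => fro2 (Wm v *m y)) <= kap_N * fro2 y.
Proof.
rewrite Er_Wlaw; last by mtac.
rewrite (eq_Er P (g := fun t => \sum_a n2 (\sum_j y j 0 * vfam (loc (a, j)) t))); last first.
  move=> t; rewrite Wm_Xt fro2_cV; apply: eq_bigr => a _; rewrite mxE; congr n2.
  by apply: eq_bigr => j _; rewrite mulrC WtE.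
have ms a : rmom P (fun t => n2 (\sum_j y j 0 * vfam (loc (a, j)) t)).
  by apply: rmom_n2; apply: mom_sum => j; apply: momM; [exact: mom_cst|exact: mv].
rewrite Er_sum//; apply: (@le_trans _ _ (\sum_(a < n) Cs / N%:R * fro2 y)).
  apply: ler_sum => a _.
  apply: (le_trans (grouped_cov_bound (D := 1) (phi := fun j => loc (a, j)) _ _)).
    move=> [m k]; apply/card_le1_eqP => j j'; rewrite !inE /loc/= => /eqP[e1 e2] /eqP[e3 e4].
    by apply: val_inj; have /eqP := congr1 val (etrans e2 (esym e4)); rewrite /= eqn_add2l => /eqP.
  by rewrite mul1r ler_wpM2l ?divr_ge0 ?Cs_ge0// fro2_cV.
rewrite sumr_const card_ord -[_ *+ n]mulr_natl mulrA mulrCA.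
by rewrite ler_wpM2r// /kap_N mulrDr mulr1 lerDr Cs_ge0.
Qed.

(** The covariance r_m(i + j - i' - k) / N multiplying F_jk is the (k, j) term of [psiE], whence the
    transpose. *)
Lemma Kop_Psi (F : 'M[C]_N) : Kop Wlaw F = Psi L S F^T.
Proof.
apply/matrixP => a b; rewrite mxE Ec_Wlaw; last by mtac.
pose v a j t := vfam (loc (a, j)) t.
have m1 j k := momM (mv (loc (a, j))) (momJ (mv (loc (b, k)))).
rewrite (eq_Ec P (G := fun t => \sum_j \sum_k F j k * (v a j t * Num.conj (v b k t)))); last first.
  move=> t; rewrite Wm_Xt mxE; under eq_bigr do rewrite mxE mulr_suml.
  rewrite exchange_big/=; apply: eq_bigr => j _; apply: eq_bigr => k _.
  by rewrite conj_entry !WtE /v; ring.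
rewrite Ec_sum; last by move=> j; apply: mom_sum => k; exact: (momM (mom_cst _ _) (m1 j k)).
have E j k : Ec P (fun t => v a j t * Num.conj (v b k t)) =
    fourier_coef (S (bm a)) ((bi a + j)%N%:Z - (bi b + k)%N%:Z) / N%:R * (bm a == bm b)%:R.
  exact: covE.
rewrite PsiE; case: eqP => hab; last first.
  rewrite big1// => j _; rewrite Ec_sum; last by move=> k; exact: (momM (mom_cst _ _) (m1 j k)).
  rewrite big1// => k _; rewrite (EcZ _ (m1 j k)) E (_ : (bm a == bm b) = false) ?mulr0//.
  exact/eqP.
rewrite (psiE (mS _) (S0 _) (SC _)) mulr_sumr.
rewrite (eq_bigr (fun j => \sum_k F j k * (fourier_coef (S (bm a)) ((bi a + j)%N%:Z - (bi b + k)%N%:Z) / N%:R))); last first.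
  move=> j _; rewrite Ec_sum; last by move=> k; exact: (momM (mom_cst _ _) (m1 j k)).
  by apply: eq_bigr => k _; rewrite (EcZ _ (m1 j k)) E hab eqxx mulr1.
rewrite exchange_big/=; apply: eq_bigr => k _; rewrite mulr_sumr; apply: eq_bigr => j _.
rewrite mxE [RHS]mulrCA [_ / N%:R]mulrC; congr (_ * (_ * fourier_coef _ _)).
rewrite !PoszD; ring.
Qed.

(** The factor ML / N cancels the normalizations 1 / M of [Psibar] and 1 / L of [psi], leaving the
    variance 1 / N of the samples; distinct blocks are uncorrelated, so only diagonal blocks of X
    contribute. *)
Lemma Ktop_Psibar (X : 'M[C]_n) :
  Ktop Wlaw X = ((M * L)%:R / N%:R) *: (Psibar N S X)^T.
Proof.
apply/matrixP => j k; rewrite mxE Ec_Wlaw; last by mtac.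
pose v a j t := vfam (loc (a, j)) t.
have m1 a b := momM (mv (loc (b, k))) (momJ (mv (loc (a, j)))).
rewrite (eq_Ec P (G := fun t => \sum_a \sum_b X a b * (v b k t * Num.conj (v a j t)))); last first.
  move=> t; rewrite Wm_Xt mxE; under eq_bigr do rewrite mxE mulr_suml.
  rewrite exchange_big/=; apply: eq_bigr => a _; apply: eq_bigr => b _.
  by rewrite conj_entry !WtE /v; ring.
rewrite Ec_sum; last by move=> a; apply: mom_sum => b; exact: (momM (mom_cst _ _) (m1 a b)).
have E a b : Ec P (fun t => v b k t * Num.conj (v a j t)) =
    fourier_coef (S (bm b)) ((bi b + k)%N%:Z - (bi a + j)%N%:Z) / N%:R * (bm b == bm a)%:R.
  exact: covE.
rewrite 2!mxE PsibarE sum_block.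
rewrite natrM; have M1 : (M%:R : C) != 0 by rewrite pnatr_eq0 -lt0n.
have N1 : (N%:R : C) != 0 by rewrite pnatr_eq0 -lt0n.
have L1 : (L%:R : C) != 0 by rewrite pnatr_eq0 -lt0n.
rewrite mulrA (_ : M%:R * L%:R / N%:R * M%:R^-1 = L%:R / N%:R); last by field; rewrite ?M1 ?N1.
rewrite mulr_sumr; apply: eq_bigr => m _.
rewrite (psiE (mS _) (S0 _) (SC _)) mulrA (_ : L%:R / N%:R * L%:R^-1 = N%:R^-1); last by field; rewrite ?L1 ?N1.
rewrite mulr_sumr; apply: eq_bigr => i _.
rewrite Ec_sum; last by move=> b; exact: (momM (mom_cst _ _) (m1 _ b)).
rewrite sum_block (bigD1 m)//= [X in _ + X]big1 => [|m' mm']; last first.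
  rewrite big1// => i' _; rewrite (EcZ _ (m1 _ _)) E !bm_bk (negbTE mm') !mulr0//.
rewrite addr0 mulr_sumr; apply: eq_bigr => i' _.
rewrite (EcZ _ (m1 _ _)) E !bm_bk !bi_bk eqxx mulr1 mxE mulrC -!mulrA [LHS]mulrC.
rewrite -mulrA; congr (_ * (_ * fourier_coef _ _)).
rewrite !PoszD; ring.
Qed.

End hankel_model.

(** * Stieltjes transforms *)

Section finite_measure_integral.
Context (R : realType) d (T : measurableType d) (m : {finite_measure set T -> \bar R}) (D : set T).
Hypothesis mD : measurable D.
Local Notation C := R[i].
Local Notation Re := (@complex.Re R).
Local Notation Im := (@complex.Im R).
Implicit Types f g : T -> C.

Definition bmeas f := cmeas f /\ exists K, forall t, normc (f t) <= K.

Lemma Re_abs (x : C) : `|Re x| <= normc x.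
Proof.
rewrite -(@ler_pXn2r _ 2)// ?nnegrE ?normr_ge0 ?normc_ge0'//.
by rewrite real_normK ?num_real// -n2E Re_le.
Qed.
Lemma Im_abs (x : C) : `|Im x| <= normc x.
Proof.
rewrite -(@ler_pXn2r _ 2)// ?nnegrE ?normr_ge0 ?normc_ge0'//.
by rewrite real_normK ?num_real// -n2E Im_le.
Qed.

Lemma bounded_real_integrable (h : T -> R) K : measurable_fun setT h -> (forall t, `|h t| <= K) ->
  m.-integrable D (EFin \o h).
Proof.
move=> mh hK; apply: measurable_bounded_integrable => //.
- by rewrite (le_lt_trans (le_measure m _ _ (subsetT D))) ?inE// fin_num_fun_lty//; exact: fin_num_measure.
- exact: measurable_funTS.
- exists K; split; first exact: num_real.
  by move=> x Kx t _ /=; exact: le_trans (hK t) (ltW Kx).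
Qed.

Lemma bmeas_Re f : bmeas f -> m.-integrable D (EFin \o (Re \o f)).
Proof.
move=> [[m1 _] [K hK]]; apply: (bounded_real_integrable m1 (K := K)) => t.
exact: le_trans (Re_abs _) (hK t).
Qed.
Lemma bmeas_Im f : bmeas f -> m.-integrable D (EFin \o (Im \o f)).
Proof.
move=> [[_ m1] [K hK]]; apply: (bounded_real_integrable m1 (K := K)) => t.
exact: le_trans (Im_abs _) (hK t).
Qed.

Lemma bmeasD f g : bmeas f -> bmeas g -> bmeas (fun t => f t + g t).
Proof.
move=> [mf [K hK]] [mg [K' hK']]; split; first exact: cmeasD.
by exists (K + K') => t; rewrite (le_trans (le_normcD _ _))// lerD.
Qed.
Lemma bmeasZ c f : bmeas f -> bmeas (fun t => c * f t).
Proof.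
move=> [mf [K hK]]; split; first by apply: cmeasM => //; exact: cmeas_cst.
by exists (normc c * K) => t; rewrite normcM ler_wpM2l.
Qed.
Lemma bmeas0 : bmeas (fun=> 0).
Proof. by split; [exact: cmeas_cst|exists (normc (0 : C))]. Qed.
Lemma bmeas_sum (I : Type) (r : seq I) (F : I -> T -> C) : (forall i, bmeas (F i)) ->
  bmeas (fun t => \sum_(i <- r) F i t).
Proof.
move=> h; elim: r => [|i r ih].
  by under eq_fun do rewrite big_nil; exact: bmeas0.
by under eq_fun do rewrite big_cons; exact: bmeasD.
Qed.

Lemma cintegralD f g : bmeas f -> bmeas g ->
  cintegral m D (fun t => f t + g t) = cintegral m D f + cintegral m D g.
Proof.
move=> hf hg; apply: complexP => /=.
  rewrite -RintegralD//; [|exact: bmeas_Re|exact: bmeas_Re].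
  by apply: eq_Rintegral => t _; rewrite ReD.
rewrite -RintegralD//; [|exact: bmeas_Im|exact: bmeas_Im].
by apply: eq_Rintegral => t _; rewrite ImD.
Qed.

Lemma cintegralZ c f : bmeas f -> cintegral m D (fun t => c * f t) = c * cintegral m D f.
Proof.
move=> hf; have h1 := bmeas_Re hf; have h2 := bmeas_Im hf.
have h3 (k : R) (h : T -> R) : m.-integrable D (EFin \o h) -> m.-integrable D (EFin \o (fun t => k * h t)).
  by move=> hh; have := integrableZl mD k hh; apply: eq_integrable.
apply: complexP; rewrite ?Re_mul ?Im_mul/=.
  rewrite -!RintegralZl// -RintegralB//; [|exact: h3|exact: h3].
  by apply: eq_Rintegral => t _; rewrite Re_mul.
rewrite -!RintegralZl// -RintegralD//; [|exact: h3|exact: h3].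
by apply: eq_Rintegral => t _; rewrite Im_mul.
Qed.

Lemma cintegral_sum (I : Type) (r : seq I) (F : I -> T -> C) : (forall i, bmeas (F i)) ->
  cintegral m D (fun t => \sum_(i <- r) F i t) = \sum_(i <- r) cintegral m D (F i).
Proof.
move=> h; elim: r => [|i r ih].
  rewrite big_nil (_ : (fun t => _) = fun t => 0 * 0); last first.
    by apply/funext => t; rewrite big_nil mulr0.
  by rewrite (cintegralZ 0 bmeas0) mul0r.
rewrite big_cons -ih -cintegralD//; last exact: bmeas_sum.
by congr cintegral; apply/funext => t; rewrite big_cons.
Qed.

Lemma cintegral_bound f e : bmeas f -> (forall t, normc (f t) <= e) ->
  normc (cintegral m D f) <= 2 * (e * fine (m D)).
Proof.
move=> hf he.
have [t0|/forallNP nT] := pselect (exists t, D t); last first.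
  have D0 : D = set0 by apply/seteqP; split=> t // /nT.
  by rewrite D0 /cintegral !Rintegral_set0 measure0 /normc/= expr0n addr0 sqrtr0 !mulr0.
have [t _] := t0; have e0 : 0 <= e := le_trans (normc_ge0' _) (he t).
have mfin : m D \is a fin_num by exact: fin_num_measure.
have b (h : T -> R) : m.-integrable D (EFin \o h) -> (forall t, `|h t| <= e) ->
    (\int[m]_(x in D) h x) ^+ 2 <= (e * fine (m D)) ^+ 2.
  move=> ih hh; rewrite -real_normK ?num_real//; apply: expr_mono => //.
  apply: (le_trans (le_normr_Rintegral mD ih)).
  rewrite -Rintegral_cst//; apply: le_Rintegral => //.
  - exact: integrable_norm.
  - by apply/finite_measure_integrable_cst.
apply: normc_le_sqr; first by rewrite !mulr_ge0// fine_ge0.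
have b1 := b _ (bmeas_Re hf) (fun t => le_trans (Re_abs _) (he t)).
have b2 := b _ (bmeas_Im hf) (fun t => le_trans (Im_abs _) (he t)).
by rewrite exprMn /n2 /cintegral/=; have := sqr_ge0 (e * fine (m D)); move: b1 b2 => /=; lra.
Qed.

Lemma Re_cintegral_ge0 v f : bmeas f -> (forall t, 0 <= Re (v * f t)) -> 0 <= Re (v * cintegral m D f).
Proof.
by move=> hf h; rewrite -cintegralZ//; apply: Rintegral_ge0 => t _; exact: h.
Qed.
End finite_measure_integral.

(** * Positivity and approximation in the Stieltjes class *)

Section stieltjes.
Variable R : realType.
Local Notation C := R[i].
Local Notation Re := (@complex.Re R).
Local Notation Rp := (`[0, +oo[%classic : set (measurableTypeR R)).

(* The kernel is frozen on the negative half-line, where it could be singular. *)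
Definition kern (z : C) (l : measurableTypeR R) : C := ((Num.max l 0)%:C - z)^-1.

Lemma kern_coercive u z dl l : dir u z dl -> dl <= Re (u * ((Num.max l 0)%:C - z)).
Proof.
move=> [_ u0 _ hz]; rewrite mulrBr -mulNr ReD mulrC Re_mulC.
have : 0 <= Num.max l 0 * Re u by rewrite mulr_ge0// le_max lexx orbT.
by move: hz; lra.
Qed.

Lemma kern_neq0 u z dl (l : measurableTypeR R) : dir u z dl -> (Num.max l 0)%:C - z != 0 :> C.
Proof.
move=> hd; have := kern_coercive l hd; case: hd => _ _ d0 _.
by apply: contraTneq => ->; rewrite mulr0 -ltNge.
Qed.

Lemma kern_bound u z dl l : dir u z dl -> normc (kern z l) <= dl^-1.
Proof.
move=> hd; have h := kern_coercive l hd; case: (hd) => u1 _ d0 _.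
have b : dl <= normc ((Num.max l 0)%:C - z).
  by rewrite (le_trans h)// (le_trans (Re_ler _))// normcM normc1_n2// mul1r.
by rewrite /kern normcV lef_pV2 ?posrE// (lt_le_trans d0).
Qed.

Lemma bmeas_kern u z dl : dir u z dl -> bmeas (kern z).
Proof.
move=> hd; split; last by exists dl^-1 => l; exact: (kern_bound l hd).
apply: cmeas_inv; last by move=> l; exact: (kern_neq0 l hd).
apply: cmeasD; last exact: cmeas_cst.
by split; [exact: measurable_maxr|exact: measurable_cst].
Qed.

(** At fixed l the kernels at the points z - y u^* are 1 x 1 matrices satisfying the resolvent
    identity, so the interpolation applies to them with the same coefficients. *)
Lemma kern_approx u z dl (s : seq R) (al : R -> C) e : dir u z dl ->
  (forall n (F : R -> 'M[C]_n), resolvent_like u dl F -> opb e (F 0 - \sum_(y <- s) al y *: F y)) ->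
  forall l, normc (kern z l - \sum_(y <- s) al y * kern (z - y%:C * Num.conj u) l) <= e.
Proof.
move=> hd h l; pose F y : 'M[C]_1 := (kern (z - y%:C * Num.conj u) l)%:M.
have rF : resolvent_like u dl F.
  split=> [y y' y0 y0'|y y0].
    apply/matrixP => i j; rewrite !ord1 !mxE big_ord1 !mxE eqxx !mulr1n /kern.
    have := kern_neq0 l (dir_shift y0 hd); have := kern_neq0 l (dir_shift y0' hd).
    rewrite rmorphB/=; move: (Num.max l 0)%:C => a; move: (Num.conj u) => b n1 n2.
    by field; rewrite n1 n2.
  apply: opbP; first by rewrite invr_ge0 addr_ge0// ltW//; case: hd.
  move=> x; rewrite /F mul_scalar_mx nrmZ ler_wpM2r//.
  by have := kern_bound l (dir_shift y0 hd).
have [e0 _] := h _ _ rF.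
have := entry_nrm (F 0 - \sum_(y <- s) al y *: F y) 0 0.
have E : (F 0 - \sum_(y <- s) al y *: F y) 0 0 = kern z l - \sum_(y <- s) al y * kern (z - y%:C * Num.conj u) l.
  rewrite mxE /F mxE eqxx mulr1n mul0r subr0 mxE summxE; congr (_ - _).
  by apply: eq_bigr => y _; rewrite !mxE eqxx mulr1n.
rewrite E => b; apply: (le_trans b); have := opb_nrm1 (h _ _ rF).
by rewrite sqrtr1 mulr1.
Qed.

Variables (K : nat) (F : C -> 'M[C]_K).
Hypothesis hF : stieltjes_class F.

Lemma stieltjes_repr : exists q : 'cV[C]_K -> {finite_measure set (measurableTypeR R) -> \bar R},
  (forall x, fine (q x Rp) = fro2 x) /\
  forall u z dl, dir u z dl -> forall x, qf (F z) x = cintegral (q x) Rp (kern z).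
Proof.
have [mu [q [pm _ m1 hq]]] := hF; exists q; split.
  move=> x; have := pm x Rp (measurable_itv _); rewrite m1 -/(qf _ x) qf1 => e.
  by move: e => /(congr1 Re)/= ->.
move=> u z dl hd x.
have nz : ~~ (0 <= z).
  apply/negP => z0; case: hd => _ u0 d0; case: z z0 => a b; rewrite lecE/= => /andP[/eqP -> a0].
  by rewrite mulrC mulrN -[(a +i* 0)]/(a%:C) ReN Re_mulC; have := mulr_ge0 a0 u0; lra.
rewrite /qf (hq z nz x); rewrite /cintegral.
have E l : l \in Rp -> ((l%:C - z)^-1 : C) = kern z l.
  by rewrite inE/= in_itv/= andbT => l0; rewrite /kern; move/max_idPl: l0 => ->.
by congr (_ +i* _); apply: eq_Rintegral => l /E /= ->.
Qed.

(** Both inequalities hold for the kernel at each l and pass to the integral against the positive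
    measures [q x]. *)
Lemma stieltjes_pos u z dl : dir u z dl -> pos u z (F z).
Proof.
move=> hd; have [q [_ hq]] := stieltjes_repr; have bk := bmeas_kern hd.
have key v : (forall l, 0 <= Re (v * kern z l)) -> accr v (F z).
  by move=> h x; rewrite (hq u z dl hd x); apply: Re_cintegral_ge0.
have inv (x y : C) : x != 0 -> Re (y * x^-1) = (n2 x)^-1 * Re (y * Num.conj x).
  move=> x0; rewrite -Re_mulC; congr Re.
  have nx : ((n2 x)%:C : C) != 0 by rewrite -mulCJ mulf_neq0// conjC_eq0.
  have e : x * Num.conj x = (n2 x)%:C := mulCJ x.
  by rewrite fmorphV/= -e invfM -mulrA [y * Num.conj x]mulrC mulKf ?conjC_eq0// mulrC.
case: (hd) => u1 u0 d0 hz.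
split; apply: key => l; rewrite /kern inv ?(kern_neq0 l hd)//;
  rewrite mulr_ge0 ?invr_ge0// cjB cjC.
  have -> : Num.conj u * ((Num.max l 0)%:C - Num.conj z) = Num.conj (u * ((Num.max l 0)%:C - z)).
    by rewrite cjM cjB cjC.
  by rewrite ReJ (le_trans _ (kern_coercive l hd))// ltW.
have -> : - u * z * ((Num.max l 0)%:C - Num.conj z) = (Num.max l 0)%:C * (- u * z) + (n2 z)%:C * u.
  by rewrite -mulCJ; ring.
have m0 : 0 <= Num.max l 0 by rewrite le_max lexx orbT.
rewrite ReD !Re_mulC addr_ge0// mulr_ge0//.
by rewrite (le_trans _ hz)// ltW.
Qed.

(** F need not satisfy the resolvent identity, so the interpolation is performed on the kernel under
    the integral. This bounds the quadratic form by 2 e |x|^2, the mass of [q x] being |x|^2, and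
    [numerical_radius] costs the factor 4. *)
Lemma stieltjes_approx u z dl (s : seq R) (al : R -> C) e : dir u z dl -> all (>= 0) s ->
  (forall n (G : R -> 'M[C]_n), resolvent_like u dl G -> opb e (G 0 - \sum_(y <- s) al y *: G y)) ->
  opb (4 * (2 * e)) (F z - \sum_(y <- s) al y *: F (z - y%:C * Num.conj u)).
Proof.
move=> hd s0 h; have [q [q1 hq]] := stieltjes_repr.
have hk := kern_approx hd h.
have e0 : 0 <= e := le_trans (normc_ge0' _) (hk 0).
apply: numerical_radius; first exact: mulr_ge0.
move=> x.
pose G y l := al y * kern (z - (Num.max y 0)%:C * Num.conj u) l.
have bG y : bmeas (G y).
  apply: bmeasZ; apply: bmeas_kern (dir_shift _ hd).
  by rewrite le_max lexx orbT.
have hk' l : normc (kern z l - \sum_(y <- s) G y l) <= e.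
  rewrite (eq_big_seq (fun y => al y * kern (z - y%:C * Num.conj u) l)) ?hk// => y ys.
  by rewrite /G (max_idPl (allP s0 y ys)).
have mRp : measurable Rp by exact: measurable_itv.
have E : qf (F z - \sum_(y <- s) al y *: F (z - y%:C * Num.conj u)) x =
   cintegral (q x) Rp (fun l => kern z l - \sum_(y <- s) G y l).
  have bk := bmeas_kern hd; have bs := bmeas_sum s bG.
  have -> : (fun l => kern z l - \sum_(y <- s) G y l) = fun l => kern z l + (-1) * \sum_(y <- s) G y l.
    by apply/funext => l; rewrite mulN1r.
  rewrite (cintegralD (q x) mRp bk (bmeasZ (-1) bs)) (cintegralZ (q x) mRp (-1) bs) (cintegral_sum (q x) mRp s bG).
  rewrite qfD qfN mulN1r (hq u z dl hd x); congr (_ - _).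
  rewrite /qf mulmx_sumr mulmx_suml summxE; apply: eq_big_seq => y ys.
  have y0 : 0 <= y := allP s0 y ys.
  rewrite -scalemxAr -scalemxAl mxE /G (max_idPl y0) (cintegralZ (q x) mRp _ (bmeas_kern (dir_shift y0 hd))).
  by rewrite -(hq _ _ _ (dir_shift y0 hd) x).
rewrite E; have b := cintegral_bound (q x) mRp (e := e) (bmeasD (bmeas_kern hd) (bmeasZ (-1) (bmeas_sum s bG))).
rewrite q1 in b.
have -> : (fun l => kern z l - \sum_(y <- s) G y l) = fun l => kern z l + (-1) * \sum_(y <- s) G y l.
  by apply/funext => l; rewrite mulN1r.
rewrite -mulrA; apply: b => l; rewrite mulN1r; exact: hk'.
Qed.
End stieltjes.

(** * Convergence *)

Lemma l2norm_nrm (R : realType) n (x : 'cV[R[i]]_n) : l2norm x = nrm x.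
Proof. by rewrite /l2norm /nrm fro2_cV; congr Num.sqrt; apply: eq_bigr => i _; rewrite n2E. Qed.

Lemma spectral_norm_opb (R : realType) m n (A : 'M[R[i]]_(m, n)) (c : R) :
  spectral_norm A <= c -> opb c A.
Proof.
move=> hA.
pose E := [set l2norm (A *m x) | x in [set x : 'cV[R[i]]_n | l2norm x <= 1]].
have ub : has_sup E.
  split; first by exists (l2norm (A *m 0)), 0 => //=; rewrite l2norm_nrm nrm0.
  exists (nrm A) => _ [x /= x1 <-]; rewrite !l2norm_nrm in x1 *.
  by rewrite (le_trans (nrmM _ _))// ler_piMr.
have key (x : 'cV[R[i]]_n) : nrm x <= 1 -> nrm (A *m x) <= c.
  move=> x1; rewrite -l2norm_nrm; apply: le_trans hA.
  by apply: sup_ubound ub.2 _ _; exists x => //=; rewrite l2norm_nrm.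
have c0 : 0 <= c by have := key 0; rewrite mulmx0 !nrm0 ler01 => /(_ isT).
apply: opbP => // x.
have [x0|x0] := eqVneq (nrm x) 0.
  by rewrite (nrm_eq0 x0) mulmx0 !nrm0 mulr0.
have xp : 0 < nrm x by rewrite lt0r x0 nrm_ge0.
have := key ((nrm x)^-1%:C *: x); rewrite -scalemxAr !nrm_realZ ger0_norm ?invr_ge0//.
by rewrite mulVf// lexx => /(_ isT); rewrite mulrC ler_pdivrMr.
Qed.

Lemma tr_opb (R : realType) n (e a : R) (X A : 'M[R[i]]_n) : opb e X -> opb a A ->
  normc (\tr (X *m A)) <= e * a * n%:R.
Proof.
move=> hX hA; have [e0 _] := hX; have [a0 _] := hA.
apply: (le_trans (normc_trM _ _)).
have := ler_pM (nrm_ge0 _) (nrm_ge0 _) (opb_nrm1 hX) (opb_nrm1 hA).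
by rewrite mulrACA -expr2 sqr_sqrtr.
Qed.

Lemma tr_sub (R : realType) n (A B : 'M[R[i]]_n) : \tr (A - B) = \tr A - \tr B.
Proof. exact: raddfB. Qed.

Lemma tr_sub_sum (R : realType) n (I : Type) (s : seq I) (al : I -> R[i]) (X A : 'M[R[i]]_n) F :
  \tr ((X - \sum_(y <- s) al y *: F y) *m A) = \tr (X *m A) - \sum_(y <- s) al y * \tr (F y *m A).
Proof.
rewrite mulmxBl tr_sub; congr (_ - _); elim: s => [|y s ih].
  by rewrite !big_nil mul0mx mxtrace0.
by rewrite !big_cons mulmxDl mxtraceD -scalemxAl mxtraceZ ih.
Qed.

Lemma normc_sum (R : realType) (I : Type) (r : seq I) (F : I -> R[i]) :
  normc (\sum_(i <- r) F i) <= \sum_(i <- r) normc (F i).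
Proof.
elim: r => [|i r ih]; first by rewrite !big_nil /normc/= expr0n addr0 sqrtr0.
by rewrite !big_cons (le_trans (le_normcD _ _))// lerD2l.
Qed.

(** * Bias and fluctuations at fixed N *)

Section fixed_dimension.
Context (R : realType) d (Omega : measurableType d) (P : probability Omega R).
Variables (M L N : nat) (w : 'I_M -> nat -> Omega -> R[i]) (S : 'I_M -> R -> R) (Cs : R).
Local Notation C := R[i].
Local Notation n := (blockdim M L).
Hypothesis N0 : (0 < N)%N.
Hypothesis M0 : (0 < M)%N.
Hypothesis L0 : (0 < L)%N.
Hypothesis hv : circular_gaussian P (vfam w : 'I_M * 'I_(N + L - 1) -> Omega -> C).
Hypothesis mS : forall m, measurable_fun (`[0, 1] : set (measurableTypeR R)) (S m).
Hypothesis S0 : forall m nu, nu \in `[0, 1] -> 0 < S m nu.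
Hypothesis SC : forall m nu, nu \in `[0, 1] -> S m nu <= Cs.
Hypothesis cov : forall (m m' : 'I_M) (k k' : 'I_(N + L - 1)),
  cexpectation P (fun t => w m k t * (w m' k' t)^*) =
  fourier_coef (S m) (k%:Z - k'%:Z) / N%:R * (m == m')%:R.
Variable k4 : R.
Hypothesis k40 : 0 <= k4.
Hypothesis hk4 : forall d (T : measurableType d) (P : probability T R) (J : finType) (x : J -> T -> R),
  (forall a, gaussian_rv P (lin x a)) ->
  (forall a, (\int[P]_t (expR (lin x a t))%:E = \int[P]_t (expR (- lin x a t))%:E)%E) ->
  forall a v, (\int[P]_t (lin x a t ^+ 2)%:E = v%:E)%E ->
    (\int[P]_t (lin x a t ^+ 4)%:E <= (k4 * v ^+ 2)%:E)%E.
Variable kap : R.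
Hypothesis hkap : kap_N M L N Cs <= kap.
Variables (T : C -> 'M[C]_n) (Tt : C -> 'M[C]_N).
Hypothesis hT : stieltjes_class T.
Hypothesis hTt : stieltjes_class Tt.
Hypothesis eqT : forall z : C, ~~ (0 <= z) ->
  T z = - z^-1 *: invmx (1%:M + Psi L S (Tt z)^T).
Hypothesis eqTt : forall z : C, ~~ (0 <= z) ->
  Tt z = - z^-1 *: invmx (1%:M + ((M * L)%:R / N%:R) *: (Psibar N S (T z))^T).

Let nu := Wlaw N0 M0 L0 hv.
Let jg := Wlaw_gaussian N0 M0 L0 hv.
Let sym := Wlaw_sym N0 M0 L0 hv.
Let eta := eta_N L N Cs.
Let mW := mommx_Wm jg sym.
Local Notation Q z := (fun x => resolv z (@Wm R n N x)).

Let Cs0 : 0 <= Cs. Proof. exact: Cs_ge0 M0 S0 SC. Qed.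
Lemma eta_ge0 : 0 <= eta.
Proof. by rewrite /eta /eta_N mulr_ge0 ?divr_ge0. Qed.
Let kap0 : 0 <= kap.
Proof. by rewrite (le_trans _ hkap)// /kap_N mulr_ge0 ?addr_ge0 ?divr_ge0. Qed.

Let left_bound (x : 'cV[C]_n) : Er nu (fun v => fro2 ((Wm v)^H *m x)) <= kap * fro2 x.
Proof. by apply: (le_trans (Wlaw_left N0 M0 L0 hv mS S0 SC cov x)); rewrite ler_wpM2r. Qed.
Let right_bound (y : 'cV[C]_N) : Er nu (fun v => fro2 (Wm v *m y)) <= kap * fro2 y.
Proof. by apply: (le_trans (Wlaw_right N0 M0 L0 hv mS S0 SC cov y)); rewrite ler_wpM2r. Qed.

Lemma dir_nonpos (u z : C) dl : dir u z dl -> ~~ (0 <= z).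
Proof.
move=> [_ u0 d0 hz]; apply/negP; case: z hz => a b hz; rewrite lecE/= => /andP[/eqP b0 a0].
have := mulr_ge0 a0 u0; move: hz; rewrite b0 mulrC mulrN -[(a +i* 0)]/(a%:C) ReN Re_mulC; lra.
Qed.

Lemma mean_bound_far u z dl : dir u z dl -> 2 * n2 z * kap ^+ 2 <= dl ^+ 4 ->
  forall A, opb 1 A -> normc (\tr ((Emx nu (Q z) - T z) *m A)) <=
    2 * (Num.sqrt (master_cst k4 kap z dl) * (eta * n%:R)).
Proof.
move=> hd far; have nz := dir_nonpos hd.
apply: (@perturbed_fixpoint R u z dl n N kap hd (Kop nu) (Ktop nu) (KopB jg sym) (KtopB jg sym)
  (Kop_opb jg sym kap0 left_bound) (Ktop_opb jg sym kap0 right_bound)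
  (Kop_accr jg sym) (Ktop_accr jg sym) (Kop_adj jg sym) (Emx nu (Q z)) (T z) (Tt z)).
- exact: (pos_EQ jg sym hd).
- exact: (stieltjes_pos hT hd).
- exact: (stieltjes_pos hTt hd).
- by rewrite (Kop_Psi N0 M0 L0 hv mS S0 SC cov) eqT.
- by rewrite (Ktop_Psibar N0 M0 L0 hv mS S0 SC cov) eqTt.
- exact: far.
move=> A oA; apply: normc_le_sqr.
  by rewrite mulr_ge0 ?sqrtr_ge0// mulr_ge0// eta_ge0.
have h := master_bound jg sym k40 (hk4 jg sym) eta_ge0 kap0 (Wlaw_pseudo N0 M0 L0 hv)
  (Wlaw_trace N0 M0 L0 hv mS S0 SC cov) left_bound hd oA.
apply: (le_trans h); rewrite [leRHS]exprMn.
(* The square root of a negative number is 0 by convention; splitting on the sign avoids a proof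
   that the constant is nonnegative. *)
have [c0|c0] := leP 0 (master_cst k4 kap z dl); first by rewrite sqr_sqrtr.
by rewrite (@le_trans _ _ 0)// ?mulr_ge0 ?sqr_ge0// nmulr_rle0// sqr_ge0.
Qed.

Lemma resolvent_like_sample u z dl (W : 'M[C]_(n, N)) : dir u z dl ->
  resolvent_like u dl (fun y => resolv (z - y%:C * Num.conj u) W).
Proof.
move=> hd; split=> [y y' y0 y0'|y y0]; last first.
  by have [_ o _ _ _] := resolvP (dir_shift y0 hd) W.
have [u1 _ _ _ _] := resolvP (dir_shift y0 hd) W.
have [u2 _ _ _ _] := resolvP (dir_shift y0' hd) W.
have zE (a b e : 'M[C]_n) : a - e - (a - b) = b - e by rewrite opprB addrC addrA subrK.
rewrite (resolv_id u1 u2) zE -raddfB/=.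
rewrite mul_mx_scalar -scalemxAl; congr (_ *: _).
by rewrite rmorphB/=; ring.
Qed.

Definition approx_cst (s : seq R) (al : R -> C) (u z : C) dl : R :=
  \sum_(y <- s) normc (al y) * (2 * Num.sqrt (master_cst k4 kap (z - y%:C * Num.conj u) (dl + y))).

(* z is reached from far points z - y u^*, y in s, by interpolation; the
   coefficients do not depend on N, hence no compactness argument is needed. *)
Lemma mean_bound u z dl (s : seq R) (al : R -> C) e : dir u z dl ->
  (forall y, y \in s -> 0 <= y /\ 2 * n2 (z - y%:C * Num.conj u) * kap ^+ 2 <= (dl + y) ^+ 4) ->
  (forall n (G : R -> 'M[C]_n), resolvent_like u dl G -> opb e (G 0 - \sum_(y <- s) al y *: G y)) ->
  forall A, opb 1 A -> normc (\tr ((Emx nu (Q z) - T z) *m A)) <=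
    10 * e * n%:R + approx_cst s al u z dl * (eta * n%:R).
Proof.
move=> hd hs happ A oA.
pose zz y := z - y%:C * Num.conj u.
have s0 : all (>= 0) s by apply/allP => y /hs [].
(* [zp] agrees with [zz] on the nodes and remains admissible for every real y, so that moments exist
   for all indices of the sums. *)
pose zp y := z - (Num.max y 0)%:C * Num.conj u.
have yp (y : R) : 0 <= Num.max y 0 by rewrite le_max lexx orbT.
have zzE y : y \in s -> zz y = zp y by move=> /hs[y0 _]; rewrite /zz /zp (max_idPl y0).
have mQ y := mommx_resolv (dir_shift (yp y) hd) mW.
have mQ0 := mommx_resolv hd mW.
have mf z' : mommx nu (Q z') -> mom nu (fun x => \tr (resolv z' (Wm x) *m A)).
  by move=> h; apply: mom_tr; apply: mommxM => //; exact: mommx_cst.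
have trE z' : mommx nu (Q z') -> \tr (Emx nu (Q z') *m A) = Ec nu (fun x => \tr (resolv z' (Wm x) *m A)).
  move=> h; rewrite Ec_tr; last by apply: mommxM => //; exact: mommx_cst.
  by rewrite EmxMr.
(* The interpolation error of E Q, that of T, and the comparison at the far points. The first two
   contribute 2 e n and 8 e n, whence the 10. *)
have decomp : \tr ((Emx nu (Q z) - T z) *m A) =
    (\tr (Emx nu (Q z) *m A) - \sum_(y <- s) al y * \tr (Emx nu (Q (zp y)) *m A))
    - \tr ((T z - \sum_(y <- s) al y *: T (zz y)) *m A)
    + \sum_(y <- s) al y * \tr ((Emx nu (Q (zp y)) - T (zp y)) *m A).
  have e1 : \tr ((T z - \sum_(y <- s) al y *: T (zz y)) *m A) =
      \tr (T z *m A) - \sum_(y <- s) al y * \tr (T (zp y) *m A).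
    rewrite tr_sub_sum; congr (_ - _).
    by apply: eq_big_seq => y ys; rewrite zzE.
  have e2 : \sum_(y <- s) al y * \tr ((Emx nu (Q (zp y)) - T (zp y)) *m A) =
      \sum_(y <- s) al y * \tr (Emx nu (Q (zp y)) *m A) - \sum_(y <- s) al y * \tr (T (zp y) *m A).
    by rewrite -sumrB; apply: eq_bigr => y _; rewrite mulmxBl tr_sub mulrBr.
  by rewrite mulmxBl tr_sub e1 e2; ring.
have b1 : normc (\tr (Emx nu (Q z) *m A) - \sum_(y <- s) al y * \tr (Emx nu (Q (zp y)) *m A)) <= 2 * (e * 1 * n%:R).
  have m1 y : mom nu (fun x => al y * \tr (resolv (zp y) (Wm x) *m A)) := momM (mom_cst nu (al y)) (mf _ (mQ y)).
  have B1 := EcB (mf _ mQ0) (mom_sum s xpredT m1).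
  have -> : \tr (Emx nu (Q z) *m A) - \sum_(y <- s) al y * \tr (Emx nu (Q (zp y)) *m A) =
      Ec nu (fun x => \tr ((resolv z (Wm x) - \sum_(y <- s) al y *: resolv (zz y) (Wm x)) *m A)).
    have S1 : \sum_(y <- s) al y * \tr (Emx nu (Q (zp y)) *m A) =
        Ec nu (fun x => \sum_(y <- s) al y * \tr (resolv (zp y) (Wm x) *m A)).
      transitivity (\sum_(y <- s) Ec nu (fun x => al y * \tr (resolv (zp y) (Wm x) *m A))).
        apply: eq_bigr => y _; rewrite (trE _ (mQ y)); symmetry; exact: (EcZ (al y) (mf _ (mQ y))).
      by symmetry; exact: (Ec_sum s xpredT m1).
    transitivity (Ec nu (fun x => \tr (resolv z (Wm x) *m A)) -
        Ec nu (fun x => \sum_(y <- s) al y * \tr (resolv (zp y) (Wm x) *m A))).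
      by congr (_ - _); [exact: trE|exact: S1].
    rewrite -B1.
    apply: eq_Ec => x; rewrite tr_sub_sum; congr (_ - _).
    by apply: eq_big_seq => y ys; rewrite zzE.
  have mF : mom nu (fun x => \tr ((resolv z (Wm x) - \sum_(y <- s) al y *: resolv (zz y) (Wm x)) *m A)).
    apply: (eq_mom (F := fun x => \tr (resolv z (Wm x) *m A) - \sum_(y <- s) al y * \tr (resolv (zp y) (Wm x) *m A))).
      move=> x; rewrite tr_sub_sum; congr (_ - _).
      by apply: eq_big_seq => y ys; rewrite zzE.
    exact: (momB (mf _ mQ0) (mom_sum s xpredT m1)).
  apply: (le_trans (Ec_norm_le mF (rmom_cst nu (e * 1 * n%:R)) _)); last by rewrite Er_cst.
  move=> x; apply: tr_opb => //.
  have := happ _ _ (resolvent_like_sample (Wm x) hd).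
  by rewrite mul0r subr0.
have b2 := tr_opb (stieltjes_approx hT hd s0 happ) oA.
have b3 : normc (\sum_(y <- s) al y * \tr ((Emx nu (Q (zp y)) - T (zp y)) *m A)) <= approx_cst s al u z dl * (eta * n%:R).
  apply: (le_trans (normc_sum _ _)); rewrite /approx_cst mulr_suml.
  rewrite big_seq [leRHS]big_seq; apply: ler_sum => y ys.
  rewrite normcM -mulrA ler_wpM2l// -mulrA; have [y0 far] := hs y ys.
  rewrite -zzE//; exact: (mean_bound_far (dir_shift y0 hd) far oA).
rewrite decomp (le_trans (le_normcD _ _))// lerD//.
rewrite (le_trans (le_normcD _ _))// normcN.
apply: (le_trans (lerD b1 b2)); lra.
Qed.

Definition fluctuation z (A : 'M[C]_n) t : C :=
  \tr (resolv z (Wt L N w t) *m A) - \tr (Emx nu (Q z) *m A).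

Lemma fluctuation_bound u z dl A : dir u z dl ->
  rmom P (fun t => n2 (fluctuation z A t) ^+ 2) /\
  Er P (fun t => n2 (fluctuation z A t) ^+ 2) <= 128 * (64 * k4) *
    (eta * ((dl^-1 + normc z * dl^-2) * dl^-2 * fro2 A)) ^+ 2.
Proof.
move=> hd; have mQ0 := mommx_resolv hd mW.
have mf : mom nu (fun x => \tr (resolv z (Wm x) *m A)).
  by apply: mom_tr; apply: mommxM => //; exact: mommx_cst.
have h := rmomX 2 (rmom_n2 (momB mf (mom_cst nu (Ec nu (fun x => \tr (resolv z (Wm x) *m A)))))).
have inv B (mB : measurable B) : P (Xt w @^-1` B) = nu B := erefl.
have E : (fun t => n2 (fluctuation z A t) ^+ 2) = fun t =>
    n2 (\tr (resolv z (@Wm R n N (Xt w t)) *m A) - Ec nu (fun x => \tr (resolv z (Wm x) *m A))) ^+ 2.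
  apply/funext => t; rewrite /fluctuation Wm_Xt Ec_tr; last by apply: mommxM => //; exact: mommx_cst.
  by rewrite EmxMr.
rewrite E; split; first exact: (rmom_push (measurable_Xt N0 M0 L0 hv) inv h).
rewrite (Er_push (measurable_Xt N0 M0 L0 hv) inv h.1).
exact: (concentration4 jg sym k40 (hk4 jg sym) eta_ge0 (Wlaw_trace N0 M0 L0 hv mS S0 SC cov) hd).
Qed.

End fixed_dimension.

(** * Almost sure convergence from summable moments *)

Section almost_sure.
Context (R : realType) d (Omega : measurableType d) (P : probability Omega R).

Lemma sum_inverse_squares (c : R) n : 0 <= c ->
  \sum_(0 <= k < n) c / k.+1%:R ^+ 2 <= 2 * c.
Proof.
move=> c0.
have key m : \sum_(0 <= k < m.+1) c / k.+1%:R ^+ 2 <= 2 * c - c / m.+1%:R.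
  elim: m => [|m ih]; first by rewrite big_nat1 expr1n divr1; lra.
  rewrite big_nat_recr//=; apply: (le_trans (lerD ih (lexx _))).
  suff : c / m.+2%:R ^+ 2 <= c / m.+1%:R - c / m.+2%:R.
    by move: (c / m.+2%:R ^+ 2) (c / m.+1%:R) (c / m.+2%:R) => x y v; lra.
  have m1 : 0 < m.+1%:R :> R by rewrite ltr0n.
  have m2 : (m.+2%:R : R) = m.+1%:R + 1 by rewrite -natr1.
  have -> : c / m.+1%:R - c / m.+2%:R = c / (m.+1%:R * m.+2%:R).
    by rewrite m2; field; rewrite !gt_eqF//; lra.
  rewrite ler_wpM2l// lef_pV2 ?posrE ?mulr_gt0 ?exprn_gt0 ?ltr0n//.
  by rewrite expr2 ler_wpM2r ?ler0n// ler_nat.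
case: n => [|n]; first by rewrite big_geq// mulr_ge0.
by apply: (le_trans (key n)); rewrite gerBl divr_ge0.
Qed.

(** The sum of the Y k has finite expectation, so it is finite almost everywhere and its terms tend
    to 0. One null set serves for all e. *)
Lemma ae_small (Y : nat -> Omega -> R) (c : R) : (forall k, rmom P (Y k)) ->
  (forall k t, 0 <= Y k t) -> (forall k, Er P (Y k) <= c / k.+1%:R ^+ 2) ->
  {ae P, forall t, forall e : R, 0 < e -> exists K, forall k, (K <= k)%N -> Y k t < e}.
Proof.
move=> mY Y0 hY.
have c0 : 0 <= c.
  have h := hY 0%N; rewrite expr1n divr1 in h; apply: le_trans h.
  by apply: Er_ge0 => t; exact: Y0.
have mE k : measurable_fun setT (fun t => (Y k t)%:E) by apply/measurable_EFinP; case: (mY k).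
have YE k t : (0 <= (Y k t)%:E)%E by rewrite lee_fin.
pose S t := (\sum_(k <oo) (Y k t)%:E)%E.
have S0 t : (0 <= S t)%E by apply: nneseries_ge0 => k _ _; exact: YE.
have mS : measurable_fun setT S by apply: ge0_emeasurable_sum => [k t _ _|k _].
have IS : (\int[P]_t S t < +oo)%E.
  rewrite /S integral_nneseries//.
  apply: (@le_lt_trans _ _ (2 * c)%:E); last by rewrite ltry.
  apply: lime_le; first by apply: is_cvg_nneseries => k _ _; apply: integral_ge0 => t _; exact: YE.
  apply: nearW => m.
  under eq_bigr do rewrite -Er_EFin//.
  rewrite sumEFin lee_fin; apply: (le_trans _ (sum_inverse_squares m c0)).
  by apply: ler_sum => k _; exact: hY.
have intS : P.-integrable setT S.
  apply/integrableP; split=> //; rewrite (eq_integral S)// => t _.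
  by rewrite gee0_abs.
have := integrable_ae measurableT intS; apply: filterS => t /(_ I) fS e e0.
have cvgY : cvgn (series (fun k => Y k t)).
  apply: nondecreasing_is_cvgn.
    by apply: nondecreasing_series => k _ _; exact: Y0.
  exists (fine (S t)) => _ [m _ <-]; rewrite -lee_fin fineK// /series/= -sumEFin.
  by apply: nneseries_lim_ge => k _ _; exact: YE.
have /cvgrPdist_lt/(_ e e0) [K _ hK] := cvg_series_cvg_0 cvgY.
exists K => k Kk; have := hK k Kk; rewrite /= sub0r normrN.
by rewrite ger0_norm.
Qed.

Lemma cvg0_normc (g : nat -> R[i]) :
  (forall e : R, 0 < e -> exists K, forall k, (K <= k)%N -> normc (g k) < e) ->
  (g : nat -> R[i]^o) @ \oo --> (0 : R[i]^o).
Proof.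
move=> h; apply/cvgrPdist_lt => e e0.
(* In the order of C, a positive e is a positive real. *)
have eR : e = (complex.Re e)%:C by move: e0; case: (e) => a b; rewrite ltcE/= => /andP[/eqP -> _].
have e1 : 0 < complex.Re e by move: e0; rewrite {1}eR ltcR.
have [K hK] := h _ e1; exists K => // k Kk /=.
by rewrite sub0r normrN eR -[`|_|]/((normc (g k))%:C) ltcR; exact: hK.
Qed.
End almost_sure.

(** * Passage to the limit in N *)

Section large_dimension.
Context (R : realType) d (Omega : measurableType d) (P : probability Omega R).
Variables (M L : nat -> nat) (c : R) (S : forall K : nat, 'I_K -> R -> R) (Cs : R).
Variables (w : forall N : nat, 'I_(M N) -> nat -> Omega -> R[i]).
Variables (T : forall N : nat, R[i] -> 'M[R[i]]_(blockdim (M N) (L N)))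
  (Tt : forall N : nat, R[i] -> 'M[R[i]]_N).
Hypothesis ML : forall N, (0 < N)%N -> (0 < M N)%N /\ (0 < L N)%N.
Hypothesis Moo : M @ \oo --> \oo.
Hypothesis cvgc : (fun N => (M N * L N)%:R / N%:R : R) @ \oo --> c.
Hypothesis mS : forall K (m : 'I_K),
  measurable_fun (`[0, 1] : set (measurableTypeR R)) (S m).
Hypothesis S0 : forall K (m : 'I_K) nu, nu \in `[0, 1] -> 0 < S m nu.
Hypothesis SC : forall K (m : 'I_K) nu, nu \in `[0, 1] -> S m nu <= Cs.
Hypothesis gaussian : forall N, (0 < N)%N ->
  circular_gaussian P (vfam (@w N) : 'I_(M N) * 'I_(N + L N - 1) -> Omega -> R[i]).
Hypothesis cov : forall N, (0 < N)%N ->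
  forall (m m' : 'I_(M N)) (k k' : 'I_(N + L N - 1)),
    cexpectation P (fun t => w m k t * (w m' k' t)^*) =
    fourier_coef (S m) (k%:Z - k'%:Z) / N%:R * (m == m')%:R.
Hypothesis hT : forall N, (0 < N)%N -> stieltjes_class (@T N).
Hypothesis hTt : forall N, (0 < N)%N -> stieltjes_class (@Tt N).
Hypothesis eqT : forall N, (0 < N)%N -> forall z : R[i], ~~ (0 <= z) ->
  T N z = - z^-1 *: invmx (1%:M + Psi (L N) (@S (M N)) (Tt N z)^T).
Hypothesis eqTt : forall N, (0 < N)%N -> forall z : R[i], ~~ (0 <= z) ->
  Tt N z = - z^-1 *: invmx (1%:M +
    ((M N * L N)%:R / N%:R) *: (Psibar N (@S (M N)) (T N z))^T).
Variables (A : forall N, 'M[R[i]]_(blockdim (M N) (L N))) (a : R).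
Hypothesis a0 : 0 < a.
Hypothesis opA : forall N, (0 < N)%N -> opb a (A N).

Definition mean_resolvent N (N0 : (0 < N)%N) z :=
  Emx (Wlaw N0 (ML N0).1 (ML N0).2 (gaussian N0)) (fun x => resolv z (Wm x)).

Let Cs0 : 0 <= Cs.
Proof. exact: (Cs_ge0 (ML (ltn0Sn 0)).1 (@S0 _) (@SC _)). Qed.

Let c0 : 0 <= c.
Proof. by apply: (cvgr_to_ge cvgc); apply: nearW => N; rewrite divr_ge0. Qed.

Let ratio_le : exists K, forall N, (K <= N)%N -> (M N * L N)%:R / N%:R <= c + 1.
Proof.
have [K _ hK] : \forall N \near \oo, (M N * L N)%:R / N%:R <= c + 1.
  by apply: (cvgr_le _ cvgc); rewrite ltrDl.
by exists K => N /hK.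
Qed.

Let dim_ge k : exists K, forall N, (K <= N)%N -> (k <= M N)%N.
Proof.
have /cvgnyPge/(_ k)[K _ hK] := Moo.
by exists K => N /hK.
Qed.

(** The order of choices matters: [kap] is fixed for all large N, then the nodes and coefficients
    are chosen from z, e and [kap], and only then is N taken large, so that the far-point errors, of
    order 1 / M, overcome the size of the coefficients. *)
Lemma mean_vanishes z : ~~ (0 <= z) -> forall e : R, 0 < e ->
  exists K, forall N (N0 : (0 < N)%N), (K <= N)%N ->
    normc ((M N * L N)%:R^-1 * \tr ((mean_resolvent N0 z - T N z) *m A N)) < e.
Proof.
move=> nz e e0; have [u [dl hd]] := exists_dir nz; have [u1 _ d0 _] := hd.
have [k4 k40 hk4] := gaussian_fourth_moment R.
have [K1 hK1] := ratio_le.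
(* Eventually ML / N <= c + 1, and then [kap_N] is at most this number. *)
pose kap := Cs * (2 + c).
have kap0 : 0 <= kap by rewrite mulr_ge0// addr_ge0.
(* For y > y0 one has |z - y u^*| <= 2 y and 3 kap <= y, so 2 |z - y u^*|^2 kap^2 <= 8 y^2 kap^2 <=
   y^4: every node is in the region of contraction. *)
pose y0 := normc z + 3 * kap.
have nz0 : 0 <= normc z := normc_ge0' z.
have y00 : 0 <= y0 by rewrite addr_ge0// mulr_ge0.
(* The interpolation error enters as 10 a times this number, that is e / 2. *)
have e'0 : 0 < e / (20 * a) by rewrite divr_gt0// mulr_gt0.
have [s [al [hs happ]]] := rational_approx u1 d0 y00 e'0.
pose c1 := `|approx_cst k4 kap s al u z dl|.
have c10 : 0 <= c1 := normr_ge0 _.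
(* M > b makes a c1 eta smaller than the other e / 2, since eta <= Cs (c + 1) / M for large N. *)
pose b := 2 * a * c1 * (Cs * (c + 1)) / e.
have b0 : 0 <= b by rewrite divr_ge0 ?(ltW e0)// !mulr_ge0 ?addr_ge0// ltW.
have [K2 hK2] := dim_ge (Num.bound b).
exists (maxn K1 K2) => N N0; rewrite geq_max => /andP[/hK1 rN /hK2 MN].
have [M0 L0] := ML N0.
have bM : b < (M N)%:R by apply: (lt_le_trans (archi_boundP b0)); rewrite ler_nat.
have n0 : 0 < (M N * L N)%:R :> R by rewrite ltr0n muln_gt0 M0.
have hkap : kap_N (M N) (L N) N Cs <= kap.
  by rewrite /kap_N /kap ler_wpM2l// blockdimE; move: rN; move: (_ / _) => x; lra.
have far y : y \in s -> 0 <= y /\ 2 * n2 (z - y%:C * Num.conj u) * kap ^+ 2 <= (dl + y) ^+ 4.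
  move=> /(allP hs) ys; have yp : 0 <= y by rewrite (le_trans y00)// ltW.
  split=> //.
  have h1 : normc (z - y%:C * Num.conj u) <= 2 * y.
    apply: (le_trans (le_normcD _ _)); rewrite normcN normcM normcJ' (normc1_n2 u1) mulr1.
    rewrite normc_real ger0_norm//; move: ys; rewrite /y0; lra.
  have h2 : 3 * kap <= y by move: ys; rewrite /y0; lra.
  have h3 : n2 (z - y%:C * Num.conj u) <= (2 * y) ^+ 2.
    by rewrite n2E; apply: expr_mono => //; exact: normc_ge0'.
  have h4 : (3 * kap) ^+ 2 <= y ^+ 2 by apply: expr_mono => //; rewrite mulr_ge0.
  have h5 : y ^+ 4 <= (dl + y) ^+ 4 by apply: expr_mono => //; rewrite lerDr ltW.
  apply: le_trans h5.
  have h6 : 2 * n2 (z - y%:C * Num.conj u) * kap ^+ 2 <= 2 * (2 * y) ^+ 2 * kap ^+ 2.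
    by rewrite ler_wpM2r ?sqr_ge0// ler_wpM2l.
  apply: (le_trans h6).
  have h7 : y ^+ 2 * (3 * kap) ^+ 2 <= y ^+ 2 * y ^+ 2 by rewrite ler_wpM2l ?sqr_ge0.
  have k2 : 0 <= y ^+ 2 * kap ^+ 2 by rewrite mulr_ge0 ?sqr_ge0.
  have E1 : 2 * (2 * y) ^+ 2 * kap ^+ 2 = 8 * (y ^+ 2 * kap ^+ 2) by ring.
  have E2 : y ^+ 2 * (3 * kap) ^+ 2 = 9 * (y ^+ 2 * kap ^+ 2) by ring.
  have E3 : y ^+ 2 * y ^+ 2 = y ^+ 4 by ring.
  by rewrite E1 -E3; apply: le_trans h7; rewrite E2; lra.
have oA1 : opb 1 ((a^-1)%:C *: A N).
  have := opbZ (a^-1)%:C (opA N0).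
  by rewrite normc_real ger0_norm ?invr_ge0 ?ltW// mulVf// gt_eqF.
have h := mean_bound N0 M0 L0 (gaussian N0) (@mS _) (@S0 _) (@SC _) (cov N0) k40 hk4 hkap
  (hT N0) (hTt N0) (eqT N0) (eqTt N0) hd far happ oA1.
have {h} : normc (\tr ((mean_resolvent N0 z - T N z) *m A N)) <=
    a * (10 * (e / (20 * a)) * (blockdim (M N) (L N))%:R
    + c1 * (eta_N (L N) N Cs * (blockdim (M N) (L N))%:R)).
  have ia : `|a^-1| = a^-1 by rewrite ger0_norm// invr_ge0 ltW.
  rewrite -scalemxAr mxtraceZ normcM normc_real ia in h.
  rewrite ler_pdivrMl// in h; apply: (le_trans h); rewrite ler_wpM2l ?(ltW a0)//.
  rewrite lerD2l ler_wpM2r ?ler_norm// mulr_ge0//.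
  by rewrite /eta_N mulr_ge0 ?divr_ge0.
have bE : (blockdim (M N) (L N))%:R = (M N * L N)%:R :> R by rewrite blockdimE.
rewrite bE => h.
have normn : normc ((M N * L N)%:R^-1 : R[i]) = (M N * L N)%:R^-1.
  have -> : ((M N * L N)%:R^-1 : R[i]) = ((M N * L N)%:R^-1)%:C by rewrite rmorphV/= ?rmorph_nat// unitfE gt_eqF.
  by rewrite normc_real ger0_norm// invr_ge0 ltW.
rewrite normcM normn ltr_pdivrMl//; apply: (le_lt_trans h).
have Mp : 0 < (M N)%:R :> R by rewrite ltr0n.
have etaM : eta_N (L N) N Cs <= Cs * (c + 1) / (M N)%:R.
  rewrite /eta_N ler_pdivlMr//.
  have -> : Cs / N%:R * (L N)%:R * (M N)%:R = Cs * ((M N * L N)%:R / N%:R) by rewrite natrM; ring.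
  by rewrite ler_wpM2l.
have hc : c1 * eta_N (L N) N Cs < e / (2 * a).
  apply: (le_lt_trans (ler_wpM2l c10 etaM)).
  rewrite mulrA ltr_pdivrMr//.
  have := bM; rewrite /b ltr_pdivrMr// => hb.
  rewrite -(ltr_pM2l (_ : 0 < 2 * a)) ?mulr_gt0//.
  have -> : 2 * a * (e / (2 * a) * (M N)%:R) = (M N)%:R * e by field; rewrite gt_eqF.
  by apply: le_lt_trans hb; rewrite mulrA.
have -> : a * (10 * (e / (20 * a)) * (M N * L N)%:R + c1 * (eta_N (L N) N Cs * (M N * L N)%:R)) =
   (M N * L N)%:R * (e / 2 + a * (c1 * eta_N (L N) N Cs)) by field; rewrite gt_eqF.
rewrite ltr_pM2l//.
have : a * (c1 * eta_N (L N) N Cs) < e / 2.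
  by rewrite -(ltr_pM2l a0) in hc; apply: (lt_le_trans hc); rewrite le_eqVlt; apply/orP; left; apply/eqP; field; rewrite gt_eqF.
move: (a * _) => x; lra.
Qed.

(** With n = ML, the fourth moment of the normalized trace is at most a constant times (eta |A|_F^2
    / n^2)^2. Since |A|_F^2 <= a^2 n and eta = Cs L / N, the inner quantity is O(1 / (M N)), hence
    O(1 / N), and [ae_small] applies. *)
Lemma fluctuation_vanishes z : ~~ (0 <= z) ->
  {ae P, forall t, forall e : R, 0 < e -> exists K, forall N (N0 : (0 < N)%N), (K <= N)%N ->
    normc ((M N * L N)%:R^-1 * (\tr (resolv z (Wt (L N) N (@w N) t) *m A N)
      - \tr (mean_resolvent N0 z *m A N))) < e}.
Proof.
move=> nz; have [u [dl hd]] := exists_dir nz; have [u1 _ d0 _] := hd.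
have [k4 k40 hk4] := gaussian_fourth_moment R.
pose X N (N0 : (0 < N)%N) t : R[i] := (M N * L N)%:R^-1 *
  fluctuation N0 (ML N0).1 (ML N0).2 (gaussian N0) z (A N) t.
(* The sequence starts at N = 1; the proofs that N is positive, on which [mean_resolvent] depends,
   are identified by proof irrelevance below. *)
pose Y k t : R := n2 (X k.+1 (ltn0Sn k) t) ^+ 2.
pose Kc := (dl^-1 + normc z * dl^-2) * dl^-2.
have Kc0 : 0 <= Kc by rewrite mulr_ge0 ?addr_ge0 ?mulr_ge0 ?normc_ge0' ?invr_ge0 ?exprn_ge0// ltW.
have n2q N : n2 ((M N * L N)%:R^-1 : R[i]) = (M N * L N)%:R^-2.
  rewrite n2E.
  have -> : ((M N * L N)%:R^-1 : R[i]) = ((M N * L N)%:R^-1)%:C by rewrite fmorphV/= rmorph_nat.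
  by rewrite normc_real ger0_norm ?invr_ge0// exprVn.
have hY k : rmom P (Y k) /\ Er P (Y k) <= 128 * (64 * k4) * (Cs * Kc * a ^+ 2) ^+ 2 / k.+1%:R ^+ 2.
  have N0 := ltn0Sn k; have [M0 L0] := ML N0.
  have [mF hF] := fluctuation_bound N0 (ML N0).1 (ML N0).2 (gaussian N0) (@mS _) (@S0 _) (@SC _) (cov N0) k40 hk4 (A k.+1) hd.
  pose q : R := (M k.+1 * L k.+1)%:R^-2 ^+ 2.
  have YE : Y k = fun t => q * n2 (fluctuation (ltn0Sn k) (ML (ltn0Sn k)).1 (ML (ltn0Sn k)).2 (gaussian (ltn0Sn k)) z (A k.+1) t) ^+ 2.
    by apply/funext => t; rewrite /Y /X n2M exprMn n2q.
  have irr : N0 = ltn0Sn k by exact: eq_irrelevance.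
  rewrite irr in mF hF.
  rewrite YE; split; first exact: (rmomM (rmom_cst P q) mF).
  rewrite (ErZ q mF).
  have q0 : 0 <= q by rewrite sqr_ge0.
  apply: (le_trans (ler_wpM2l q0 hF)).
  set n : R := (M k.+1 * L k.+1)%:R.
  have n0 : 0 < n by rewrite ltr0n muln_gt0 M0.
  have -> : q * (128 * (64 * k4) * (eta_N (L k.+1) k.+1 Cs * (Kc * fro2 (A k.+1))) ^+ 2) =
     128 * (64 * k4) * (n ^- 2 * (eta_N (L k.+1) k.+1 Cs * (Kc * fro2 (A k.+1)))) ^+ 2.
    by rewrite /q -/n; ring.
  rewrite -[leRHS]mulrA -exprVn -exprMn.
  rewrite ler_wpM2l//; first by rewrite !mulr_ge0.
  have eta0 : 0 <= eta_N (L k.+1) k.+1 Cs by rewrite /eta_N mulr_ge0 ?divr_ge0.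
  apply: expr_mono; first by rewrite mulr_ge0 ?invr_ge0 ?sqr_ge0// mulr_ge0// mulr_ge0// fro2_ge0.
  have hA : fro2 (A k.+1) <= a ^+ 2 * n.
    by rewrite /n -blockdimE; exact: opb_fro (opA N0).
  rewrite ler_pdivrMl ?exprn_gt0//.
  apply: (le_trans (ler_wpM2l eta0 (ler_wpM2l Kc0 hA))).
  have k1 : 0 < k.+1%:R :> R by rewrite ltr0n.
  have Mp : 1 <= (M k.+1)%:R :> R by rewrite ler1n.
  have Lp : 0 < (L k.+1)%:R :> R by rewrite ltr0n.
  rewrite /eta_N.
  have -> : Cs / k.+1%:R * (L k.+1)%:R * (Kc * (a ^+ 2 * n)) =
    (Cs * Kc * a ^+ 2 / k.+1%:R * n) * (L k.+1)%:R by ring.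
  have -> : n ^+ 2 * (Cs * Kc * a ^+ 2 / k.+1%:R) = (Cs * Kc * a ^+ 2 / k.+1%:R * n) * n by ring.
  rewrite ler_wpM2l//.
    exact: (mulr_ge0 (divr_ge0 (mulr_ge0 (mulr_ge0 Cs0 Kc0) (sqr_ge0 a)) (ltW k1)) (ltW n0)).
  by rewrite /n ler_nat leq_pmull.
have := ae_small (fun k => (hY k).1) (fun k t => sqr_ge0 _) (fun k => (hY k).2).
apply: filterS => t ht e e0.
have [K hK] := ht (e ^+ 4) (exprn_gt0 _ e0).
exists K.+1 => -[//|k] N0 Kk; have /= := hK k Kk.
rewrite /Y /X (_ : ltn0Sn k = N0); last exact: eq_irrelevance.
rewrite /fluctuation -/(mean_resolvent N0 z); set x := _ * _ => hx.
have {}hx : normc x ^+ 4 < e ^+ 4 by rewrite (_ : 4 = 2 * 2)%N// exprM -n2E.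
by move: hx; rewrite ltr_pXn2r// nnegrE ?normc_ge0'// ltW.
Qed.

Lemma trace_cvg z : ~~ (0 <= z) -> {ae P, forall t,
  (fun N => (M N * L N)%:R^-1 * \tr ((resolv z (Wt (L N) N (@w N) t) - T N z) *m A N) : R[i]^o)
    @ \oo --> (0 : R[i]^o)}.
Proof.
move=> nz; have := fluctuation_vanishes nz; apply: filterS => t ht.
apply: cvg0_normc => e e0.
have e2 : 0 < e / 2 by rewrite divr_gt0.
have [K1 hK1] := ht _ e2; have [K2 hK2] := mean_vanishes nz e2.
exists (maxn 1 (maxn K1 K2)) => N; rewrite !geq_max => /and3P[N0 /(hK1 _ N0) h1 /(hK2 _ N0) h2].
have -> : \tr ((resolv z (Wt (L N) N (@w N) t) - T N z) *m A N) =
    (\tr (resolv z (Wt (L N) N (@w N) t) *m A N) - \tr (mean_resolvent N0 z *m A N))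
    + \tr ((mean_resolvent N0 z - T N z) *m A N).
  by rewrite !mulmxBl !tr_sub addrA subrK.
rewrite mulrDr; apply: (le_lt_trans (le_normcD _ _)).
by have := ltrD h1 h2; rewrite -splitr.
Qed.
End large_dimension.

Lemma spectral_norm_scalar1 (R : realType) n : spectral_norm (1%:M : 'M[R[i]]_n) <= 1.
Proof.
apply: ge_sup; first by exists (l2norm (1%:M *m (0 : 'cV[R[i]]_n))), 0 => //=; rewrite l2norm_nrm nrm0 ler01.
by move=> _ [x /= x1 <-]; rewrite mul1mx.
Qed.

Theorem mainTheorem1 (R : realType)
    (d : measure_display) (Omega : measurableType d) (P : probability Omega R)
    (M L : nat -> nat) (c : R)
    (S : forall K : nat, 'I_K -> R -> R)
    (w : forall N : nat, 'I_(M N) -> nat -> Omega -> R[i])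
    (T : forall N : nat, R[i] -> 'M[R[i]]_(blockdim (M N) (L N)))
    (Tt : forall N : nat, R[i] -> 'M[R[i]]_N) :
  (forall N, (0 < N)%N -> (0 < M N)%N /\ (0 < L N)%N) ->
  M @ \oo --> \oo ->
  0 < c ->
  (fun N => (M N * L N)%:R / N%:R : R) @ \oo --> c ->
  (forall K (m : 'I_K),
     measurable_fun (`[0, 1] : set (measurableTypeR R)) (S K m)) ->
  (forall K (m : 'I_K) nu, nu \in `[0, 1] -> 0 < S K m nu) ->
  (exists C : R, forall K, (0 < K)%N ->
     (\esum_(n in [set: int])
        (Num.sqrt (K%:R^-1 *
           \sum_(m < K) normc (fourier_coef (S K m) n) ^+ 2))%:E <= C%:E)%E) ->
  (exists C : R, forall K (m : 'I_K) nu, nu \in `[0, 1] -> S K m nu <= C) ->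
  (exists2 C : R, 0 < C &
     forall K (m : 'I_K) nu, nu \in `[0, 1] -> C <= S K m nu) ->
  (forall N, (0 < N)%N ->
     circular_gaussian P
       (fun p : 'I_(M N) * 'I_(N + L N - 1) => w N p.1 p.2)) ->
  (forall N, (0 < N)%N ->
     forall (m m' : 'I_(M N)) (k k' : 'I_(N + L N - 1)),
       cexpectation P (fun t => w N m k t * (w N m' k' t)^*) =
       fourier_coef (S (M N) m) (k%:Z - k'%:Z) / N%:R * (m == m')%:R) ->
  (forall N, (0 < N)%N -> stieltjes_class (T N)) ->
  (forall N, (0 < N)%N -> stieltjes_class (Tt N)) ->
  (forall N, (0 < N)%N -> forall z : R[i], ~~ (0 <= z) ->
     T N z = - z^-1 *: invmx (1%:M + Psi (L N) (S (M N)) (Tt N z)^T)) ->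
  (forall N, (0 < N)%N -> forall z : R[i], ~~ (0 <= z) ->
     Tt N z = - z^-1 *: invmx (1%:M +
       ((M N * L N)%:R / N%:R) *: (Psibar N (S (M N)) (T N z))^T)) ->
  let Q N (t : Omega) := resolvent (L N) N (fun m n => w N m n t) in
  (forall A : forall N, 'M[R[i]]_(blockdim (M N) (L N)),
     (exists C : R, forall N, (0 < N)%N -> spectral_norm (A N) <= C) ->
     forall z : R[i], ~~ (0 <= z) ->
     {ae P, forall t,
        (fun N => (M N * L N)%:R^-1 * \tr ((Q N t z - T N z) *m A N) : R[i]^o)
          @ \oo --> (0 : R[i]^o)}) /\
  (forall z : R[i], ~~ (0 <= z) ->
     {ae P, forall t,
        (fun N => (M N * L N)%:R^-1 * \tr (Q N t z)
                  - (M N * L N)%:R^-1 * \tr (T N z) : R[i]^o)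
          @ \oo --> (0 : R[i]^o)}).
Proof.
move=> ML Moo _ cvgc mS S0 _ [Cs SC] _ gaussian cov hT hTt eqT eqTt Q.
have trace_cvg0 (A : forall N, 'M[R[i]]_(blockdim (M N) (L N))) :
    (exists C : R, forall N, (0 < N)%N -> spectral_norm (A N) <= C) ->
    forall z : R[i], ~~ (0 <= z) -> {ae P, forall t,
      (fun N => (M N * L N)%:R^-1 * \tr ((Q N t z - T N z) *m A N) : R[i]^o)
        @ \oo --> (0 : R[i]^o)}.
  move=> [a hA] z nz.
  (* The given bound may be 0 or, for N = 0, say nothing; a positive constant is needed in order to
     rescale A to norm at most 1. *)
  have a0 : 0 < `|a| + 1 by rewrite ltr_pwDr.
  have opA N : (0 < N)%N -> opb (`|a| + 1) (A N).
    move=> N0; apply: spectral_norm_opb; apply: (le_trans (hA N N0)).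
    by rewrite (le_trans (ler_norm a))// lerDl.
  exact: (trace_cvg ML Moo cvgc mS S0 SC gaussian cov hT hTt eqT eqTt a0 opA nz).
split=> // z nz.
have h1 : exists C : R, forall N, (0 < N)%N ->
    spectral_norm (1%:M : 'M[R[i]]_(blockdim (M N) (L N))) <= C.
  by exists 1 => N _; exact: spectral_norm_scalar1.
have := trace_cvg0 (fun N => 1%:M) h1 z nz; apply: filterS => t.
by under eq_fun do rewrite mulmx1 tr_sub mulrBr.
Qed.
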